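(* Let $n\ge2$ and let $\mathcal K_\gamma(\rho)$ be the kernel of $(-\Delta_{\mathbb H^n})^\gamma$ defined in the context. For $\gamma\in(-1/2,1)$ it holds, with a constant $\alpha_\gamma$, that: - for $n\ge3$ odd, $$\mathcal K_\gamma(\rho)=\alpha_\gamma\Bigl(\frac{\partial_\rho}{\sinh\rho}\Bigr)^{\frac{n-1}2}\Bigl[\rho^{-\frac12-\gamma}K_{-\frac12-\gamma}\bigl(\tfrac{n-1}2\rho\bigr)\Bigr];$$ - for $n\ge2$ even, $$\mathcal K_\gamma(\rho)=\alpha_\gamma\int_\rho^\infty\frac{\sinh r}{\sqrt{\cosh r-\cosh\rho}}\Bigl(\frac{\partial_r}{\sinh r}\Bigr)^{\frac n2}\Bigl[r^{-\frac12-\gamma}K_{-\frac12-\gamma}\bigl(\tfrac{n-1}2r\bigr)\Bigr]\,dr.$$ Here $K_{-\frac12-\gamma}$ is the modified Bessel function of the second kind of order $-\frac12-\gamma$. Additionally, $\mathcal K_\gamma(\rho)$ has the asymptotic behavior: (i) as $\rho\to0$, $\ \mathcal K_\gamma(\rho)\sim\rho^{-n-2\gamma}$; (ii) as $\rho\to\infty$, $\ \mathcal K_\gamma(\rho)\sim\rho^{-1-\gamma}e^{-(n-1)\rho}$.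
   Context: $\mathbb H^n=\{x\in\mathbb R^{n+1}: x_0^2-x_1^2-\dots-x_n^2=1,\ x_0>0\}$ with the metric induced by $-dx_0^2+dx_1^2+\dots+dx_n^2$, volume element $dx$, distance $d_{\mathbb H^n}$, and $[x,x']=x_0x_0'-x_1x_1'-\dots-x_nx_n'$. For $\lambda\in\mathbb R$, $\theta\in\mathbb S^{n-1}$ let $h_{\lambda,\theta}(x)=[x,(1,\theta)]^{i\lambda-\frac{n-1}2}$, a generalized eigenfunction: $\Delta_{\mathbb H^n}h_{\lambda,\theta}=-(\lambda^2+\frac{(n-1)^2}4)h_{\lambda,\theta}$. The Fourier transform is $\hat f(\lambda,\theta)=\int_{\mathbb H^n}f\,h_{\lambda,\theta}\,dx$, with inversion formula $f(x)=\int_{-\infty}^\infty\int_{\mathbb S^{n-1}}\bar h_{\lambda,\theta}(x)\hat f(\lambda,\theta)\frac{d\theta\,d\lambda}{|c(\lambda)|^2}$, where $c(\lambda)$ is the Harish-Chandra coefficient, $$\frac1{|c(\lambda)|^2}=\frac12\,\frac{|\Gamma(\frac{n-1}2)|^2}{|\Gamma(n-1)|^2}\,\frac{|\Gamma(i\lambda+\frac{n-1}2)|^2}{|\Gamma(i\lambda)|^2}.$$ Set $$k_\lambda(x,x')=\frac1{|c(\lambda)|^2}\int_{\mathbb S^{n-1}}\bar h_{\lambda,\theta}(x)h_{\lambda,\theta}(x')\,d\theta=k_\lambda(\rho),\qquad\rho=d_{\mathbb H^n}(x,x').$$ The formulas used for $k_\lambda$ are $k_\lambda(\rho)=\bigl(\frac{\partial_\rho}{\sinh\rho}\bigr)^{\frac{n-1}2}(\cos\lambda\rho)$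 for $n\ge3$ odd, and $k_\lambda(\rho)=\int_\rho^\infty\frac{\sinh r}{\sqrt{\cosh r-\cosh\rho}}\bigl(\frac{\partial_r}{\sinh r}\bigr)^{\frac n2}(\cos\lambda r)\,dr$ for $n\ge2$ even. Here $\frac{\partial_\rho}{\sinh\rho}$ means first the derivative $\partial_\rho$ and then multiplication by $\frac1{\sinh\rho}$. The fractional Laplacian $(-\Delta_{\mathbb H^n})^\gamma$ is the operator with $\widehat{(-\Delta_{\mathbb H^n})^\gamma f}=(\lambda^2+\frac{(n-1)^2}4)^\gamma\hat f$, and its (singular) kernel is $$\mathcal K_\gamma(\rho)=\int_{-\infty}^\infty\Bigl(\lambda^2+\tfrac{(n-1)^2}4\Bigr)^\gamma k_\lambda(\rho)\,d\lambda,$$ the integral being interpreted in the sense of distributions (through the distributional Fourier transform in $\lambda$ of $(\lambda^2+\frac{(n-1)^2}4)^\gamma$) in this range of $\gamma$. $K_\nu$ is the solution of $s^2\psi''+s\psi'-(s^2+\nu^2)\psi=0$ with $K_\nu(s)\sim\sqrt{\pi/(2s)}\,e^{-s}$ as $s\to+\infty$. In (i) and (ii), $\sim$ describes the asymptotic behavior with multiplicative constants omitted.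
   Formalization: The asymptotics (i) and (ii) are asserted with a nonzero constant only for γ ≠ 0: at γ = 0 the operator is the identity, its kernel vanishes for ρ > 0 and α_0 = 0, so (i) and (ii) fail there; the formulas are kept at γ = 0. *)

(* Defs.v *)
From HB Require Import structures.
From mathcomp Require Import all_boot all_order all_algebra.
From mathcomp Require Import all_classical all_reals all_analysis.

Set Implicit Arguments.
Unset Strict Implicit.
Unset Printing Implicit Defensive.

Import Order.TTheory GRing.Theory Num.Theory.
Import numFieldNormedType.Exports.

Local Open Scope classical_set_scope.
Local Open Scope ring_scope.

Definition cosh (R : realType) (x : R) : R := (expR x + expR (- x)) / 2.
Definition sinh (R : realType) (x : R) : R := (expR x - expR (- x)) / 2.

(* The operator d_rho / sinh rho: differentiate first, then divide. *)
Definition radial_deriv (R : realType) (g : R -> R) : R -> R :=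
  fun rho => derive1 g rho / sinh rho.

(* int_rho^oo sinh r / sqrt (cosh r - cosh rho) g(r) dr; the integrands used
   below are absolutely integrable, so a Lebesgue integral is adequate. *)
Definition abel_integral (R : realType) (g : R -> R) : R -> R :=
  fun rho =>
    \int[@lebesgue_measure R]_(r in `]rho, +oo[)
      (sinh r / Num.sqrt (cosh r - cosh rho) * g r).

(* k_lambda(rho) for H^n. The normalisation is the one of these closed
   formulas: the constant depending only on n that relates them to the integral
   of products of generalized eigenfunctions over the sphere is dropped. *)
Definition spectral_kernel (R : realType) (n : nat) (lambda : R) : R -> R :=
  if odd n
  then iter n.-1./2 (@radial_deriv R) (fun rho => cos (lambda * rho))
  else abel_integral (iter n./2 (@radial_deriv R) (fun r => cos (lambda * r))).

(* The symbol (lambda^2 + (n-1)^2/4)^gamma. *)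
Definition frac_symbol (R : realType) (n : nat) (gamma lambda : R) : R :=
  (lambda ^+ 2 + (n%:R - 1) ^+ 2 / 4) `^ gamma.

(* Smooth functions with compact support in the open half-line ]0, +oo[. *)
Definition test_function (R : realType) (phi : R -> R) : Prop :=
  (forall (m : nat) (x : R), derivable (derive1n m phi) x 1) /\
  (exists a b : R, 0 < a /\ forall x, phi x != 0 -> a <= x <= b).

(* The lambda-integrand of the pairing of K_gamma with phi: distributionally,
   <K_gamma, phi> = int symbol(lambda) <k_lambda, phi> d lambda. *)
Definition paired_integrand (R : realType) (n : nat) (gamma : R)
    (phi : R -> R) (lambda : R) : R :=
  frac_symbol n gamma lambda *
  \int[@lebesgue_measure R]_(rho in `]0, +oo[)
    (spectral_kernel n lambda rho * phi rho).

(* On ]0, +oo[ (off the diagonal) the distribution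
   K_gamma = int symbol(lambda) k_lambda d lambda is the continuous function K.
   This determines K on ]0, +oo[. At a fixed rho the lambda-integral is not
   absolutely convergent; it is so after pairing with phi. *)
Definition is_frac_laplacian_kernel (R : realType) (n : nat) (gamma : R)
    (K : R -> R) : Prop :=
  (forall rho : R, 0 < rho -> {for rho, continuous K}) /\
  (forall phi : R -> R, test_function phi ->
     (@lebesgue_measure R).-integrable setT
       (fun lambda => (paired_integrand n gamma phi lambda)%:E) /\
     \int[@lebesgue_measure R]_lambda paired_integrand n gamma phi lambda =
     \int[@lebesgue_measure R]_(rho in `]0, +oo[) (K rho * phi rho)).

Definition is_besselK (R : realType) (nu : R) (psi : R -> R) : Prop :=
  (forall s : R, 0 < s ->
     [/\ derivable psi s 1, derivable (derive1 psi) s 1 &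
         s ^+ 2 * derive1n 2 psi s + s * derive1 psi s - (s ^+ 2 + nu ^+ 2) * psi s = 0])
  /\ (psi s / (Num.sqrt (pi / (2 * s)) * expR (- s)) @[s --> +oo] --> (1 : R)).

(* The solution characterised by is_besselK, unique on ]0, +oo[ (its only
   meaningful domain). *)
Definition besselK (R : realType) (nu : R) : R -> R :=
  xget (fun=> 0) [set psi | is_besselK nu psi].

(* rho^(-1/2-gamma) K_(-1/2-gamma) ((n-1)/2 rho) *)
Definition bessel_profile (R : realType) (n : nat) (gamma : R) : R -> R :=
  fun rho => rho `^ (- (1 / 2) - gamma) *
             besselK (- (1 / 2) - gamma) ((n%:R - 1) / 2 * rho).

(* f / g tends along F to a constant, which is nonzero as soon as nz holds. *)
Definition equiv_upto_const (R : realType) (nz : Prop) (F : set_system R)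
    (f g : R -> R) : Prop :=
  exists c : R, (nz -> c != 0) /\ (f x / g x @[x --> F] --> c).

(* Main.v *)
Require Import Defs.
From mathcomp Require Import all_boot all_order all_algebra.
From mathcomp Require Import all_classical all_reals all_analysis.
From mathcomp Require Import measurable_realfun.
From HB Require Import structures.
From mathcomp Require Import ring lra.
Import Order.TTheory GRing.Theory Num.Theory.
Import numFieldNormedType.Exports.
Local Open Scope classical_set_scope.
Local Open Scope ring_scope.
Set Implicit Arguments.
Unset Strict Implicit.
Unset Printing Implicit Defensive.

(** The theorem reduces to one Fourier identity on the half-line. Put
    a = (n-1)/2, and let F(r) be the Laplace integral of (u^2-1)^gamma against
    exp(-a u r) over u > 1, written with u = 1 + t and called profile a gamma 0.
    It is a nonzero multiple of r^(-1/2-gamma) K_(-1/2-gamma)(a r): with the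
    right power and constant in front, the Laplace integral solves the Bessel
    equation and has the normalised behaviour at infinity, and a Wronskian
    argument makes such a solution unique (besselK_profile).

    The identity (cos_transform_symbol) says that, for h smooth, exponentially
    decaying and zero near 0, the integral over lambda > 0 of
    (lambda^2+a^2)^gamma times the cosine transform of h is a constant B times
    the integral of h F. For -1 < gamma < 0 the power (lambda^2+a^2)^gamma is a
    superposition of the Cauchy kernels 2k/(lambda^2+k^2), k = a(1+t), with
    weights (t(2+t))^gamma (stieltjes_transform), and a Cauchy kernel against
    cos(lambda r) integrates to pi exp(-k r) (cauchy_scaled); Fubini does the
    rest. For 0 <= gamma < 1 the identity is applied with gamma - 1 to
    a^2 h - h'', whose cosine transform is (lambda^2+a^2) times that of h; the
    boundary terms that the divergent case would produce are absent because h
    vanishes near 0. At gamma = 0 the constant B is 0.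

    The passage to hyperbolic space is a transposition. Let D = d/(sinh r dr).
    For n odd the spectral kernel and the kernel to be found are D^m of
    cos(lambda r) and of F; pairing D^m f with a test function phi gives the
    pairing of f with the m-th iterate on phi of the adjoint of D
    (int_iter_radial_deriv). For n even an Abel transform is applied after D^m,
    whose adjoint sends phi to sinh r times the integral of
    phi(x)/sqrt(cosh r - cosh x) (abel_transposition). That function is smooth
    because two integrations by parts replace the singular kernel by the 3/2
    power of cosh r - cosh x, on which d/dr acts as -sinh r times the adjoint of
    D on phi (is_derive_int_pow32), and it has the decay needed to continue with
    D^m (sinh_int_rsqrt_decaying). In both cases the pairing of phi with the
    spectral kernel is the cosine transform of an admissible h, the same h
    represents the pairing with the kernel built from F, and the identity gives
    the claim (radial_kernel_transposition, radial_kernel_pairing).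

    Asymptotics at 0 and at infinity are known for F with all its derivatives.
    A function together with the expected behaviour of its derivatives is called
    a jet; jets are stable under products, hence under D since 1/sinh has jets
    on every scale used. For n even, the substitutions r = rho + t and
    r = rho (1+t) turn the Abel transform into integrals over a fixed half-line
    to which dominated convergence applies (abel_asymp_pinfty,
    abel_asymp_zero). *)

(** * The fundamental theorem of calculus on open intervals *)

Notation mu := (@lebesgue_measure _).

Section exhaustion.
Context {R : realType}.
Implicit Types (f F : R -> R) (I : set R).

(** Each compact piece of an exhaustion carries the classical theorem; the lemmas of this section pass to the union, by monotone convergence for a nonnegative integrand and by dominated convergence for an integrable one. At the end points the primitive enters through its limits. *)
Lemma exhaustion_FTC f F (a b : nat -> R) I :
  (forall n, a n < b n) ->
  I = \bigcup_n `[a n, b n]%classic ->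
  (forall x, I x -> is_derive x 1 F (f x)) ->
  (forall x, I x -> {for x, continuous f}) ->
  forall n, (\int[mu]_(x in `[a n, b n]) (f x)%:E = (F (b n) - F (a n))%:E)%E.
Proof.
move=> ab IE dF cf n.
have sub x : x \in `[a n, b n] -> I x.
  by move=> xab; rewrite IE; exists n.
have subo x : x \in `]a n, b n[ -> I x.
  by rewrite in_itv/= => /andP[/ltW ax /ltW xb]; apply: sub; rewrite in_itv/= ax.
rewrite EFinB; apply: continuous_FTC2 => //.
- apply: continuous_in_subspaceT => x /set_mem/= xab.
  by apply: cf; exact: sub.
- have cF x : I x -> {for x, continuous F}.
    move=> Ix; apply: differentiable_continuous.
    by apply/derivable1_diffP; have [] := dF _ Ix.
  split.
  + by move=> x xab; have [] // := dF x (subo _ xab).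
  + apply: cvg_at_right_filter; apply: cF; apply: sub.
    by rewrite in_itv/= lexx ltW.
  + apply: cvg_at_left_filter; apply: cF; apply: sub.
    by rewrite in_itv/= lexx ltW.
- by move=> x xab; rewrite derive1E; have [_ ->] := dF x (subo _ xab).
Qed.

Variables (a b : nat -> R) (I : set R) (f F : R -> R) (l0 l : R).
Hypothesis ab : forall n, a n < b n.
Hypothesis aN : {homo a : n m / (n <= m)%N >-> n >= m}.
Hypothesis bN : {homo b : n m / (n <= m)%N >-> n <= m}.
Hypothesis IE : I = \bigcup_n `[a n, b n]%classic.
Hypothesis dF : forall x, I x -> is_derive x 1 F (f x).
Hypothesis cf : forall x, I x -> {for x, continuous f}.
Hypothesis Fa : F (a n) @[n --> \oo] --> l0.
Hypothesis Fb : F (b n) @[n --> \oo] --> l.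

Let A n := `[a n, b n]%classic.

Let Asub : {homo A : n m / (n <= m)%N >-> (n <= m)%O}.
Proof.
move=> n m nm; apply/subsetPset => x; rewrite /A/= !in_itv/= => /andP[ax xb].
by rewrite (le_trans _ ax) ?aN//= (le_trans xb) ?bN.
Qed.

Lemma measurable_exhaustion : measurable I.
Proof. by rewrite IE; apply: bigcup_measurable => n _; exact: measurable_itv. Qed.

Lemma exhaustion_measurable : measurable_fun I f.
Proof.
rewrite IE; apply/measurable_fun_bigcup => n; first exact: measurable_itv.
apply: subspace_continuous_measurable_fun; first exact: measurable_itv.
apply: continuous_in_subspaceT => x /set_mem/= xab.
by apply: cf; rewrite IE; exists n.
Qed.

Let cvgF : F (b n) - F (a n) @[n --> \oo] --> l - l0.
Proof. exact: cvgB. Qed.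

Lemma ge0_exhaustion_FTC : (forall x, I x -> 0 <= f x) ->
  (\int[mu]_(x in I) (f x)%:E = (l - l0)%:E)%E.
Proof.
move=> f0.
have /cvg_lim <- // : (\int[mu]_(x in A i) (f x)%:E)%E @[i --> \oo] --> (l - l0)%:E.
  under eq_cvg do rewrite (exhaustion_FTC ab IE dF cf).
  by apply: cvg_EFin => //; apply: nearW.
have := @ge0_nondecreasing_set_cvg_integral _ (measurableTypeR R) R A (EFin \o f) mu Asub.
rewrite -IE => h; apply/esym/cvg_lim => //; apply: h => [i|i|i x ix].
- exact: measurable_itv.
- apply/measurable_EFinP; apply: measurable_funS exhaustion_measurable.
    exact: measurable_exhaustion.
  by rewrite IE; exact: bigcup_sup.
- by rewrite lee_fin f0// IE; exists i.
Qed.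

Lemma ge0_exhaustion_integrable : (forall x, I x -> 0 <= f x) ->
  mu.-integrable I (EFin \o f).
Proof.
move=> f0; apply/integrableP; split.
  by apply/measurable_EFinP; exact: exhaustion_measurable.
under eq_integral => x /set_mem Ix.
  rewrite /= ger0_norm; last exact: f0.
  over.
by rewrite ge0_exhaustion_FTC// ltry.
Qed.

Lemma exhaustion_RFTC : mu.-integrable I (EFin \o f) ->
  \int[mu]_(x in I) f x = l - l0.
Proof.
move=> intf.
have mI := measurable_exhaustion.
have h : (\int[mu]_(x in A n) (f x)%:E)%E @[n --> \oo] --> (\int[mu]_(x in I) (f x)%:E)%E.
  have := @dominated_convergence _ (measurableTypeR R) R mu I mI (fun n => (EFin \o f) \_ (A n)) (EFin \o f) (fun x => `|(f x)%:E|%E).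
  case.
  - move=> n; apply/measurable_restrict => //; first exact: measurable_itv.
    apply/measurable_EFinP; apply: measurable_funS exhaustion_measurable => //.
  - by apply/measurable_EFinP; exact: exhaustion_measurable.
  - apply: aeW => x Ix; apply: cvg_near_cst.
    move: (Ix); rewrite IE => -[n _ xn]; exists n => // m /= nm.
    rewrite patchE mem_set//.
    by have /subsetPset := Asub nm; apply.
  - exact: integrable_abse.
  - apply: aeW => x n Ix; rewrite patchE; case: ifPn => // _.
    by rewrite abse0.
  move=> _ _; apply: cvg_trans; apply: near_eq_cvg; apply: nearW => n /=.
  rewrite -integral_mkcondr setIidr//.
  by rewrite IE; exact: bigcup_sup.
rewrite /Rintegral.
move: h; under eq_cvg do rewrite (exhaustion_FTC ab IE dF cf).
move=> /cvg_lim <- //.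
rewrite (_ : lim _ = (l - l0)%:E)//.
by apply/cvg_lim => //; apply: cvg_EFin => //; apply: nearW.
Qed.

End exhaustion.

Lemma nat_ge {R : realType} (x : R) : exists n : nat, x <= n%:R.
Proof.
exists (Num.bound `|x|); apply: (le_trans (ler_norm _)).
by apply/ltW/archi_boundP.
Qed.

Section FTC_open.
Context {R : realType}.
Variables (f F : R -> R) (a l0 l : R).

Section bounded.
Variable b : R.
Hypothesis ab : a < b.
Hypothesis dF : forall x, a < x < b -> is_derive x 1 F (f x).
Hypothesis cf : forall x, a < x < b -> {for x, continuous f}.
Hypothesis Fa : F x @[x --> a^'+] --> l0.
Hypothesis Fb : F x @[x --> b^'-] --> l.

Let u n := a + (b - a) / n.+3%:R.
Let v n := b - (b - a) / n.+3%:R.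

Let cvgd : (b - a) / n.+3%:R @[n --> \oo] --> (0 : R).
Proof.
rewrite -(mulr0 (b - a)); apply: cvgMr.
have := @cvg_harmonic R; rewrite -(cvg_shiftn 2); apply: cvg_trans.
by apply: near_eq_cvg; apply: nearW => n; rewrite /= addn2.
Qed.

Let d_gt0 n : 0 < (b - a) / n.+3%:R.
Proof. by rewrite divr_gt0// subr_gt0. Qed.

Let d_lt n : (b - a) / n.+3%:R + (b - a) / n.+3%:R < b - a.
Proof.
have n3 : (2 : R) < n.+3%:R by rewrite ltr_nat.
rewrite -mulrDl ltr_pdivrMr//; have : 0 < b - a by rewrite subr_gt0.
by nra.
Qed.

Let dN : {homo (fun n : nat => (b - a) / n.+3%:R) : n m / (n <= m)%N >-> n >= m}.
Proof.
move=> n m nm; rewrite ler_pM2l ?subr_gt0// lef_pV2 ?posrE//.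
by rewrite ler_nat !ltnS.
Qed.

Let uv n : u n < v n. Proof. by rewrite /u /v; move: (d_lt n); move: (_ / _) => d; lra. Qed.

Let uN : {homo u : n m / (n <= m)%N >-> n >= m}.
Proof. by move=> n m nm; rewrite lerD2l dN. Qed.

Let vN : {homo v : n m / (n <= m)%N >-> n <= m}.
Proof. by move=> n m nm; rewrite lerD2l lerN2 dN. Qed.

Let ooE : `]a, b[%classic = \bigcup_n `[u n, v n]%classic.
Proof.
apply/seteqP; split => x /=.
  rewrite in_itv/= => /andP[ax xb].
  have /cvgrPdist_lt/(_ (Num.min (x - a) (b - x))) := cvgd.
  rewrite lt_min !subr_gt0 ax xb => /(_ isT)[n _ /(_ n (leqnn n))].
  rewrite /= sub0r normrN ltr_norml lt_min => /andP[_ /andP[h1 h2]].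
  exists n => //=; rewrite in_itv/= /u /v; move: h1 h2; move: (_ / _) => d.
  by move=> *; apply/andP; split; lra.
move=> [n _]; rewrite /= !in_itv/= /u /v => /andP[h1 h2].
by move: (d_gt0 n) h1 h2; move: (_ / _) => d; lra.
Qed.

Let Fu : F (u n) @[n --> \oo] --> l0.
Proof.
move/cvg_at_rightP : Fa; apply; split => [n|].
  by rewrite /u ltrDl d_gt0.
by rewrite -[X in _ --> X]addr0; apply: cvgD => //; exact: cvg_cst.
Qed.

Let Fv : F (v n) @[n --> \oo] --> l.
Proof.
move/cvg_at_leftP : Fb; apply; split => [n|].
  by rewrite /v ltrBlDr ltrDl d_gt0.
by rewrite -[X in _ --> X]subr0; apply: cvgB => //; exact: cvg_cst.
Qed.

Lemma ge0_FTC_oo_integrable : (forall x, a < x < b -> 0 <= f x) ->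
  mu.-integrable `]a, b[ (EFin \o f).
Proof.
move=> f0; apply: (ge0_exhaustion_integrable uv uN vN ooE _ _ Fu Fv) => x /=;
  rewrite in_itv/=; auto.
Qed.

Lemma RFTC_oo : mu.-integrable `]a, b[ (EFin \o f) ->
  \int[mu]_(x in `]a, b[) f x = l - l0.
Proof.
move=> f0; apply: (exhaustion_RFTC uv uN vN ooE _ _ Fu Fv) => // x /=;
  rewrite in_itv/=; auto.
Qed.

End bounded.

Section unbounded.
Hypothesis dF : forall x, a < x -> is_derive x 1 F (f x).
Hypothesis cf : forall x, a < x -> {for x, continuous f}.
Hypothesis Fa : F x @[x --> a^'+] --> l0.
Hypothesis Fy : F x @[x --> +oo] --> l.

Let u n : R := a + n.+1%:R^-1.
Let v n : R := a + 1 + n.+1%:R.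

Let d_le1 n : n.+1%:R^-1 <= 1 :> R.
Proof. by rewrite invf_le1 ?ler1n. Qed.

Let d_gt0 n : 0 < n.+1%:R^-1 :> R.
Proof. by rewrite invr_gt0. Qed.

Let uv n : u n < v n.
Proof.
have : (0 : R) < n.+1%:R by [].
by rewrite /u /v; move: (d_le1 n); move: (n.+1%:R^-1 : R) (n.+1%:R : R) => d e; lra.
Qed.

Let uN : {homo u : n m / (n <= m)%N >-> n >= m}.
Proof. by move=> n m nm; rewrite lerD2l lef_pV2 ?posrE// ler_nat ltnS. Qed.

Let vN : {homo v : n m / (n <= m)%N >-> n <= m}.
Proof. by move=> n m nm; rewrite lerD2l ler_nat ltnS. Qed.

Let oyE : `]a, +oo[%classic = \bigcup_n `[u n, v n]%classic.
Proof.
apply/seteqP; split => x /=; last first.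
  move=> [n _]; rewrite /= !in_itv/= /u => /andP[h1 h2].
  by move: (d_gt0 n) h1; move: (n.+1%:R^-1 : R) => d; lra.
rewrite in_itv/= andbT => ax.
have [n nx] : exists n : nat, x - a - 1 <= n%:R.
  exact: nat_ge.
have [m mx] : exists m : nat, (x - a)^-1 <= m%:R.
  exact: nat_ge.
exists (maxn n m) => //=; rewrite in_itv/= /u /v.
have h1 : n%:R <= (maxn n m).+1%:R :> R by rewrite ler_nat leqW// leq_maxl.
have h2 : (maxn n m).+1%:R^-1 <= x - a.
  rewrite -[leRHS]invrK lef_pV2 ?posrE ?invr_gt0 ?subr_gt0//.
  by rewrite (le_trans mx)// ler_nat leqW// leq_maxr.
by move: h1 h2 nx; move: ((maxn n m).+1%:R^-1 : R) ((maxn n m).+1%:R : R) (n%:R : R) => d e k h1 h2 h3; apply/andP; split; lra.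
Qed.

Let Fu : F (u n) @[n --> \oo] --> l0.
Proof.
move/cvg_at_rightP : Fa; apply; split => [n|].
  by rewrite /u ltrDl.
rewrite -[X in _ --> X]addr0; apply: cvgD; [exact: cvg_cst|exact: cvg_harmonic].
Qed.

Let Fv : F (v n) @[n --> \oo] --> l.
Proof.
move/cvg_pinftyP : Fy; apply.
apply/cvgryPge => A; near=> n; rewrite /v -lerBlDl.
apply: (@le_trans _ _ n%:R); last by rewrite ler_nat.
by near: n; exact: nbhs_infty_ger.
Unshelve. all: by end_near. Qed.

Lemma ge0_FTC_oy : (forall x, a < x -> 0 <= f x) ->
  (\int[mu]_(x in `]a, +oo[) (f x)%:E = (l - l0)%:E)%E.
Proof.
move=> f0; apply: (ge0_exhaustion_FTC uv uN vN oyE _ _ Fu Fv) => x /=;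
  rewrite in_itv/= andbT; auto.
Qed.

Lemma ge0_FTC_oy_integrable : (forall x, a < x -> 0 <= f x) ->
  mu.-integrable `]a, +oo[ (EFin \o f).
Proof.
move=> f0; apply: (ge0_exhaustion_integrable uv uN vN oyE _ _ Fu Fv) => x /=;
  rewrite in_itv/= andbT; auto.
Qed.

Lemma RFTC_oy : mu.-integrable `]a, +oo[ (EFin \o f) ->
  \int[mu]_(x in `]a, +oo[) f x = l - l0.
Proof.
move=> f0; apply: (exhaustion_RFTC uv uN vN oyE _ _ Fu Fv) => // x /=;
  rewrite in_itv/= andbT; auto.
Qed.

End unbounded.
End FTC_open.

(** * Differentiation rules *)

Section derive_rules.
Context {R : realType}.
Implicit Types (f g : R -> R) (x a b c : R).

Lemma dcst c x : is_derive x 1 (fun _ : R => c) 0.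
Proof. exact: is_derive_cst. Qed.

Lemma did x : is_derive x 1 (fun y : R => y) 1.
Proof. exact: is_derive_id. Qed.

Lemma dadd f g x a b : is_derive x 1 f a -> is_derive x 1 g b ->
  is_derive x 1 (fun y => f y + g y) (a + b).
Proof. by move=> fa gb; exact: is_deriveD. Qed.

Lemma dopp f x a : is_derive x 1 f a -> is_derive x 1 (fun y => - f y) (- a).
Proof. by move=> fa; exact: is_deriveN. Qed.

Lemma dmul f g x a b : is_derive x 1 f a -> is_derive x 1 g b ->
  is_derive x 1 (fun y => f y * g y) (a * g x + f x * b).
Proof.
move=> fa gb; apply: (is_derive_eq (is_deriveM fa gb)).
by rewrite addrC; congr (_ + _); exact: mulrC.
Qed.

Lemma dinv f x a : f x != 0 -> is_derive x 1 f a ->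
  is_derive x 1 (fun y => (f y)^-1) (- a / f x ^+ 2).
Proof.
move=> fx fa; apply: (is_derive_eq (is_deriveV fx fa)).
by rewrite /GRing.scale/= !mulNr mulrC.
Qed.

Lemma dexpn f x a n : is_derive x 1 f a ->
  is_derive x 1 (fun y => f y ^+ n) (n%:R * f x ^+ n.-1 * a).
Proof.
move=> fa; rewrite (_ : (fun y => f y ^+ n) = f ^+ n).
  exact: (is_deriveX n fa).
by apply/funext => y; rewrite exprfctE.
Qed.

Lemma dcomp f g x a b : is_derive (g x) 1 f a -> is_derive x 1 g b ->
  is_derive x 1 (fun y => f (g y)) (a * b).
Proof. exact: is_derive1_comp. Qed.

Lemma dexp f x a : is_derive x 1 f a ->
  is_derive x 1 (fun y => expR (f y)) (expR (f x) * a).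
Proof. by move=> fa; apply: dcomp => //; exact: is_derive_expR. Qed.

Lemma dcos f x a : is_derive x 1 f a ->
  is_derive x 1 (fun y => cos (f y)) (- sin (f x) * a).
Proof. by move=> fa; apply: dcomp => //; exact: is_derive_cos. Qed.

Lemma dsin f x a : is_derive x 1 f a ->
  is_derive x 1 (fun y => sin (f y)) (cos (f x) * a).
Proof. by move=> fa; apply: dcomp => //; exact: is_derive_sin. Qed.

Lemma dpowR f x a p : 0 < f x -> is_derive x 1 f a ->
  is_derive x 1 (fun y => f y `^ p) (p * f x `^ (p - 1) * a).
Proof.
by move=> f0 fa; exact: (@dcomp (fun z => z `^ p) _ _ _ _ (is_derive1_powR p f0) fa).
Qed.

Lemma dsqrt f x a : 0 < f x -> is_derive x 1 f a ->
  is_derive x 1 (fun y => Num.sqrt (f y)) (a / (2 * Num.sqrt (f x))).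
Proof.
move=> f0 fa; rewrite mulrC.
exact: (@dcomp (fun z => Num.sqrt z) _ _ _ _ (is_derive1_sqrt f0) fa).
Qed.

Lemma is_derive_continuous f x a : is_derive x 1 f a -> {for x, continuous f}.
Proof.
move=> fa; apply: differentiable_continuous.
by apply/derivable1_diffP; case: fa.
Qed.

Lemma is_derive_derive1 f x a : is_derive x 1 f a -> derive1 f x = a.
Proof. by move=> fa; rewrite derive1E; case: fa. Qed.

Lemma derivable_is_derive f x : derivable f x 1 -> is_derive x 1 f (derive1 f x).
Proof. by move=> df; split => //; rewrite derive1E. Qed.

End derive_rules.

Ltac derive_rule :=
  first [exact (did _) | exact (dcst _ _) |
  lazymatch goal with
  | |- is_derive _ _ (fun y => @?f y + @?g y) _ =>
      eapply (@dadd _ f g); [derive_rule | derive_rule]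
  | |- is_derive _ _ (fun y => - (@?f y)) _ => eapply (@dopp _ f); derive_rule
  | |- is_derive _ _ (fun y => @?f y * @?g y) _ =>
      eapply (@dmul _ f g); [derive_rule | derive_rule]
  | |- is_derive _ _ (fun y => (@?f y)^-1) _ =>
      eapply (@dinv _ f); [|derive_rule]
  | |- is_derive _ _ (fun y => (@?f y) ^+ ?n) _ =>
      eapply (@dexpn _ f); derive_rule
  | |- is_derive _ _ (fun y => expR (@?f y)) _ => eapply (@dexp _ f); derive_rule
  | |- is_derive _ _ (fun y => cos (@?f y)) _ => eapply (@dcos _ f); derive_rule
  | |- is_derive _ _ (fun y => sin (@?f y)) _ => eapply (@dsin _ f); derive_rule
  | |- is_derive _ _ (fun y => (@?f y) `^ ?p) _ =>
      eapply (@dpowR _ f); [|derive_rule]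
  | |- is_derive _ _ (fun y => Num.sqrt (@?f y)) _ =>
      eapply (@dsqrt _ f); [|derive_rule]
  | _ => eassumption
  end].

(** * Domination and Beta integrals *)

Section real_integrals.
Context {R : realType}.
Implicit Types (f g : R -> R) (D : set R).

Lemma dominated_integrable D f g : measurable D -> measurable_fun D f ->
  (forall x, D x -> `|f x| <= g x) ->
  mu.-integrable D (EFin \o g) -> mu.-integrable D (EFin \o f).
Proof.
move=> mD mf fg ig; apply: (@le_integrable _ (measurableTypeR R) R mu D mD _ (EFin \o g)) => //.
  exact/measurable_EFinP.
move=> x Dx /=; rewrite lee_fin (le_trans (fg _ Dx))//.
exact: ler_norm.
Qed.

Lemma continuous_measurable_oy a f : (forall x, a < x -> {for x, continuous f}) ->
  measurable_fun `]a, +oo[ f.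
Proof.
move=> cf; apply: open_continuous_measurable_fun.
  exact: interval_open.
by move=> x /set_mem; rewrite /= in_itv/= andbT; exact: cf.
Qed.

Lemma integrable_scale D f k : measurable D ->
  mu.-integrable D (EFin \o f) -> mu.-integrable D (fun x => (k * f x)%:E).
Proof. by move=> mD fi; exact: (@integrableZl _ (measurableTypeR R) R mu D mD k (EFin \o f)). Qed.

Lemma powR_add (x p q : R) : 0 < x -> x `^ (p + q) = x `^ p * x `^ q.
Proof. by move=> x0; rewrite powRD// (gt_eqF x0) implybT. Qed.

Lemma powR_div (x y p : R) : 0 < x -> 0 < y -> (x / y) `^ p = x `^ p / y `^ p.
Proof.
move=> x0 y0; rewrite powRM ?invr_ge0 ?ltW// -powR_inv1 ?ltW// -powRrM mulN1r.
by rewrite powRN.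
Qed.

Lemma powR_continuous (x p : R) : 0 < x -> {for x, continuous (fun z : R => z `^ p)}.
Proof. by move=> x0; eapply is_derive_continuous; exact: is_derive1_powR. Qed.

Lemma cvg_comp_for (T : Type) (F : set_system T) (h : R -> R)
    (f : T -> R) (a : R) : f x @[x --> F] --> a -> {for a, continuous h} ->
  h (f x) @[x --> F] --> h a.
Proof. by move=> fa ha; exact: (cvg_comp _ _ fa ha). Qed.

Lemma cvg_onem_inv : t / (1 + t) @[t --> +oo] --> (1 : R).
Proof.
apply/cvgrPdist_lt => e e0; near=> t.
have t0 : 0 < t by near: t; exact: nbhs_pinfty_gt.
have te : e^-1 < t by near: t; apply: nbhs_pinfty_gt; exact: num_real.
have t1 : 0 < 1 + t by lra.
rewrite (_ : 1 - t / (1 + t) = (1 + t)^-1); last by field; rewrite gt_eqF.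
rewrite gtr0_norm ?invr_gt0//.
by rewrite -[ltRHS]invrK ltf_pV2 ?posrE ?invr_gt0//; lra.
Unshelve. all: by end_near. Qed.

Lemma integrable_sub D f g : measurable D -> mu.-integrable D (EFin \o f) ->
  mu.-integrable D (EFin \o g) -> mu.-integrable D (fun x => (f x - g x)%:E).
Proof.
move=> mD fi gi.
exact: (@integrableB _ (measurableTypeR R) R mu D mD (EFin \o f) (EFin \o g)).
Qed.

Lemma integrable_add D f g : measurable D -> mu.-integrable D (EFin \o f) ->
  mu.-integrable D (EFin \o g) -> mu.-integrable D (fun x => (f x + g x)%:E).
Proof.
move=> mD fi gi.
exact: (@integrableD _ (measurableTypeR R) R mu D mD (EFin \o f) (EFin \o g)).
Qed.

(** The function (t/(1+t))^(p+1)/(p+1) is a primitive, with limits 0 and 1/(p+1). This integrand serves as the universal majorant for algebraic singularities at 0. *)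
Lemma beta_integrable (p : R) : -1 < p ->
  mu.-integrable `]0, +oo[ (fun t => (t `^ p * (1 + t) `^ (- p - 2))%:E).
Proof.
move=> p1.
have p0 : p + 1 != 0 by apply/eqP; lra.
pose F (t : R) := (p + 1)^-1 * (t / (1 + t)) `^ (p + 1).
apply: (@ge0_FTC_oy_integrable _ (fun t => t `^ p * (1 + t) `^ (- p - 2)) F 0 0 (p + 1)^-1).
- move=> x x0; have x1 : 0 < 1 + x by lra.
  rewrite /F; apply: is_derive_eq; first derive_rule.
  + exact: divr_gt0.
  + by rewrite gt_eqF.
  rewrite (_ : p + 1 - 1 = p); last by ring.
  rewrite !powR_div// (@powR_add _ (- p))// !powRN (@powR_mulrn _ _ 2) ?ltW//.
  field; rewrite p0 !gt_eqF ?powR_gt0//.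
- move=> x x0; have x1 : 0 < 1 + x by lra.
  by eapply is_derive_continuous; derive_rule.
- rewrite -[X in _ --> X](mulr0 (p + 1)^-1) /F; apply: cvgMr.
  apply: (@squeeze_cvgr _ _ _ _ (cst 0) (fun t => t `^ (p + 1))).
  + near=> t; have t0 : 0 < t by near: t; exact: nbhs_right_gt.
    have t1 : 0 < 1 + t by lra.
    rewrite /= powR_ge0/= ge0_ler_powR ?nnegrE ?divr_ge0 ?ltW//; first by lra.
    by rewrite ltr_pdivrMr//; nra.
  + exact: cvg_cst.
  + by apply: powR_cvg0; lra.
- rewrite -[X in _ --> X]mulr1 /F; apply: cvgMr.
  rewrite -[X in _ --> X](_ : 1 `^ (p + 1) = 1); last by rewrite powR1.
  by apply: (cvg_comp_for (h := fun z => z `^ (p + 1)) cvg_onem_inv); exact: powR_continuous.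
- by move=> x x0; rewrite mulr_ge0// powR_ge0.
Unshelve. all: by end_near. Qed.

End real_integrals.

(** * Limits under the integral, affine substitution, Fubini *)

(** Compare with one term of the exponential series at c(1+t). *)
Lemma powR_le_expR {R : realType} (q c : R) : 0 < c ->
  exists2 C : R, 0 < C & forall t, 0 <= t -> (1 + t) `^ q <= C * expR (c * t).
Proof.
move=> c0; have [n nq] := nat_ge q.
pose C := (n.+1)`!%:R / c ^+ n.+1 * expR c.
exists C; first by rewrite mulr_gt0 ?expR_gt0// divr_gt0 ?exprn_gt0// ltr0n fact_gt0.
move=> t t0.
have t1 : 1 <= 1 + t by lra.
apply: (@le_trans _ _ ((1 + t) `^ n.+1%:R)).
  by apply: ler_powR => //; rewrite (le_trans nq)// ler_nat.
rewrite powR_mulrn; last by lra.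
rewrite (_ : C * _ = (n.+1)`!%:R / c ^+ n.+1 * expR (c * (1 + t))); last first.
  by rewrite mulrDr mulr1 expRD /C mulrA.
have := @expR_ge1Dxn _ (c * (1 + t)) n (mulr_ge0 (ltW c0) (le_trans ler01 t1)).
rewrite exprMn; set e := expR _; set f := (n.+1)`!%:R => h.
have f0 : (0 : R) < f by rewrite ltr0n fact_gt0.
have cn : 0 < c ^+ n.+1 by rewrite exprn_gt0.
rewrite mulrAC ler_pdivlMr// mulrC -ler_pdivrMl// mulrC.
apply: (le_trans _ h); rewrite (mulrC (c ^+ _)) (mulrC _ f^-1).
by rewrite -[leLHS]add0r lerD2r.
Qed.

Section dominated_convergence.
Context d (T : measurableType d) (R : realType).
Variables (m : {measure set T -> \bar R}) (D : set T).
Hypothesis mD : measurable D.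

Lemma Rdominated_cvg (f_ : nat -> T -> R) (f g : T -> R) :
  (forall n, measurable_fun D (f_ n)) ->
  (forall x, D x -> f_ n x @[n --> \oo] --> f x) ->
  m.-integrable D (EFin \o g) ->
  (forall n x, D x -> `|f_ n x| <= g x) ->
  \int[m]_(x in D) f_ n x @[n --> \oo] --> \int[m]_(x in D) f x.
Proof.
move=> mf cf ig fg.
have mf' : measurable_fun D f by apply: (measurable_fun_cvg mf cf).
have := @dominated_convergence _ _ _ m D mD (fun n => EFin \o f_ n) (EFin \o f) (EFin \o g).
case => //.
- by move=> n; exact/measurable_EFinP.
- exact/measurable_EFinP.
- apply: aeW => x Dx; apply: cvg_EFin; first by apply: nearW.
  exact: cf.
- by apply: aeW => x n Dx /=; rewrite lee_fin fg.
move=> intf _ h; apply/fine_cvg; move: h.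
rewrite /= => h; rewrite fineK//; exact: integrable_fin_num.
Qed.

(** Dominated convergence is available for sequences. A filter whose limits can be tested along sequences inherits it; this is the case of the three filters used below. *)
Definition sequential (F : set_system R) := forall (h : R -> R) (l : R),
  (forall u : nat -> R, u n @[n --> \oo] --> F -> h (u n) @[n --> \oo] --> l) ->
  h x @[x --> F] --> l.

Lemma dominated_cvg_filter (F : set_system R) (f : R -> T -> R) (h g : T -> R) :
  Filter F -> sequential F ->
  (\forall x \near F, measurable_fun D (f x)) ->
  (forall t, D t -> f x t @[x --> F] --> h t) ->
  m.-integrable D (EFin \o g) ->
  (\forall x \near F, forall t, D t -> `|f x t| <= g t) ->
  \int[m]_(t in D) f x t @[x --> F] --> \int[m]_(t in D) h t.
Proof.
move=> FF sF mf cf ig fg; apply: sF => u uF.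
have [N _ HN] : \forall n \near \oo, measurable_fun D (f (u n)) /\
    forall t, D t -> `|f (u n) t| <= g t.
  by apply: (uF (fun x => measurable_fun D (f x) /\ forall t, D t -> `|f x t| <= g t)); near do split.
rewrite -(cvg_shiftn N).
apply: (@Rdominated_cvg (fun n => f (u (n + N)%N)) h g) => //.
- by move=> n; have [] := HN (n + N)%N (leq_addl _ _).
- move=> x Dx.
  have : f (u n) x @[n --> \oo] --> h x by apply: cvg_comp (cf _ Dx).
  by rewrite -(cvg_shiftn N).
- by move=> n x Dx; have [_] := HN (n + N)%N (leq_addl _ _); apply.
Unshelve. all: by end_near. Qed.

End dominated_convergence.

Section sequential_filters.
Context {R : realType}.

Lemma sequential_nbhs (x : R) : sequential (nbhs x).
Proof. by move=> h l H; apply/(@cvg_nbhsP _ R^o). Qed.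

Lemma sequential_pinfty : sequential (+oo_R).
Proof. by move=> h l H; apply/cvg_pinftyP. Qed.

Lemma sequential_at_right (x : R) : sequential (x^'+).
Proof.
move=> h l H; apply/cvg_at_rightP => u [ux uc]; apply: H.
move=> A /= xA; have : \forall n \near \oo, x < u n -> A (u n) := uc _ xA.
by apply: filterS => n; apply.
Qed.

End sequential_filters.

Section affine_substitution.
Context {R : realType}.
Variables (x k : R).
Hypothesis k0 : 0 < k.

Let phi (t : R) : R := x + k * t.

Let mphi : measurable_fun setT (phi : measurableTypeR R -> measurableTypeR R).
Proof.
apply: continuous_measurable_fun => t; apply: cvgD; first exact: cvg_cst.
by apply: cvgMr; exact: cvg_id.
Qed.

Let k_ge0 : 0 <= k. Proof. exact: ltW. Qed.

Let pf : {measure set (measurableTypeR R) -> \bar R} :=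
  measure_function_pushforward__canonical__measure_function_Measure
    (@lebesgue_measure R) mphi.

Let m : {measure set (measurableTypeR R) -> \bar R} := mscale (NngNum k_ge0) pf.

Let lebesgueE (A : set R) : measurable A -> m A = (@lebesgue_measure R) A.
Proof.
move=> mA; apply/esym/lebesgue_measure_unique => //= _ [[a b]] _ <-.
have preE : phi @^-1` `]a, b]%classic = `](a - x) / k, (b - x) / k]%classic.
  apply/seteqP; split => t /=; rewrite !in_itv/= /phi ltr_pdivrMr// ler_pdivlMr// mulrC;
  by move=> /andP[? ?]; apply/andP; split; lra.
transitivity (k%:E * (@lebesgue_measure R) (phi @^-1` `]a, b]%classic))%E => //.
rewrite preE !lebesgue_measure_itv/= !lte_fin ltr_pM2r ?invr_gt0// ltrD2r.
case: ifPn => // _; last by rewrite mule0.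
by rewrite -!EFinB -EFinM; congr EFin; field; rewrite gt_eqF.
Qed.

Let preoy : phi @^-1` `]x, +oo[%classic = `]0, +oo[%classic.
Proof.
apply/seteqP; split => t /=; rewrite !in_itv/= !andbT /phi;
  by rewrite ltrDl pmulr_rgt0.
Qed.

(** The scaled push-forward of Lebesgue measure under t -> x + k t agrees with Lebesgue measure on half-open intervals, hence everywhere. *)
Lemma ge0_integral_affine (f : R -> \bar R) :
  measurable_fun `]x, +oo[ f -> (forall r, x < r -> (0 <= f r)%E) ->
  (\int[mu]_(r in `]x, +oo[) f r =
   k%:E * \int[mu]_(t in `]0%R, +oo[) f (x + k * t)%R)%E.
Proof.
move=> mf f0.
transitivity (\int[m]_(r in `]x, +oo[) f r)%E.
  by apply: eq_measure_integral => A mA _; rewrite lebesgueE.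
rewrite ge0_integral_mscale//=; last first.
  by move=> r; rewrite /= in_itv/= andbT; exact: f0.
congr (_ * _)%E.
transitivity (\int[mu]_(t in phi @^-1` `]x, +oo[) (f \o phi) t)%E; last by rewrite preoy.
apply: (@ge0_integral_pushforward _ _ _ _ _ _ mphi) => //.
by move=> r; rewrite inE/= in_itv/= andbT; exact: f0.
Qed.

Let kB (A B : \bar R) : (k%:E * (A - B) = k%:E * A - k%:E * B)%E.
Proof.
have k1 : (0%R < k%:E)%E by rewrite lte_fin.
case: A B => [a| |] [b| |]; rewrite /= ?(gt0_muley, gt0_muleNy)//.
by rewrite -EFinB -!EFinM -EFinB mulrBr.
Qed.

Lemma integral_affine (f : R -> \bar R) : measurable_fun `]x, +oo[ f ->
  (\int[mu]_(r in `]x, +oo[) f r =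
   k%:E * \int[mu]_(t in `]0%R, +oo[) f (x + k * t)%R)%E.
Proof.
move=> mf; rewrite integralE.
have := ge0_integral_affine (measurable_funepos mf).
move=> -> //.
have := ge0_integral_affine (measurable_funeneg mf).
move=> -> //.
rewrite -kB; congr (_ * _)%E; rewrite [RHS]integralE.
by congr (_ - _)%E; apply: eq_integral => t _; rewrite ?(funeposE, funenegE).
Qed.

Lemma measurable_affine (f : R -> R) : measurable_fun `]x, +oo[ f ->
  measurable_fun `](0 : R), +oo[ (fun t => f (x + k * t)).
Proof.
move=> mf.
apply: (@measurable_comp _ _ _ (measurableTypeR R) (measurableTypeR R) _ `]x, +oo[%classic f _ phi) => //.
  move=> _ /= [t t0 <-]; move: t0; rewrite /= !in_itv/= !andbT => t0.
  by rewrite /phi ltrDl mulr_gt0.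
by apply: measurable_funTS.
Qed.

Lemma integrable_affine (f : R -> R) : mu.-integrable `]x, +oo[ (EFin \o f) ->
  mu.-integrable `]0, +oo[ (fun t => (f (x + k * t))%:E).
Proof.
move=> /integrableP[mf fi]; apply/integrableP; split.
  by apply/measurable_EFinP; apply: measurable_affine; exact/measurable_EFinP.
move: fi; rewrite (integral_affine (f := fun r => `|(EFin \o f) r|%E)).
  case: (integral _ _ _) => [r _| |_]; [by rewrite ltry| |by []].
  by rewrite gt0_muley ?lte_fin.
exact: measurableT_comp.
Qed.

Lemma Rintegral_affine (f : R -> R) : measurable_fun `]x, +oo[ f ->
  \int[mu]_(r in `]x, +oo[) f r = k * \int[mu]_(t in `]0, +oo[) f (x + k * t).
Proof.
move=> mf; rewrite /Rintegral integral_affine; last exact/measurable_EFinP.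
case: (integral _ _ _) => [r| |] //=.
  by rewrite gt0_muley ?lte_fin//= mulr0.
by rewrite gt0_muleNy ?lte_fin//= mulr0.
Qed.

End affine_substitution.

Section fubini_real.
Context {R : realType}.
Implicit Types (D E : set R).
Local Notation T := (measurableTypeR R).

Variables (D E : set R) (f : R -> R -> R) (G : R -> R).
Hypothesis mD : measurable (D : set T).
Hypothesis mE : measurable (E : set T).
Hypothesis mf : measurable_fun (D `*` E : set (T * T)) (fun z : T * T => f z.1 z.2).
Hypothesis iG : mu.-integrable D (EFin \o G).
Hypothesis ifE : forall x, D x -> mu.-integrable E (EFin \o f x).
Hypothesis fG : forall x, D x -> \int[mu]_(y in E) `|f x y| <= G x.

Let F : T * T -> \bar R := (fun z => (f z.1 z.2)%:E) \_ (D `*` E).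

Let mF : measurable_fun setT F.
Proof.
apply/(measurable_restrictT _ _).1; first exact: measurableX.
exact/measurable_EFinP.
Qed.

Let int_F x : (\int[mu]_y `|F (x, y)| =
  (if x \in D then \int[mu]_(y in E) `|f x y|%:E else 0))%E.
Proof.
case: ifPn => xD.
  rewrite [RHS]integral_mkcond; apply: eq_integral => y _.
  rewrite /F /patch in_setX xD/=.
  by case: ifPn => // _; exact: abse0.
rewrite -[RHS](@integral0 _ _ _ mu setT); apply: eq_integral => y _.
by rewrite /F /patch in_setX (negbTE xD)/=; exact: abse0.
Qed.

(** Tonelli reduces integrability on the product to the bound G on the inner integrals of the absolute value. *)
Lemma integrable_prod : (mu \x mu)%E.-integrable setT F.
Proof.
apply/integrable12ltyP => //.
apply: (@le_lt_trans _ _ (\int[mu]_(x in D) `|(G x)%:E|)%E); last first.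
  by move/integrableP : iG => [].
rewrite [leRHS]integral_mkcond; apply: ge0_le_integral => //.
- by move=> x _; exact: integral_ge0.
- apply: (measurable_fun_fubini_tonelli_F (abse \o F)) => //=.
  exact: measurableT_comp.
- apply/(measurable_restrictT _ _).1 => //.
  by apply: measurableT_comp => //; exact: (measurable_int _ iG).
- move=> x _; rewrite int_F patchE; case: ifPn => // /set_mem Dx.
  have iabs : mu.-integrable E (EFin \o (fun y => `|f x y|)).
    exact: (@integrable_norm _ T R mu E (f x) (ifE Dx)).
  apply: (@le_trans _ _ (G x)%:E); last by rewrite lee_fin ler_norm.
  rewrite -[leLHS]fineK; last exact: integrable_fin_num iabs.
  by rewrite lee_fin; exact: fG.
Qed.

Let F1 x : D x -> (\int[mu]_y F (x, y) = (\int[mu]_(y in E) f x y)%:E)%E.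
Proof.
move=> Dx; rewrite fineK; last exact: integrable_fin_num (ifE Dx).
rewrite [RHS]integral_mkcond; apply: eq_integral => y _.
by rewrite /F /patch in_setX mem_set.
Qed.

Let F1N x : ~ D x -> (\int[mu]_y F (x, y) = 0)%E.
Proof.
move=> Dx; rewrite -[RHS](@integral0 _ _ _ mu setT); apply: eq_integral => y _.
by rewrite /F /patch in_setX memNset.
Qed.

Let F2 y : E y -> (\int[mu]_x F (x, y) = \int[mu]_(x in D) (f x y)%:E)%E.
Proof.
move=> Ey; rewrite [RHS]integral_mkcond; apply: eq_integral => x _.
by rewrite /F /patch in_setX (mem_set Ey) andbT.
Qed.

Let F2N y : ~ E y -> (\int[mu]_x F (x, y) = 0)%E.
Proof.
move=> Ey; rewrite -[RHS](@integral0 _ _ _ mu setT); apply: eq_integral => x _.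
by rewrite /F /patch in_setX (memNset Ey) andbF.
Qed.

Lemma integrable_Rintegral1 : mu.-integrable D (fun x => (\int[mu]_(y in E) f x y)%:E).
Proof.
apply: (eq_integrable mD (fun x => \int[mu]_y F (x, y))%E).
  by move=> x /set_mem Dx; rewrite F1.
apply: (integrableS measurableT) => //.
exact: (integrable_fubini_F integrable_prod).
Qed.

(** The outer integral on the right is taken of real numbers, so the inner integrals may fail to be finite on a null set; there the two integrands differ, which does not change the integral. *)
Lemma RFubini : \int[mu]_(x in D) (\int[mu]_(y in E) f x y) =
  \int[mu]_(y in E) (\int[mu]_(x in D) f x y).
Proof.
have := Fubini integrable_prod => eqF.
rewrite {1}/Rintegral [X in fine X = _](_ : _ = \int[mu]_x \int[mu]_y F (x, y))%E; last first.
  rewrite integral_mkcond; apply: eq_integral => x _; rewrite patchE.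
  by case: ifPn => [/set_mem Dx|/negP xD]; [rewrite F1|rewrite F1N// => /mem_set].
rewrite eqF {eqF} [in RHS]/Rintegral; congr fine.
have mG : measurable_fun setT (fun y => \int[mu]_x F (x, y))%E.
  exact: measurable_fubini_G integrable_prod.
rewrite [RHS]integral_mkcond.
apply: ae_eq_integral => //.
- apply/(measurable_restrictT _ _).1 => //; apply/measurable_EFinP.
  apply: (eq_measurable_fun (fun y => fine (\int[mu]_x F (x, y))%E)).
    by move=> y /set_mem Ey; rewrite F2.
  apply: measurable_funTS; apply: measurableT_comp => //.
- have := ae_integrable2 integrable_prod.
  apply: filterS => y /(integrable_fin_num measurableT) h _; rewrite patchE.
  case: ifPn => [/set_mem Ey|/negP yE]; last by rewrite F2N// => /mem_set.
  by rewrite F2// /Rintegral fineK// -F2.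
Qed.

End fubini_real.

(** * Prescribed behaviour of all derivatives *)

Section jets.
Context {R : realType}.
Implicit Types (f g : R -> R) (c d L M s : R) (Q : R -> R -> (R -> R) -> Prop).

(** Along N derivatives, Q c L f is to persist with c increased by s and L multiplied by -c at each step. With Q saying that f behaves like L r^(-c) at 0 one takes s = 1, with Q saying that f behaves like L exp(-c r) at infinity one takes s = 0: the rule is formal differentiation of the leading term in both cases. *)
Fixpoint jet Q s N c L f : Prop :=
  if N is N'.+1 then
    [/\ Q c L f, forall x : R, 0 < x -> derivable f x 1 &
        jet Q s N' (c + s) (- (c * L)) (derive1 f)]
  else Q c L f.

Definition jet_compat Q := [/\
  forall c L f g, (forall x : R, 0 < x -> f x = g x) -> Q c L f -> Q c L g,
  forall c L M f g, Q c L f -> Q c M g -> Q c (L + M) (fun x => f x + g x) &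
  forall c L f, Q c L f -> Q c (- L) (fun x => - f x)].

Definition jet_mulcompat Q1 Q2 Q3 := forall c d L M f g,
  Q1 c L f -> Q2 d M g -> Q3 (c + d) (L * M) (fun x => f x * g x).

Lemma near_pos (x : R) f g : 0 < x -> (forall y : R, 0 < y -> f y = g y) ->
  \forall y \near x, f y = g y.
Proof. by move=> x0 fg; near=> y; apply: fg; near: y; exact: lt_nbhsr. Unshelve. all: by end_near. Qed.

Lemma derivable_ext f g x : (forall y : R, 0 < y -> f y = g y) -> 0 < x ->
  derivable f x 1 -> derivable g x 1.
Proof. by move=> fg x0; apply: near_eq_derivable; exact: near_pos. Qed.

Lemma derive1_ext f g x : (forall y : R, 0 < y -> f y = g y) -> 0 < x ->
  derive1 f x = derive1 g x.
Proof.
move=> fg x0; rewrite !derive1E; apply: near_eq_derive.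
exact: near_pos.
Qed.

Lemma jet_weaken Q s N c L f : jet Q s N.+1 c L f -> jet Q s N c L f.
Proof. by elim: N c L f => [|N IH] c L f [Qf df jf] //=; split => //; exact: IH. Qed.

Lemma jet0 Q s N c L f : jet Q s N c L f -> Q c L f.
Proof. by case: N => [|N] //= []. Qed.

Lemma jet_leq Q s N N' c L f : (N <= N')%N -> jet Q s N' c L f -> jet Q s N c L f.
Proof.
move=> /subnKC <-; elim: (N' - N)%N => [|k IH]; first by rewrite addn0.
by rewrite addnS => /jet_weaken.
Qed.

Lemma jet_ext Q s N c L f g : jet_compat Q ->
  (forall x : R, 0 < x -> f x = g x) -> jet Q s N c L f -> jet Q s N c L g.
Proof.
move=> [Qe _ _]; elim: N c L f g => [|N IH] c L f g fg /=; first exact: Qe.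
move=> [Qf df jf]; split; first exact: Qe Qf.
- by move=> x x0; apply: (derivable_ext fg) => //; exact: df.
- by apply: IH jf => x x0; exact: derive1_ext.
Qed.

Lemma jet_step Q s N c L f f' : jet_compat Q -> Q c L f ->
  (forall x : R, 0 < x -> is_derive x 1 f (f' x)) ->
  jet Q s N (c + s) (- (c * L)) f' -> jet Q s N.+1 c L f.
Proof.
move=> cQ Qf df jf; split => // [x x0|]; first by have [] := df _ x0.
by apply: jet_ext jf => // x x0; rewrite (is_derive_derive1 (df _ x0)).
Qed.

Lemma jet_derive Q s N c L f : jet Q s N.+1 c L f ->
  forall x : R, 0 < x -> is_derive x 1 f (derive1 f x).
Proof. by move=> [_ df _] x x0; apply: derivable_is_derive; exact: df. Qed.

Lemma jet_add Q s N c L M f g : jet_compat Q ->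
  jet Q s N c L f -> jet Q s N c M g ->
  jet Q s N c (L + M) (fun x => f x + g x).
Proof.
move=> cQ; have [Qe Qa _] := cQ.
elim: N c L M f g => [|N IH] c L M f g /=; first exact: Qa.
move=> jf jg.
apply: (@jet_step _ _ _ _ _ _ (fun x => derive1 f x + derive1 g x)) => //.
- by apply: Qa; [case: jf|case: jg].
- by move=> x x0; apply: dadd; [exact: jet_derive jf _ x0|exact: jet_derive jg _ x0].
- rewrite mulrDr opprD; apply: IH; [by case: jf|by case: jg].
Qed.

Lemma jet_opp Q s N c L f : jet_compat Q ->
  jet Q s N c L f -> jet Q s N c (- L) (fun x => - f x).
Proof.
move=> cQ; have [Qe _ Qo] := cQ.
elim: N c L f => [|N IH] c L f /=; first exact: Qo.
move=> jf; apply: (@jet_step _ _ _ _ _ _ (fun x => - derive1 f x)) => //.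
- by apply: Qo; case: jf.
- by move=> x x0; apply: dopp; exact: jet_derive jf _ x0.
- by rewrite mulrN; apply: IH; case: jf.
Qed.

(** By Leibniz, the leading terms (c, L) and (d, M) of the factors give (c + d, L M), and -cLM - LdM = -(c+d)LM, so that the product obeys the rule of jets again. *)
Lemma jet_mul Q1 Q2 Q3 s N c d L M f g : jet_compat Q3 ->
  jet_mulcompat Q1 Q2 Q3 -> jet Q1 s N c L f -> jet Q2 s N d M g ->
  jet Q3 s N (c + d) (L * M) (fun x => f x * g x).
Proof.
move=> cQ Qm.
elim: N c d L M f g => [|N IH] c d L M f g; first exact: Qm.
move=> jf jg.
apply: (@jet_step _ _ _ _ _ _ (fun x => derive1 f x * g x + f x * derive1 g x)).
- exact: cQ.
- by apply: Qm; [case: jf|case: jg].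
- by move=> x x0; apply: dmul; [exact: jet_derive jf _ x0|exact: jet_derive jg _ x0].
- rewrite (_ : - _ = - (c * L) * M + L * - (d * M)); last by ring.
  apply: jet_add => //.
  + rewrite addrAC; apply: IH; first by case: jf.
    exact: jet_weaken.
  + rewrite -addrA; apply: IH; last by case: jg.
    exact: jet_weaken.
Qed.

End jets.

Section hyperbolic.
Context {R : realType}.
Implicit Types x : R.

Lemma is_derive_sinh x : is_derive x 1 (@sinh R) (cosh x).
Proof.
rewrite /sinh; eapply is_derive_eq; first derive_rule.
by rewrite /cosh; ring.
Qed.

Lemma is_derive_cosh x : is_derive x 1 (@cosh R) (sinh x).
Proof.
rewrite /cosh; eapply is_derive_eq; first derive_rule.
by rewrite /sinh; ring.
Qed.

Lemma sinh_gt0 x : 0 < x -> 0 < sinh x.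
Proof. by move=> x0; rewrite /sinh divr_gt0// subr_gt0 ltr_expR; lra. Qed.

Lemma cosh_ge1 x : 1 <= cosh x.
Proof.
rewrite /cosh ler_pdivlMr// expRN; have := expR_gt0 x; move: (expR x) => e e0.
rewrite -(ler_pM2r e0) mulrDl mulVf ?gt_eqF//.
by have := sqr_ge0 (e - 1); rewrite expr2; nra.
Qed.

Lemma is_derive_csch x : 0 < x ->
  is_derive x 1 (fun y : R => (sinh y)^-1) (- (cosh x * (sinh x)^-1 * (sinh x)^-1)).
Proof.
move=> x0; have s0 : sinh x != 0 by rewrite gt_eqF// sinh_gt0.
apply: (is_derive_eq (dinv s0 (is_derive_sinh x))).
by field.
Qed.

(** The derivative of 1/sinh is -cosh/sinh^2, a product of functions whose jets of one order less are known, which closes the induction. *)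
Lemma jet_csch Q s c0 L0 M : jet_compat Q -> jet_mulcompat Q Q Q ->
  (forall N, jet Q s N c0 L0 (@cosh R)) -> Q 1 M (fun y : R => (sinh y)^-1) ->
  c0 + 1 = s -> L0 * M * M = M ->
  forall N, jet Q s N 1 M (fun y : R => (sinh y)^-1).
Proof.
move=> cQ mQ jc Qs c0s LM; elim => [//|N IH].
apply: (jet_step cQ Qs) => [x x0|]; first exact: is_derive_csch.
rewrite (_ : 1 + s = c0 + 1 + 1); last by rewrite -c0s; ring.
rewrite mul1r -[in - M]LM; apply: jet_opp => //; apply: jet_mul (mQ) _ (IH) => //.
exact: jet_mul (mQ) (jc N) (IH).
Qed.

Lemma jet_radial_deriv Q1 Q2 s N c L M (f : R -> R) : jet_compat Q1 ->
  jet_mulcompat Q1 Q2 Q1 ->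
  (forall N, jet Q2 s N 1 M (fun y : R => (sinh y)^-1)) ->
  jet Q1 s N.+1 c L f -> jet Q1 s N (c + s + 1) (- (c * L) * M) (radial_deriv f).
Proof. by move=> c1 m12 js [_ _ jf]; exact: jet_mul m12 jf (js N). Qed.

(** Differentiation contributes the factor -c and the shift s, division by sinh the factor M and the shift 1. The leading coefficient stays nonzero because the exponents met on the way are positive. *)
Lemma jet_iter_radial_deriv Q1 Q2 s M m N c L (f : R -> R) : jet_compat Q1 ->
  jet_mulcompat Q1 Q2 Q1 ->
  (forall N, jet Q2 s N 1 M (fun y : R => (sinh y)^-1)) ->
  jet Q1 s (N + m) c L f ->
  exists L', (0 <= s -> M != 0 -> 0 < c -> L != 0 -> L' != 0) /\
    jet Q1 s N (c + m%:R * (s + 1)) L' (iter m (@radial_deriv R) f).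
Proof.
move=> c1 m12 js; elim: m N => [|m IH] N.
  by rewrite addn0 => jf; exists L; split => //; rewrite mul0r addr0.
rewrite addnS -addSn => /IH [L' [L'0 jf]].
exists (- ((c + m%:R * (s + 1)) * L') * M); split.
  move=> s0 M0 c_gt0 L0; rewrite mulf_neq0// oppr_eq0 mulf_neq0 ?L'0//.
  by rewrite gt_eqF// ltr_wpDr// mulr_ge0//; lra.
rewrite (_ : c + _ = c + m%:R * (s + 1) + s + 1); last by rewrite -natr1; ring.
exact: (jet_radial_deriv c1 m12 js jf).
Qed.

End hyperbolic.

(** * The three scales of behaviour *)

Section jet_instances.
Context {R : realType}.
Implicit Types (f g w : R -> R) (c d L M : R).

(** Decay at infinity, uniform on every half-line away from 0, with no control of the constant as delta tends to 0. *)
Definition exp_bounded c L f := forall delta : R, 0 < delta ->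
  exists C : R, forall r : R, delta <= r -> `|f r| <= C * expR (- (c * r)).

Definition asymp_pinfty w c L f := f r * expR (c * r) / w r @[r --> +oo] --> L.

Definition asymp_zero c L f := f r * r `^ c @[r --> 0^'+] --> L.

Lemma exp_bounded_compat : jet_compat exp_bounded.
Proof.
split.
- move=> c L f g fg Hf delta d0; have [C HC] := Hf _ d0; exists C => r dr.
  by rewrite -fg ?HC// (lt_le_trans d0).
- move=> c L M f g Hf Hg delta d0; have [C HC] := Hf _ d0; have [D HD] := Hg _ d0.
  exists (C + D) => r dr; rewrite mulrDl (le_trans (ler_normD _ _))// lerD ?HC ?HD//.
- move=> c L f Hf delta d0; have [C HC] := Hf _ d0; exists C => r dr.
  by rewrite normrN HC.
Qed.

Lemma exp_bounded_mul : jet_mulcompat exp_bounded exp_bounded exp_bounded.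
Proof.
move=> c d L M f g Hf Hg delta d0; have [C HC] := Hf _ d0; have [D HD] := Hg _ d0.
exists (C * D) => r dr; rewrite mulrDl opprD expRD mulrACA normrM.
by apply: ler_pM => //; [exact: HC|exact: HD].
Qed.

Lemma asymp_pinfty_compat w : jet_compat (asymp_pinfty w).
Proof.
rewrite /asymp_pinfty; split.
- move=> c L f g fg; apply: cvg_trans; apply: near_eq_cvg; near=> r.
  by rewrite fg//; near: r; exact: nbhs_pinfty_gt.
- move=> c L M f g Hf Hg; apply: (cvg_trans _ (cvgD Hf Hg)).
  by apply: near_eq_cvg; apply: nearW => r /=; rewrite -!mulrDl.
- move=> c L f Hf; apply: (cvg_trans _ (cvgN Hf)).
  by apply: near_eq_cvg; apply: nearW => r /=; rewrite -!mulNr.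
Unshelve. all: by end_near. Qed.

Lemma asymp_pinfty_mul w :
  jet_mulcompat (asymp_pinfty w) (asymp_pinfty (fun=> 1)) (asymp_pinfty w).
Proof.
rewrite /asymp_pinfty => c d L M f g Hf Hg.
apply: (cvg_trans _ (cvgM Hf Hg)); apply: near_eq_cvg; apply: nearW => r /=.
by rewrite mulrDl expRD invr1 mulr1; ring.
Qed.

Lemma asymp_zero_compat : jet_compat asymp_zero.
Proof.
rewrite /asymp_zero; split.
- move=> c L f g fg; apply: cvg_trans; apply: near_eq_cvg; near=> r.
  by rewrite fg//; near: r; exact: nbhs_right_gt.
- move=> c L M f g Hf Hg; apply: (cvg_trans _ (cvgD Hf Hg)).
  by apply: near_eq_cvg; apply: nearW => r /=; rewrite -!mulrDl.
- move=> c L f Hf; apply: (cvg_trans _ (cvgN Hf)).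
  by apply: near_eq_cvg; apply: nearW => r /=; rewrite -!mulNr.
Unshelve. all: by end_near. Qed.

Lemma asymp_zero_mul : jet_mulcompat asymp_zero asymp_zero asymp_zero.
Proof.
rewrite /asymp_zero => c d L M f g Hf Hg.
apply: (cvg_trans _ (cvgM Hf Hg)); apply: near_eq_cvg; near=> r.
have r0 : 0 < r by near: r; exact: nbhs_right_gt.
by rewrite /= powR_add//; ring.
Unshelve. all: by end_near. Qed.

Lemma cosh_bounds (r : R) : 0 <= r -> `|cosh r| <= expR r /\ `|sinh r| <= expR r.
Proof.
move=> r0; have e1 := expR_gt0 r; have e2 := expR_gt0 (- r).
have e3 : expR (- r) <= expR r by rewrite ler_expR; lra.
by rewrite /cosh /sinh !ger0_norm; lra.
Qed.

Lemma exp_bounded_cosh_sinh N L :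
  jet exp_bounded 0 N (-1) L (@cosh R) /\ jet exp_bounded 0 N (-1) L (@sinh R).
Proof.
have Qc l : exp_bounded (-1) l (@cosh R).
  move=> delta d0; exists 1 => r dr; rewrite mul1r mulN1r opprK.
  by have [] := @cosh_bounds r (ltW (lt_le_trans d0 dr)).
have Qs l : exp_bounded (-1) l (@sinh R).
  move=> delta d0; exists 1 => r dr; rewrite mul1r mulN1r opprK.
  by have [] := @cosh_bounds r (ltW (lt_le_trans d0 dr)).
elim: N L => [|N IH] L; first by split; [exact: Qc|exact: Qs].
split.
- apply: (jet_step exp_bounded_compat (Qc _) (f' := @sinh R)) => // [x _|].
    exact: is_derive_cosh.
  by rewrite addr0; have [] := IH (- (-1 * L)).
- apply: (jet_step exp_bounded_compat (Qs _) (f' := @cosh R)) => // [x _|].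
    exact: is_derive_sinh.
  by rewrite addr0; have [] := IH (- (-1 * L)).
Qed.

Lemma exp_bounded_jet_irrel s N c L M f :
  jet exp_bounded s N c L f -> jet exp_bounded s N c M f.
Proof.
elim: N c L M f => [|N IH] c L M f //= [Qf df jf]; split => //; exact: IH jf.
Qed.

Lemma exp_bounded_jet_mul N c d e L f g : e = c + d ->
  jet exp_bounded 0 N c 0 f -> jet exp_bounded 0 N d 0 g ->
  jet exp_bounded 0 N e L (fun x => f x * g x).
Proof.
move=> -> jf jg; apply: (@exp_bounded_jet_irrel _ _ _ (0 * 0)).
exact: (jet_mul exp_bounded_compat exp_bounded_mul jf jg).
Qed.

Lemma expR_small (delta r : R) : delta <= r ->
  expR r - expR (- r) >= (1 - expR (- (2 * delta))) * expR r.
Proof.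
move=> dr; rewrite mulrBl mul1r lerD2l lerN2 -expRD ler_expR; lra.
Qed.

Lemma exp_bounded_csch N L : jet exp_bounded 0 N 1 L (fun y : R => (sinh y)^-1).
Proof.
have cE := exp_bounded_compat.
apply: (@exp_bounded_jet_irrel _ _ _ 0).
apply: (jet_csch (c0 := -1) (L0 := 0) cE exp_bounded_mul); [| |by ring|by ring].
  by move=> k; have [] := exp_bounded_cosh_sinh k 0.
move=> delta d0; set q := 1 - expR (- (2 * delta)).
have q0 : 0 < q by rewrite subr_gt0 expR_lt1; lra.
exists (2 / q) => r dr; have r0 : 0 < r by exact: lt_le_trans dr.
have s0 := sinh_gt0 r0; have e0 := expR_gt0 r.
rewrite mul1r expRN gtr0_norm ?invr_gt0//.
rewrite (_ : 2 / q * _ = (q * expR r / 2)^-1); last by field; rewrite !gt_eqF.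
rewrite lef_pV2 ?posrE//; last by rewrite divr_gt0 ?mulr_gt0.
by have := expR_small dr; rewrite -/q /sinh; lra.
Qed.

Lemma cvg_expRN2 : expR (- r) * expR (- r) @[r --> +oo] --> (0 : R).
Proof. by rewrite -[X in _ --> X](mul0r 0); apply: cvgM; exact: cvgr_expR. Qed.

Lemma asymp_pinfty_cosh_sinh N :
  jet (asymp_pinfty (fun=> 1)) 0 N (-1) (1 / 2) (@cosh R) /\
  jet (asymp_pinfty (fun=> 1)) 0 N (-1) (1 / 2) (@sinh R).
Proof.
have Qc : asymp_pinfty (fun=> 1) (-1) (1 / 2) (@cosh R).
  have h : 1 / 2 * (1 + expR (- r) * expR (- r)) @[r --> +oo] --> (1 / 2 * (1 + 0) : R).
    by apply: cvgMr; apply: cvgD; [exact: cvg_cst|exact: cvg_expRN2].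
  rewrite addr0 mulr1 in h; apply: cvg_trans h.
  apply: near_eq_cvg; apply: nearW => r; rewrite /cosh mulN1r divr1.
    have : expR r * expR (- r) = 1 by rewrite expRN mulfV// gt_eqF// expR_gt0.
    by move: (expR r) (expR (- r)) => e d ed; nra.
have Qs : asymp_pinfty (fun=> 1) (-1) (1 / 2) (@sinh R).
  have h : 1 / 2 * (1 - expR (- r) * expR (- r)) @[r --> +oo] --> (1 / 2 * (1 - 0) : R).
    by apply: cvgMr; apply: cvgB; [exact: cvg_cst|exact: cvg_expRN2].
  rewrite subr0 mulr1 in h; apply: cvg_trans h.
  apply: near_eq_cvg; apply: nearW => r; rewrite /sinh mulN1r divr1.
    have : expR r * expR (- r) = 1 by rewrite expRN mulfV// gt_eqF// expR_gt0.
    by move: (expR r) (expR (- r)) => e d ed; nra.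
elim: N => [|N [jc js]]; first by [].
split.
- apply: (jet_step (asymp_pinfty_compat _) Qc (f' := @sinh R)) => // [x _|].
    exact: is_derive_cosh.
  by rewrite addr0 mulN1r opprK.
- apply: (jet_step (asymp_pinfty_compat _) Qs (f' := @cosh R)) => // [x _|].
    exact: is_derive_sinh.
  by rewrite addr0 mulN1r opprK.
Qed.

Lemma asymp_pinfty_csch N :
  jet (asymp_pinfty (fun=> 1)) 0 N 1 2 (fun y : R => (sinh y)^-1).
Proof.
apply: (jet_csch (c0 := -1) (L0 := 1 / 2) (asymp_pinfty_compat _) (@asymp_pinfty_mul _));
  [| |by ring|by field].
  by move=> k; have [] := asymp_pinfty_cosh_sinh k.
have /jet0 := (asymp_pinfty_cosh_sinh 0).2; rewrite /asymp_pinfty => /cvgV.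
have h2 : (1 / 2 : R) != 0 by rewrite mul1r invr_eq0 pnatr_eq0.
move=> /(_ h2); rewrite mul1r invrK; apply: cvg_trans.
apply: near_eq_cvg; near=> r; rewrite /= mulN1r !divr1 mul1r invfM.
by rewrite -expRN opprK.
Unshelve. all: by end_near. Qed.

Lemma sinh_cosh0 : @sinh R 0 = 0 /\ @cosh R 0 = 1.
Proof. by rewrite /sinh /cosh oppr0 expR0 subrr mul0r; split => //; field. Qed.

Lemma continuous_sinh : continuous (@sinh R).
Proof. by move=> x; eapply is_derive_continuous; exact: is_derive_sinh. Qed.

Lemma continuous_cosh : continuous (@cosh R).
Proof. by move=> x; eapply is_derive_continuous; exact: is_derive_cosh. Qed.

Lemma cvg_sinh0 : sinh r @[r --> 0^'+] --> (0 : R).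
Proof.
have := cvg_at_right_filter (@continuous_sinh 0).
by rewrite sinh_cosh0.1.
Qed.

Lemma cvg_cosh0 : cosh r @[r --> 0^'+] --> (1 : R).
Proof.
have := cvg_at_right_filter (@continuous_cosh 0).
by rewrite sinh_cosh0.2.
Qed.

Lemma asymp_zero_pow c (f : R -> R) : 0 < c -> {for 0, continuous f} ->
  asymp_zero c 0 f.
Proof.
move=> c0 cf; rewrite /asymp_zero -[X in _ --> X](mulr0 (f 0)).
by apply: cvgM; [exact: cvg_at_right_filter|exact: powR_cvg0].
Qed.

Lemma asymp_zero_cosh_sinh_gt0 N c : 0 < c ->
  jet asymp_zero 1 N c 0 (@cosh R) /\ jet asymp_zero 1 N c 0 (@sinh R).
Proof.
elim: N c => [|N IH] c c0.
  split; apply: asymp_zero_pow => //; eapply is_derive_continuous.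
    exact: is_derive_cosh.
  exact: is_derive_sinh.
have [jc js] := IH _ (addr_gt0 c0 ltr01); have [qc qs] := IH _ c0.
split.
- apply: (jet_step asymp_zero_compat (jet0 qc) (f' := @sinh R)) => // [x _|].
    exact: is_derive_cosh.
  by rewrite mulr0 oppr0.
- apply: (jet_step asymp_zero_compat (jet0 qs) (f' := @cosh R)) => // [x _|].
    exact: is_derive_sinh.
  by rewrite mulr0 oppr0.
Qed.

Lemma asymp_zero_cosh N : jet asymp_zero 1 N 0 1 (@cosh R).
Proof.
have Qc : asymp_zero 0 1 (@cosh R).
  rewrite /asymp_zero; under eq_cvg do rewrite powRr0 mulr1.
  exact: cvg_cosh0.
case: N => // N; apply: (jet_step asymp_zero_compat Qc (f' := @sinh R)) => // [x _|].
  exact: is_derive_cosh.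
rewrite mul0r oppr0 add0r; exact: (asymp_zero_cosh_sinh_gt0 _ _).2.
Qed.

Lemma cvg_sinh_div : sinh r / r @[r --> 0^'+] --> (1 : R).
Proof.
rewrite -[X in _ --> X](divr1).
apply: (@lhopital_at_right _ (@sinh R) (@cosh R) id (fun=> 1) 0 1 _ ltr01).
- by move=> x _; exact: is_derive_sinh.
- exact: cvg_sinh0.
- by apply: cvg_at_right_filter; exact: cvg_id.
- by move=> x _; exact: oner_neq0.
- by under eq_cvg do rewrite divr1; rewrite divr1; exact: cvg_cosh0.
Qed.

Lemma asymp_zero_csch N : jet asymp_zero 1 N 1 1 (fun y : R => (sinh y)^-1).
Proof.
apply: (jet_csch (c0 := 0) (L0 := 1) asymp_zero_compat asymp_zero_mul);
  [| |by ring|by ring].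
- exact: asymp_zero_cosh.
- have h : (sinh r / r)^-1 @[r --> 0^'+] --> (1^-1 : R).
    by apply: cvgV; [exact: oner_neq0|exact: cvg_sinh_div].
  rewrite invr1 in h; rewrite /asymp_zero; move: h.
  apply: cvg_trans; apply: near_eq_cvg; near=> r => /=.
  by rewrite invf_div mulrC powRr1// ltW.
Unshelve. all: by end_near. Qed.

Lemma exp_bounded_cst k N L : jet exp_bounded 0 N 0 L (fun _ : R => k).
Proof.
have Qk k' l : exp_bounded 0 l (fun _ : R => k').
  by move=> delta _; exists `|k'| => r _; rewrite mul0r oppr0 expR0 mulr1.
elim: N k L => [|N IH] k L; first exact: Qk.
apply: (jet_step exp_bounded_compat (Qk k L) (f' := fun=> 0)).
by rewrite addr0.
Qed.

Lemma exp_bounded_trig lam N L :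
  jet exp_bounded 0 N 0 L (fun r : R => cos (lam * r)) /\
  jet exp_bounded 0 N 0 L (fun r : R => sin (lam * r)).
Proof.
have Qc l : exp_bounded 0 l (fun r : R => cos (lam * r)).
  move=> delta _; exists 1 => r _; rewrite mul0r oppr0 expR0 mulr1.
  by rewrite ler_norml cos_geN1 cos_le1.
have Qs l : exp_bounded 0 l (fun r : R => sin (lam * r)).
  move=> delta _; exists 1 => r _; rewrite mul0r oppr0 expR0 mulr1.
  by rewrite ler_norml sin_geN1 sin_le1.
have cE := exp_bounded_compat.
elim: N L => [|N IH] L; first by split; [exact: Qc|exact: Qs].
split.
- apply: (jet_step cE (Qc _) (f' := fun r => - (sin (lam * r) * lam))) => [x _|].
    eapply is_derive_eq; first derive_rule.
    by rewrite mul0r add0r mulr1 mulNr.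
  rewrite addr0; apply: jet_opp => //.
  apply: (exp_bounded_jet_mul _ _ (IH _).2 (exp_bounded_cst lam _ 0)).
  by rewrite addr0.
- apply: (jet_step cE (Qs _) (f' := fun r => cos (lam * r) * lam)) => [x _|].
    eapply is_derive_eq; first derive_rule.
    by rewrite mul0r add0r mulr1.
  by apply: (exp_bounded_jet_mul _ _ (IH _).1 (exp_bounded_cst lam _ 0)).
Qed.

End jet_instances.

(** * Gamma integrals *)

Section gamma_integrals.
Context {R : realType}.
Implicit Types (a c g p q r t : R).

Lemma poly_exp_integrable p q c : -1 < p -> 0 < c ->
  mu.-integrable `]0, +oo[ (fun t => (t `^ p * (1 + t) `^ q * expR (- (c * t)))%:E).
Proof.
move=> p1 c0; have [C C0 HC] := powR_le_expR (q + p + 2) c0.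
apply: (dominated_integrable (g := fun t => C * (t `^ p * (1 + t) `^ (- p - 2)))) => //.
- apply: continuous_measurable_oy => t t0; have t1 : 0 < 1 + t by lra.
  by eapply is_derive_continuous; derive_rule.
- move=> t; rewrite /= in_itv/= andbT => t0; have t1 : 0 < 1 + t by lra.
  rewrite ger0_norm ?mulr_ge0 ?powR_ge0 ?expR_ge0//.
  rewrite mulrCA -mulrA ler_wpM2l ?powR_ge0//.
  have := HC _ (ltW t0).
  rewrite (_ : q + p + 2 = q - (- p - 2)); last by ring.
  rewrite powR_add// powRN ler_pdivrMr ?powR_gt0// => h.
  by rewrite expRN ler_pdivrMr ?expR_gt0// (le_trans h)// mulrAC.
- exact/integrable_scale/beta_integrable.
Qed.

Lemma gamma_integrable p c : -1 < p -> 0 < c ->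
  mu.-integrable `]0, +oo[ (fun t => (t `^ p * expR (- (c * t)))%:E).
Proof.
move=> p1 c0; apply: eq_integrable (poly_exp_integrable 0 p1 c0) => //.
by move=> t _; rewrite powRr0 mulr1.
Qed.

Definition gamma_int p c := \int[mu]_(t in `]0, +oo[) (t `^ p * expR (- (c * t))).

Lemma cvg_right_for (f : R -> R) (x : R) : {for x, continuous f} ->
  f y @[y --> x^'+] --> f x.
Proof. by move=> cf; exact: cvg_at_right_filter. Qed.

Lemma cvg_pow_expN p c : 0 < c -> t `^ p * expR (- (c * t)) @[t --> +oo] --> (0 : R).
Proof.
move=> c0; have c2 : 0 < c / 2 by lra.
have [C C0 HC] := powR_le_expR `|p| c2.
have h : C * expR (- (c / 2 * t)) @[t --> +oo] --> (0 : R).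
  rewrite -[X in _ --> X](mulr0 C); apply: cvgMr.
  apply: (cvg_comp (fun t => c / 2 * t) (fun t => expR (- t))); last exact: cvgr_expR.
  exact: gt0_cvgMry.
apply: (@squeeze_cvgr _ _ _ _ (cst 0)) h; last exact: cvg_cst.
near=> t.
have t1 : 1 <= t by near: t; exact: nbhs_pinfty_ge.
rewrite /= mulr_ge0 ?powR_ge0 ?expR_ge0//=.
have tp : t `^ p <= (1 + t) `^ `|p|.
  apply: (@le_trans _ _ (t `^ `|p|)); first by apply: ler_powR => //; exact: ler_norm.
  by apply: ge0_ler_powR; rewrite ?nnegrE//; lra.
apply: (@le_trans _ _ (C * expR (c / 2 * t) * expR (- (c * t)))).
  by rewrite ler_wpM2r ?expR_ge0// (le_trans tp)// HC//; lra.
by rewrite -mulrA -expRD ler_pM2l// ler_expR; lra.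
Unshelve. all: by end_near. Qed.

(** Integration by parts: the derivative of t^(p+1) exp(-c t) integrates to 0. *)
Lemma gamma_int_rec p c : -1 < p -> 0 < c ->
  (p + 1) * gamma_int p c = c * gamma_int (p + 1) c.
Proof.
move=> p1 c0; have p2 : -1 < p + 1 by lra.
have i1 := integrable_scale (p + 1) (measurable_itv _) (gamma_integrable p1 c0).
have i2 := integrable_scale c (measurable_itv _) (gamma_integrable p2 c0).
apply/eqP; rewrite -subr_eq0 /gamma_int -!RintegralZl//; try exact: gamma_integrable.
rewrite -RintegralB//; apply/eqP.
rewrite -[RHS](subrr 0).
apply: (@RFTC_oy _ _ (fun t => t `^ (p + 1) * expR (- (c * t))) 0 0 0).
- move=> t t0; eapply is_derive_eq; first by derive_rule.
  by rewrite (_ : p + 1 - 1 = p); [ring|ring].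
- move=> t t0; eapply is_derive_continuous; by derive_rule.
- rewrite -[X in _ --> X](mul0r (expR (- (c * 0)))); apply: cvgM.
    by apply: powR_cvg0; lra.
  apply: (cvg_right_for (f := fun t => expR (- (c * t)))).
  eapply is_derive_continuous; by derive_rule.
- exact: cvg_pow_expN.
- exact: integrable_sub.
Qed.

(** An integral equal to 0 would force the integrand to vanish almost everywhere on a set of infinite measure. *)
Lemma Rintegral_oy_gt0 (f : R -> R) : (forall t, 0 < t -> 0 < f t) ->
  mu.-integrable `]0, +oo[ (EFin \o f) -> 0 < \int[mu]_(t in `]0, +oo[) f t.
Proof.
move=> f0 fi; rewrite lt_neqAle Rintegral_ge0 ?andbT; last first.
  by move=> t; rewrite /= in_itv/= andbT => /f0/ltW.
apply/eqP => /esym f_eq0.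
have : (\int[mu]_(t in `]0%R, +oo[) `|(f t)%:E| = 0)%E.
  transitivity (\int[mu]_(t in `]0%R, +oo[) (f t)%:E)%E.
    by apply: eq_integral => t /set_mem; rewrite /= in_itv/= andbT => /f0 ft; rewrite gtr0_norm.
  rewrite -[LHS]fineK; last exact: integrable_fin_num fi.
  by congr EFin.
move/ae_eq_integral_abs => /(_ (measurable_itv _) (measurable_int _ fi)).
move=> [N [mN N0 sub]].
have : (mu (`](0%R : R), +oo[%classic) <= mu N)%E.
  apply: le_measure; rewrite ?inE//.
  move=> t /= t0; apply: sub => /= /(_ t0) [] ft.
  by have := f0 t; rewrite ft ltxx => /(_ _)/negP; move: t0; rewrite in_itv/= andbT => t0 /(_ t0).
by rewrite N0 lebesgue_measure_itv/= ltry.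
Qed.
End gamma_integrals.

(** * The Laplace integral behind the Bessel function *)

Section under_integral.
Context {R : realType}.

(** The mean value theorem bounds the difference quotients by G, so that dominated convergence applies to them. *)
Lemma is_derive_under_integral (D : set R) (f f' : R -> R -> R) (a u v : R)
    (G : R -> R) : measurable D -> u < a < v ->
  (forall x : R, u < x < v -> mu.-integrable D (EFin \o f x)) ->
  (forall x t : R, u < x < v -> D t -> is_derive x 1 (f ^~ t) (f' x t)) ->
  mu.-integrable D (EFin \o G) ->
  (forall x t : R, u < x < v -> D t -> `|f' x t| <= G t) ->
  is_derive a 1 (fun x => \int[mu]_(t in D) f x t) (\int[mu]_(t in D) f' a t).
Proof.
move=> mD uav intf df iG Gub.
have Ia : `]u, v[%classic a by rewrite /= in_itv.
have intf' (x : R) : `]u, v[%classic x -> mu.-integrable D (EFin \o f x).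
  by rewrite /= in_itv/=; exact: intf.
have df' (x t : R) : `]u, v[%classic x -> D t -> derivable (f ^~ t) x 1.
  by rewrite /= in_itv/= => xuv Dt; have [] := df _ _ xuv Dt.
have iG' : mu.-integrable D (EFin \o (fun t => `|G t|)).
  exact: (@integrable_norm _ (measurableTypeR R) R mu).
have Gub' (x t : R) : `]u, v[%classic x -> D t -> `|partial1of2 f x t| <= `|G t|.
  rewrite /= in_itv/= => xuv Dt.
  by rewrite /partial1of2 (is_derive_derive1 (df _ _ xuv Dt)) (le_trans (Gub _ _ xuv Dt))// ler_norm.
have G0 t : 0 <= `|G t| by exact: normr_ge0.
have h1 := @derivable_under_integral R _ (measurableTypeR R) mu f D mD a u v Ia intf' df' _ G0 iG' Gub'.
have h2 := @differentiation_under_integral R _ (measurableTypeR R) mu f D mD a u v Ia intf' df' _ G0 iG' Gub'.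
split; first exact: h1.
rewrite -derive1E h2; apply: eq_Rintegral => t /set_mem Dt.
by rewrite /partial1of2 (is_derive_derive1 (df _ _ uav Dt)).
Qed.

End under_integral.

Section laplace_profile.
Context {R : realType}.
Implicit Types (a c g p q r t : R).

Definition weight g t : R := (t * (2 + t)) `^ g.

(** Up to powers of r this is the integral representation of the Bessel function K, with the variable u = 1 + t so that the singularity of the weight sits at 0. The factor (a(1+t))^k is what k differentiations in r produce, up to sign. *)
Definition profile a g k r := \int[mu]_(t in `]0, +oo[)
  (weight g t * (a * (1 + t)) ^+ k * expR (- (a * (1 + t) * r))).

(** Whatever the sign of the exponent, the power is monotone, so one of the two end points dominates. *)
Lemma powR_le_bracket g (x y z : R) : 0 < x -> x <= y -> y <= z ->
  y `^ g <= x `^ g + z `^ g.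
Proof.
move=> x0 xy yz.
have [g0|g0] := leP 0 g.
  by apply: ler_wpDl; rewrite ?powR_ge0// ge0_ler_powR ?nnegrE//; lra.
apply: ler_wpDr; rewrite ?powR_ge0//.
rewrite -(opprK g) !(powRN _ (- g)) lef_pV2 ?posrE ?powR_gt0//; last by lra.
by apply: ge0_ler_powR; rewrite ?nnegrE//; lra.
Qed.

Lemma weightE g t : 0 < t -> weight g t = t `^ g * (2 + t) `^ g.
Proof. by move=> t0; rewrite /weight powRM//; lra. Qed.

Lemma weight_ge0 g t : 0 <= weight g t. Proof. exact: powR_ge0. Qed.

Lemma weight_gt0 g t : 0 < t -> 0 < weight g t.
Proof. by move=> t0; rewrite powR_gt0// mulr_gt0//; lra. Qed.

Lemma weight_le g t : 0 < t -> weight g t <= (1 + 2 `^ g) * (t `^ g * (1 + t) `^ g).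
Proof.
move=> t0; rewrite weightE// mulrCA ler_wpM2l ?powR_ge0//.
rewrite mulrDl mul1r -powRM//; last by lra.
by apply: powR_le_bracket; lra.
Qed.

Lemma profile_integrable a g k r : 0 < a -> -1 < g -> 0 < r ->
  mu.-integrable `]0, +oo[ (fun t =>
    (weight g t * (a * (1 + t)) ^+ k * expR (- (a * (1 + t) * r)))%:E).
Proof.
move=> a0 g1 r0; have ar : 0 < a * r by exact: mulr_gt0.
pose C := (1 + 2 `^ g) * a ^+ k * expR (- (a * r)).
apply: (dominated_integrable
  (g := fun t => C * (t `^ g * (1 + t) `^ (g + k%:R) * expR (- (a * r * t))))) => //.
- apply: continuous_measurable_oy => t t0.
  eapply is_derive_continuous; rewrite /weight; derive_rule.
  by rewrite mulr_gt0//; lra.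
- move=> t; rewrite /= in_itv/= andbT => t0; have t1 : 0 < 1 + t by lra.
  have at1 : 0 <= a * (1 + t) by rewrite mulr_ge0 ?ltW.
  rewrite ger0_norm ?mulr_ge0 ?weight_ge0 ?expR_ge0 ?exprn_ge0//.
  apply: (@le_trans _ _ ((1 + 2 `^ g) * (t `^ g * (1 + t) `^ g) * (a * (1 + t)) ^+ k * expR (- (a * (1 + t) * r)))).
    by rewrite ler_wpM2r ?expR_ge0// ler_wpM2r ?exprn_ge0//; exact: weight_le.
  rewrite le_eqVlt /C powR_add// powR_mulrn ?ltW// exprMn.
  rewrite (_ : - (a * (1 + t) * r) = - (a * r) + - (a * r * t)); last by ring.
  by rewrite expRD; apply/orP; left; apply/eqP; ring.
- by apply: integrable_scale => //; exact: poly_exp_integrable.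
Qed.

Lemma profile_decay a g k r s : 0 < a -> -1 < g -> 0 < s -> s <= r ->
  `|profile a g k r| <= profile a g k s * expR (a * s) * expR (- (a * r)).
Proof.
move=> a0 g1 s0 sr; have r0 : 0 < r by exact: lt_le_trans sr.
have f0 u t : 0 < t -> 0 <= weight g t * (a * (1 + t)) ^+ k * expR (- (a * (1 + t) * u)).
  by move=> t0; rewrite mulr_ge0 ?expR_ge0// mulr_ge0 ?weight_ge0// exprn_ge0// mulr_ge0//; lra.
rewrite ger0_norm; last first.
  by apply: Rintegral_ge0 => t; rewrite /= in_itv/= andbT; exact: f0.
rewrite -mulrA -expRD mulrC /profile -RintegralZl//; last exact: profile_integrable.
apply: le_Rintegral => //; first exact: profile_integrable.
  by apply: integrable_scale => //; exact: profile_integrable.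
move=> t; rewrite /= in_itv/= andbT => t0.
rewrite mulrCA; apply: ler_wpM2l.
  by rewrite mulr_ge0 ?weight_ge0// exprn_ge0// mulr_ge0//; lra.
rewrite -expRD ler_expR.
have : 0 <= a * t * (r - s) by rewrite !mulr_ge0//; lra.
by nra.
Qed.

Lemma is_derive_profile a g k r : 0 < a -> -1 < g -> 0 < r ->
  is_derive r 1 (profile a g k) (- profile a g k.+1 r).
Proof.
move=> a0 g1 r0.
rewrite (_ : - profile a g k.+1 r = \int[mu]_(t in `]0, +oo[)
    (- 1 * (weight g t * (a * (1 + t)) ^+ k.+1 * expR (- (a * (1 + t) * r))))); last first.
  by rewrite RintegralZl ?mulN1r//; exact: profile_integrable.
apply: (is_derive_under_integral (u := r / 2) (v := r * 2) (f := fun x t =>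
   weight g t * (a * (1 + t)) ^+ k * expR (- (a * (1 + t) * x)))
  (f' := fun x t => -1 * (weight g t * (a * (1 + t)) ^+ k.+1 * expR (- (a * (1 + t) * x))))
  (G := fun t => weight g t * (a * (1 + t)) ^+ k.+1 * expR (- (a * (1 + t) * (r / 2))))) => //.
- by lra.
- by move=> x xr; apply: profile_integrable => //; lra.
- move=> x t _ _; eapply is_derive_eq; first derive_rule.
  by rewrite exprS; ring.
- by apply: profile_integrable => //; lra.
- move=> x t xr; rewrite /= !in_itv/= andbT => t0.
  rewrite mulN1r normrN ger0_norm; last first.
    by rewrite mulr_ge0 ?expR_ge0// mulr_ge0 ?weight_ge0// exprn_ge0// mulr_ge0//; lra.
  apply: ler_wpM2l.
    by rewrite mulr_ge0 ?weight_ge0// exprn_ge0// mulr_ge0//; lra.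
  rewrite ler_expR lerN2 ler_wpM2l//; last by lra.
  by rewrite mulr_ge0//; lra.
Qed.

Lemma cvg_invr_pinfty : x^-1 @[x --> +oo] --> (0 : R).
Proof.
apply/cvgr0Pnorm_lt => e e0; near=> r.
have re : e^-1 < r by near: r; apply: nbhs_pinfty_gt; exact: num_real.
have r0 : 0 < r by near: r; exact: nbhs_pinfty_gt.
by rewrite gtr0_norm ?invr_gt0// -[ltRHS]invrK ltf_pV2 ?posrE ?invr_gt0.
Unshelve. all: by end_near. Qed.

Lemma profile_subst_integrable a g k r : 0 < a -> -1 < g -> 0 < r ->
  mu.-integrable `]0, +oo[ (fun v =>
    (weight g (v / r) * (a * (1 + v / r)) ^+ k * expR (- (a * v)))%:E).
Proof.
move=> a0 g1 r0; have ir0 : 0 < r^-1 by rewrite invr_gt0.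
have := integrable_affine ir0 (profile_integrable k a0 g1 r0).
move=> /(integrable_scale (expR (a * r)) (measurable_itv _)).
apply: eq_integrable => // v _; congr EFin.
rewrite add0r mulrCA -expRD (mulrC r^-1); congr (_ * expR _).
by field; rewrite gt_eqF.
Qed.

(** Set v = t r, which separates the exponential and makes both limits in r cases of dominated convergence. *)
Lemma profile_subst a g k r : 0 < a -> -1 < g -> 0 < r ->
  profile a g k r = expR (- (a * r)) * r^-1 * \int[mu]_(v in `]0, +oo[)
    (weight g (v / r) * (a * (1 + v / r)) ^+ k * expR (- (a * v))).
Proof.
move=> a0 g1 r0; have ir0 : 0 < r^-1 by rewrite invr_gt0.
have fi := profile_integrable k a0 g1 r0.
rewrite {1}/profile (Rintegral_affine ir0); last first.
  by apply/measurable_EFinP; exact: (measurable_int _ fi).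
rewrite -mulrA mulrCA; congr (_ * _); rewrite -RintegralZl//; last first.
  exact: profile_subst_integrable.
apply: eq_Rintegral => v _.
rewrite add0r [RHS]mulrCA -expRD (mulrC r^-1); congr (_ * expR _).
by field; rewrite gt_eqF.
Qed.

(** As r grows, (v/r)(2+v/r) behaves like 2v/r, which leaves a Gamma integral. *)
Lemma profile_pinfty a g k : 0 < a -> -1 < g ->
  asymp_pinfty (fun r => r `^ (- 1 - g)) a (a ^+ k * (2 `^ g * gamma_int g a))
    (profile a g k).
Proof.
move=> a0 g1; rewrite /asymp_pinfty.
pose f (r v : R) := v `^ g * (2 + v / r) `^ g * (a * (1 + v / r)) ^+ k * expR (- (a * v)).
have h : \int[mu]_(v in `]0, +oo[) f r v @[r --> +oo] -->
    \int[mu]_(v in `]0, +oo[) (a ^+ k * 2 `^ g * (v `^ g * expR (- (a * v)))).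
  apply: (@dominated_cvg_filter _ (measurableTypeR R) R mu _ (measurable_itv _) _ f _
    (fun v => ((1 + 2 `^ g) * a ^+ k) *
      (v `^ g * (1 + v) `^ (`|g| + k%:R) * expR (- (a * v))))) => //.
  - exact: sequential_pinfty.
  - near=> r; have r0 : 0 < r by near: r; exact: nbhs_pinfty_gt.
    apply: continuous_measurable_oy => v v0; rewrite /f.
    eapply is_derive_continuous; derive_rule => //.
    by rewrite addr_gt0// divr_gt0.
  - move=> v; rewrite /= in_itv/= andbT => v0; rewrite /f.
    have vr : v / r @[r --> +oo] --> (0 : R).
      rewrite -[X in _ --> X](mulr0 v); apply: cvgMr.
      exact: cvg_invr_pinfty.
    rewrite (_ : a ^+ k * 2 `^ g * _ = v `^ g * (2 + 0) `^ g * (a * (1 + 0)) ^+ k * expR (- (a * v))); last first.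
      by rewrite !addr0 mulr1; ring.
    apply: cvgMl; apply: cvgM; first apply: cvgMr.
      apply: (cvg_comp_for (h := fun z => (2 + z) `^ g) vr).
      by eapply is_derive_continuous; derive_rule; rewrite addr0.
    apply: (cvg_comp_for (h := fun z => (a * (1 + z)) ^+ k) vr).
    by eapply is_derive_continuous; derive_rule.
  - by apply: integrable_scale => //; exact: poly_exp_integrable.
  - near=> r => v; rewrite /= in_itv/= andbT => v0.
    have r1 : 1 <= r by near: r; exact: nbhs_pinfty_ge.
    have r0 : 0 < r by lra.
    have vr0 : 0 < v / r by rewrite divr_gt0.
    have vrv : v / r <= v by rewrite ler_pdivrMr// ler_peMr// ltW.
    rewrite /f ger0_norm; last first.
      by rewrite !mulr_ge0 ?powR_ge0 ?expR_ge0// exprn_ge0// mulr_ge0//; lra.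
    have b1 : (2 + v / r) `^ g <= (1 + 2 `^ g) * (1 + v) `^ `|g|.
      apply: (@le_trans _ _ ((1 + 2 `^ g) * (1 + v / r) `^ g)).
        rewrite mulrDl mul1r -powRM//; last by lra.
        by apply: powR_le_bracket; lra.
      rewrite ler_wpM2l ?addr_ge0 ?powR_ge0//.
      apply: (@le_trans _ _ ((1 + v / r) `^ `|g|)).
        by apply: ler_powR; [lra|exact: ler_norm].
      by apply: ge0_ler_powR; rewrite ?nnegrE//; lra.
    have b2 : (a * (1 + v / r)) ^+ k <= a ^+ k * (1 + v) `^ k%:R.
      rewrite powR_mulrn ?exprMn; last by lra.
      rewrite ler_wpM2l ?exprn_ge0//; first by lra.
      by rewrite lerXn2r ?nnegrE//; lra.
    rewrite powR_add//; last by lra.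
    rewrite [leRHS](_ : _ = v `^ g * (((1 + 2 `^ g) * (1 + v) `^ `|g|) * (a ^+ k * (1 + v) `^ k%:R)) * expR (- (a * v))); last by ring.
    rewrite ler_wpM2r ?expR_ge0// -mulrA ler_wpM2l ?powR_ge0//.
    by apply: ler_pM; rewrite ?powR_ge0// exprn_ge0// mulr_ge0//; lra.
rewrite RintegralZl in h => //; last exact: gamma_integrable.
rewrite mulrA; apply: cvg_trans h; apply: near_eq_cvg; near=> r.
have r0 : 0 < r by near: r; exact: nbhs_pinfty_gt.
rewrite profile_subst// powR_add// powRN powRN powRr1 ?ltW//.
have -> : \int[mu]_(v in `]0, +oo[) f r v = r `^ g * \int[mu]_(v in `]0, +oo[)
    (weight g (v / r) * (a * (1 + v / r)) ^+ k * expR (- (a * v))).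
  rewrite -RintegralZl//; last exact: profile_subst_integrable.
  apply: eq_Rintegral => v /set_mem; rewrite /= in_itv/= andbT => v0.
  rewrite weightE ?divr_gt0// powR_div// /f.
  by field; rewrite gt_eqF// powR_gt0.
rewrite expRN; field.
by rewrite !gt_eqF ?expR_gt0 ?powR_gt0.
Unshelve. all: by end_near. Qed.

(** As r tends to 0, (v/r)(2+v/r) behaves like (v/r)^2; the hypothesis on g makes the limiting integrand v^(2g) integrable at 0. *)
Lemma profile_zero a g k : 0 < a -> - (1 / 2) < g ->
  asymp_zero (1 + 2 * g + k%:R) (a ^+ k * gamma_int (2 * g + k%:R) a) (profile a g k).
Proof.
move=> a0 g12; have g1 : -1 < g by lra.
rewrite /asymp_zero.
pose f (r v : R) := v `^ g * (2 * r + v) `^ g * (a * (r + v)) ^+ k * expR (- (a * v)).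
have h : \int[mu]_(v in `]0, +oo[) f r v @[r --> 0^'+] -->
    \int[mu]_(v in `]0, +oo[) (a ^+ k * (v `^ (2 * g + k%:R) * expR (- (a * v)))).
  apply: (@dominated_cvg_filter _ (measurableTypeR R) R mu _ (measurable_itv _) _ f _
    (fun v => a ^+ k * (v `^ (2 * g) * (1 + v) `^ k%:R * expR (- (a * v))) +
      (a ^+ k * 2 `^ g) *
      (v `^ g * (1 + v) `^ (`|g| + k%:R) * expR (- (a * v))))) => //.
  - exact: sequential_at_right.
  - near=> r; have r0 : 0 < r by near: r; exact: nbhs_right_gt.
    apply: continuous_measurable_oy => v v0; rewrite /f.
    eapply is_derive_continuous; derive_rule => //.
    by rewrite addr_gt0// mulr_gt0.
  - move=> v; rewrite /= in_itv/= andbT => v0; rewrite /f.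
    have cr : r @[r --> 0^'+] --> (0 : R) by apply: cvg_at_right_filter; exact: cvg_id.
    rewrite (_ : a ^+ k * _ = v `^ g * (2 * 0 + v) `^ g * (a * (0 + v)) ^+ k * expR (- (a * v))); last first.
      rewrite mulr0 !add0r powR_add// powR_mulrn ?ltW// exprMn.
      by rewrite (_ : 2 * g = g + g) ?powR_add//; ring.
    apply: cvgMl; apply: cvgM; first apply: cvgMr.
      apply: (cvg_comp_for (h := fun z => (2 * z + v) `^ g) cr).
      by eapply is_derive_continuous; derive_rule; rewrite mulr0 add0r.
    apply: (cvg_comp_for (h := fun z => (a * (z + v)) ^+ k) cr).
    by eapply is_derive_continuous; derive_rule.
  - by apply: integrable_add => //; apply: integrable_scale => //;
      apply: poly_exp_integrable => //; lra.
  - near=> r => v; rewrite /= in_itv/= andbT => v0.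
    have r0 : 0 < r by near: r; exact: nbhs_right_gt.
    have r1 : r <= 1 by near: r; exact: nbhs_right_le.
    rewrite /f ger0_norm; last first.
      by rewrite !mulr_ge0 ?powR_ge0 ?expR_ge0// exprn_ge0// mulr_ge0//; lra.
    have b1 : v `^ g * (2 * r + v) `^ g <= v `^ (2 * g) + 2 `^ g * (v `^ g * (1 + v) `^ `|g|).
      rewrite (_ : 2 * g = g + g) ?powR_add//; last by ring.
      rewrite (mulrCA (2 `^ g)) -mulrDr ler_wpM2l ?powR_ge0//.
      have [g0|g0] := leP 0 g.
        rewrite ler_wpDl ?powR_ge0// ger0_norm// -powRM//; last by lra.
        by rewrite ge0_ler_powR ?nnegrE//; lra.
      rewrite ler_wpDr ?mulr_ge0 ?powR_ge0// -(opprK g) !(powRN _ (- g)).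
      rewrite lef_pV2 ?posrE ?powR_gt0//; last by lra.
      by apply: ge0_ler_powR; rewrite ?nnegrE//; lra.
    have b2 : (a * (r + v)) ^+ k <= a ^+ k * (1 + v) `^ k%:R.
      rewrite powR_mulrn ?exprMn; last by lra.
      rewrite ler_wpM2l ?exprn_ge0//; first by lra.
      by rewrite lerXn2r ?nnegrE//; lra.
    rewrite powR_add//; last by lra.
    rewrite [leRHS](_ : _ = (v `^ (2 * g) + 2 `^ g * (v `^ g * (1 + v) `^ `|g|)) *
      (a ^+ k * (1 + v) `^ k%:R) * expR (- (a * v))); last by ring.
    rewrite ler_wpM2r ?expR_ge0//.
    apply: ler_pM => //; first by rewrite mulr_ge0 ?powR_ge0.
    by rewrite exprn_ge0// mulr_ge0//; lra.
rewrite RintegralZl in h => //; last first.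
  by apply: gamma_integrable => //; have := ler0n R k; lra.
have h2 : expR (- (a * r)) @[r --> 0^'+] --> expR (- (a * 0)).
  apply: (cvg_right_for (f := fun r => expR (- (a * r)))).
  by eapply is_derive_continuous; derive_rule.
have {h2} h3 : expR (- (a * r)) * \int[mu]_(v in `]0, +oo[) f r v @[r --> 0^'+] -->
    expR (- (a * 0)) * (a ^+ k * gamma_int (2 * g + k%:R) a) by exact: cvgM h2 h.
rewrite mulr0 oppr0 expR0 mul1r in h3; move: h3 => {}h.
apply: cvg_trans h; apply: near_eq_cvg; near=> r.
have r0 : 0 < r by near: r; exact: nbhs_right_gt.
rewrite /= profile_subst//.
have -> : \int[mu]_(v in `]0, +oo[) f r v = r `^ (g + g) * r ^+ k * \int[mu]_(v in `]0, +oo[)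
    (weight g (v / r) * (a * (1 + v / r)) ^+ k * expR (- (a * v))).
  rewrite -RintegralZl//; last exact: profile_subst_integrable.
  apply: eq_Rintegral => v /set_mem; rewrite /= in_itv/= andbT => v0.
  rewrite weightE ?divr_gt0// powR_div// /f powR_add//.
  have -> : 2 * r + v = r * (2 + v / r) by field; rewrite gt_eqF.
  have -> : a * (r + v) = r * (a * (1 + v / r)) by field; rewrite gt_eqF.
  rewrite powRM ?ltW//; last by rewrite addr_gt0// divr_gt0.
  by rewrite exprMn; field; rewrite gt_eqF// powR_gt0.
rewrite (_ : 1 + 2 * g + k%:R = 1 + (g + g) + k%:R); last by ring.
rewrite (@powR_add _ r _ k%:R)// (@powR_add _ r 1)// powR_mulrn ?ltW// powRr1 ?ltW//; field.
by rewrite gt_eqF.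
Unshelve. all: by end_near. Qed.

Lemma jet_profile_pinfty a g k N : 0 < a -> -1 < g ->
  jet (asymp_pinfty (fun r => r `^ (- 1 - g))) 0 N a (a ^+ k * (2 `^ g * gamma_int g a))
    (profile a g k).
Proof.
move=> a0 g1; elim: N k => [|N IH] k; first exact: profile_pinfty.
apply: (jet_step (asymp_pinfty_compat _) (profile_pinfty (k := k) a0 g1)
  (f' := fun r => - profile a g k.+1 r)) => [r r0|].
  exact: is_derive_profile.
rewrite addr0 mulrA -exprS; apply: jet_opp; last exact: IH.
exact: asymp_pinfty_compat.
Qed.

Lemma jet_profile_zero a g k N : 0 < a -> - (1 / 2) < g ->
  jet asymp_zero 1 N (1 + 2 * g + k%:R) (a ^+ k * gamma_int (2 * g + k%:R) a)
    (profile a g k).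
Proof.
move=> a0 g1; elim: N k => [|N IH] k; first exact: profile_zero.
apply: (jet_step asymp_zero_compat (profile_zero (k := k) a0 g1)
  (f' := fun r => - profile a g k.+1 r)) => [r r0|].
  by apply: is_derive_profile => //; lra.
have k0 := ler0n R k.
have p1 : -1 < 2 * g + k%:R by lra.
rewrite [X in - X](_ : _ = a ^+ k * ((2 * g + k%:R + 1) * gamma_int (2 * g + k%:R) a)); last by ring.
rewrite gamma_int_rec// (_ : 1 + 2 * g + k%:R + 1 = 1 + 2 * g + k.+1%:R); last first.
  by rewrite -natr1; ring.
rewrite mulrA -exprSr (_ : 2 * g + k%:R + 1 = 2 * g + k.+1%:R); last first.
  by rewrite -natr1; ring.
by apply: jet_opp; [exact: asymp_zero_compat|exact: IH].
Qed.

Lemma jet_profile_bounded a g k N L : 0 < a -> -1 < g ->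
  jet exp_bounded 0 N a L (profile a g k).
Proof.
move=> a0 g1.
have Q j l : exp_bounded a l (profile a g j).
  by move=> s s0; exists (profile a g j s * expR (a * s)) => r sr; exact: profile_decay.
elim: N k L => [|N IH] k L; first exact: Q.
apply: (jet_step exp_bounded_compat (Q k L)
  (f' := fun r => - profile a g k.+1 r)) => [r r0|].
  exact: is_derive_profile.
rewrite addr0; apply: jet_opp; first exact: exp_bounded_compat.
exact: IH.
Qed.

Lemma gamma_int_gt0 p c : -1 < p -> 0 < c -> 0 < gamma_int p c.
Proof.
move=> p1 c0; apply: Rintegral_oy_gt0; last exact: gamma_integrable.
by move=> t t0; rewrite mulr_gt0 ?powR_gt0 ?expR_gt0.
Qed.

(** The difference of both sides is the integral of the derivative of (t(2+t))^(g+1) exp(-(1+t)r), which vanishes at both ends. *)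
Lemma profile_ode g r : -1 < g -> 0 < r ->
  r * (profile 1 g 2 r - profile 1 g 0 r) = (2 * g + 2) * profile 1 g 1 r.
Proof.
move=> g1 r0.
have i k := profile_integrable k (@ltr01 R) g1 r0.
apply/eqP; rewrite eq_sym -subr_eq0 /profile -RintegralB//; try exact: i.
have d := integrable_sub (measurable_itv _) (i 2) (i 0).
rewrite -!RintegralZl//; try exact: i; try exact: d.
have e1 := integrable_scale (2 * g + 2) (measurable_itv _) (i 1).
have e2 := integrable_scale r (measurable_itv _) d.
rewrite -RintegralB//.
apply/eqP; rewrite -[RHS](subrr 0).
apply: (@RFTC_oy _ _ (fun t => (t * (2 + t)) `^ (g + 1) * expR (- (1 * (1 + t) * r)))).
- move=> t t0; have t2 : 0 < t * (2 + t) by rewrite mulr_gt0//; lra.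
  rewrite /weight; eapply is_derive_eq; first by derive_rule.
  rewrite (_ : g + 1 - 1 = g) ?powR_add ?powRr1 ?ltW//; last by ring.
  by ring.
- move=> t t0; have t2 : 0 < t * (2 + t) by rewrite mulr_gt0//; lra.
  by rewrite /weight; eapply is_derive_continuous; derive_rule.
- rewrite -[X in _ --> X](mul0r (expR (- (1 * (1 + 0) * r)))); apply: cvgM.
    have h : 4 `^ (g + 1) * t `^ (g + 1) @[t --> 0^'+] --> (0 : R).
      by rewrite -[X in _ --> X](mulr0 (4 `^ (g + 1))); apply: cvgMr; apply: powR_cvg0; lra.
    apply: (@squeeze_cvgr _ _ _ _ (cst 0)) h; last exact: cvg_cst.
    near=> t; have t0 : 0 < t by near: t; exact: nbhs_right_gt.
    have t1 : t <= 1 by near: t; exact: nbhs_right_le.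
    rewrite /= powR_ge0/= -powRM ?(ltW t0)//.
    by apply: ge0_ler_powR; rewrite ?nnegrE//; nra.
  apply: (cvg_right_for (f := fun t => expR (- (1 * (1 + t) * r)))).
  by eapply is_derive_continuous; derive_rule.
- have h : 3 `^ (g + 1) * (t `^ (2 * g + 2) * expR (- (r * t))) @[t --> +oo] --> (0 : R).
    by rewrite -[X in _ --> X](mulr0 (3 `^ (g + 1))); apply: cvgMr; exact: cvg_pow_expN.
  apply: (@squeeze_cvgr _ _ _ _ (cst 0)) h; last exact: cvg_cst.
  near=> t; have t1 : 1 <= t by near: t; exact: nbhs_pinfty_ge.
  rewrite /= mulr_ge0 ?powR_ge0 ?expR_ge0//= mulrA.
  apply: ler_pM; rewrite ?powR_ge0 ?expR_ge0//.
    rewrite (_ : t `^ (2 * g + 2) = t `^ (g + 1) * t `^ (g + 1)); last first.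
      by rewrite -powR_add; [congr (_ `^ _); ring|lra].
    rewrite -!powRM; try nra.
    by apply: ge0_ler_powR; rewrite ?nnegrE//; nra.
  by rewrite ler_expR; nra.
- exact: integrable_sub e1 e2.
Unshelve. all: by end_near. Qed.

End laplace_profile.

(** * The modified Bessel function *)

Section bessel.
Context {R : realType}.
Implicit Types (f psi chi : R -> R) (s nu g : R).

Lemma MVT_pos f (df : R -> R) (x y : R) : 0 < x -> x < y ->
  (forall z : R, 0 < z -> is_derive z 1 f (df z)) ->
  exists2 z, x < z < y & f y - f x = df z * (y - x).
Proof.
move=> x0 xy fd.
have h1 (z : R) : z \in `]x, y[ -> is_derive z 1 f (df z).
  by rewrite in_itv/= => /andP[xz _]; apply: fd; exact: lt_trans xz.
have h2 : {within `[x, y], continuous f}.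
  apply: continuous_in_subspaceT => z /set_mem; rewrite /= in_itv/= => /andP[xz _].
  by eapply is_derive_continuous; apply: fd; exact: lt_le_trans xz.
by have [z zxy ->] := MVT xy h1 h2; exists z => //; rewrite in_itv in zxy.
Qed.

Lemma derive0_pos_cst f : (forall z : R, 0 < z -> is_derive z 1 f 0) ->
  forall x y : R, 0 < x -> 0 < y -> f x = f y.
Proof.
move=> fd; have lt_case x y : 0 < x -> x < y -> f x = f y.
  by move=> x0 xy; have [z _] := MVT_pos x0 xy fd; rewrite mul0r => /eqP; rewrite subr_eq0 => /eqP.
move=> x y x0 y0; have [xy|yx|->//] := ltgtP x y; first exact: lt_case.
by apply/esym/lt_case.
Qed.

(** For two solutions, s times the Wronskian is a constant w, and the quotient psi/chi has derivative -w/(s chi^2). The quotient tends to 1 by the normalisation at infinity, whereas s chi^2 stays bounded, so that w <> 0 would keep the increments of the quotient over unit intervals away from 0. *)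
Lemma besselK_unique nu psi chi : is_besselK nu psi -> is_besselK nu chi ->
  (forall s : R, 0 < s -> 0 < chi s) -> forall s : R, 0 < s -> psi s = chi s.
Proof.
move=> [Hpsi lpsi] [Hchi lchi] chi0.
have dpsi (s : R) : 0 < s -> is_derive s 1 psi (derive1 psi s).
  by move=> /Hpsi[d _ _]; exact: derivable_is_derive.
have dpsi' (s : R) : 0 < s -> is_derive s 1 (derive1 psi) (derive1n 2 psi s).
  by move=> /Hpsi[_ d _]; exact: derivable_is_derive.
have dchi (s : R) : 0 < s -> is_derive s 1 chi (derive1 chi s).
  by move=> /Hchi[d _ _]; exact: derivable_is_derive.
have dchi' (s : R) : 0 < s -> is_derive s 1 (derive1 chi) (derive1n 2 chi s).
  by move=> /Hchi[_ d _]; exact: derivable_is_derive.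
pose W (s : R) := s * (psi s * derive1 chi s - derive1 psi s * chi s).
have W0 (s : R) : 0 < s -> is_derive s 1 W 0.
  move=> s0; have h1 := dpsi _ s0; have h2 := dpsi' _ s0.
  have h3 := dchi _ s0; have h4 := dchi' _ s0.
  rewrite /W; eapply is_derive_eq; first derive_rule.
  have [_ _ e1] := Hpsi _ s0; have [_ _ e2] := Hchi _ s0.
  apply: (@mulfI _ s); first by rewrite gt_eqF.
  have := congr2 (fun u v => u * psi s - v * chi s) e2 e1.
  rewrite /= !mul0r subrr mulr0 => <-.
  move: (derive1 (derive1 psi) s) (derive1 (derive1 chi) s) => p2 c2.
  by move: (derive1 psi s) (derive1 chi s) (psi s) (chi s) => p1 c1 p0 c0; ring.
have Wc := derive0_pos_cst W0.
pose w := W 1.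
pose Q s := psi s / chi s.
have dQ (s : R) : 0 < s -> is_derive s 1 Q (- w / (s * chi s ^+ 2)).
  move=> s0; have h1 := dpsi _ s0; have h3 := dchi _ s0; have c0 := chi0 _ s0.
  rewrite /Q; eapply is_derive_eq; first derive_rule; first by rewrite gt_eqF.
  rewrite /w (Wc 1 s)// /W; field.
  by rewrite !gt_eqF.
pose E (s : R) := Num.sqrt (pi / (2 * s)) * expR (- s).
have E0 s : 0 < s -> 0 < E s.
  move=> s0; rewrite mulr_gt0 ?expR_gt0// sqrtr_gt0 divr_gt0 ?pi_gt0//.
  by rewrite mulr_gt0.
have Q1 : Q s @[s --> +oo] --> (1 : R).
  have h : (psi s / E s) / (chi s / E s) @[s --> +oo] --> (1 / 1 : R).
    by apply: cvgM => //; apply: cvgV => //; exact: oner_neq0.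
  rewrite divr1 in h; apply: cvg_trans h; apply: near_eq_cvg; near=> s.
  have s0 : 0 < s by near: s; exact: nbhs_pinfty_gt.
  have c0 := chi0 _ s0; have e0 := E0 _ s0; rewrite /Q; field.
  by rewrite !gt_eqF.
have w0 : w = 0.
  apply/eqP/negPn/negP => w0.
  have k0 : 0 < `|w| / (2 * pi) by rewrite divr_gt0 ?normr_gt0// mulr_gt0// pi_gt0.
  have Q2 : Q (s + 1) @[s --> +oo] --> (1 : R) by rewrite cvg_shiftr.
  have : Q (s + 1) - Q s @[s --> +oo] --> (1 - 1 : R) by exact: cvgB.
  rewrite subrr => /cvgr0Pnorm_lt/(_ _ k0) nearQ.
  have [S [_ HS]] : \forall s \near +oo, chi s / E s < 2.
    by apply: (cvgr_lt _ lchi); lra.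
  near +oo_R => s.
  have s0 : 0 < s by near: s; exact: nbhs_pinfty_gt.
  have sS : S < s by near: s; apply: nbhs_pinfty_gt; exact: num_real.
  have : `|Q (s + 1) - Q s| < `|w| / (2 * pi) by near: s.
  have s1 : s < s + 1 by lra.
  have [z /andP[sz _] ->] := MVT_pos s0 s1 dQ.
  have z0 : 0 < z by exact: lt_trans sz.
  have cz : chi z < 2 * E z by rewrite -ltr_pdivrMr ?E0//; apply: HS; exact: lt_trans sz.
  have c0 := chi0 _ z0.
  rewrite (_ : s + 1 - s = 1); last by ring.
  rewrite mulr1 normrM normrN ltNge => /negP; apply.
  rewrite ler_wpM2l ?normr_ge0// gtr0_norm; last by rewrite invr_gt0 mulr_gt0// exprn_gt0.
  rewrite lef_pV2 ?posrE ?mulr_gt0 ?pi_gt0 ?exprn_gt0//.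
  have : chi z ^+ 2 <= (2 * E z) ^+ 2 by rewrite lerXn2r ?nnegrE ?ltW// mulr_gt0// E0.
  rewrite exprMn [E z ^+ 2]exprMn sqr_sqrtr; last by rewrite divr_ge0 ?pi_ge0// mulr_ge0// ltW.
  rewrite -expRM_natl => h.
  apply: (@le_trans _ _ (z * (2 ^+ 2 * (pi / (2 * z) * expR (2%:R * - z))))).
    by rewrite ler_wpM2l// ltW.
  rewrite (_ : z * _ = 2 * pi * expR (2%:R * - z)); last by field; rewrite gt_eqF.
  rewrite ler_piMr//; first by rewrite mulr_ge0// pi_ge0.
  by rewrite expR_le1; lra.
have Qc : forall x y : R, 0 < x -> 0 < y -> Q x = Q y.
  by apply: derive0_pos_cst => s s0; have := dQ _ s0; rewrite w0 oppr0 mul0r.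
move=> s s0; have c0 := chi0 _ s0.
suff : Q s = 1 by rewrite /Q => /(congr1 (fun x => x * chi s)); rewrite mul1r divfK// gt_eqF.
apply: (cvg_unique _ _ Q1) => //.
apply: (@cvg_near_cst _ _ _ _ _).
by near=> t; apply: Qc => //; near: t; exact: nbhs_pinfty_gt.
Unshelve. all: by end_near. Qed.

Lemma besselK_spec nu : (exists psi, is_besselK nu psi) -> is_besselK nu (besselK nu).
Proof. by move=> [psi Hpsi]; exact: (xgetPex (fun=> 0) (ex_intro _ psi Hpsi)). Qed.

(** The profile behaves like 2^g Gamma(g+1) s^(-1-g) exp(-s) at infinity; this constant turns it into sqrt(pi/(2s)) exp(-s) after multiplication by s^(1/2+g). *)
Definition bessel_coef g : R := Num.sqrt (pi / 2) / (2 `^ g * gamma_int g 1).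

Lemma is_besselK_profile g : -1 < g ->
  is_besselK (- (1 / 2) - g)
    (fun s : R => bessel_coef g * (s `^ (1 / 2 + g) * profile 1 g 0 s)).
Proof.
move=> g1; set c := bessel_coef g; set p := 1 / 2 + g.
have dG k (s : R) : 0 < s -> is_derive s 1 (profile 1 g k) (- profile 1 g k.+1 s).
  by move=> s0; exact: is_derive_profile.
pose f1 s := c * (s `^ p * (p * s^-1 * profile 1 g 0 s - profile 1 g 1 s)).
pose f2 s := c * (s `^ p * (p * (p - 1) * s^-1 ^+ 2 * profile 1 g 0 s
                            - 2 * p * s^-1 * profile 1 g 1 s + profile 1 g 2 s)).
have pow1 s : 0 < s -> s `^ (p - 1) = s `^ p / s.
  by move=> s0; rewrite powR_add// powRN powRr1 ?ltW.
have d1 (s : R) : 0 < s -> is_derive s 1 (fun s : R => c * (s `^ p * profile 1 g 0 s)) (f1 s).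
  move=> s0; have h := dG 0 _ s0; eapply is_derive_eq; first by derive_rule.
  by rewrite /f1 pow1//; field; rewrite gt_eqF.
have d2 (s : R) : 0 < s -> is_derive s 1 f1 (f2 s).
  move=> s0; have h := dG 0 _ s0; have h' := dG 1 _ s0; rewrite /f1.
  eapply is_derive_eq; first by derive_rule => //; rewrite gt_eqF.
  by rewrite /f2 pow1//; field; rewrite gt_eqF.
have d1E (s : R) : 0 < s -> derive1 (fun s : R => c * (s `^ p * profile 1 g 0 s)) s = f1 s.
  by move=> s0; exact: is_derive_derive1 (d1 _ s0).
split.
  move=> s s0; split.
  - by have [] := d1 _ s0.
  - apply: (@derivable_ext _ f1) => // [y y0|]; first by rewrite d1E.
    by have [] := d2 _ s0.
  - rewrite d1E// /derive1n /= (@derive1_ext _ _ f1)// (is_derive_derive1 (d2 _ s0)).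
    have ode := profile_ode g1 s0.
    have e1 : s ^+ 2 * (profile 1 g 2 s - profile 1 g 0 s) = s * ((2 * g + 2) * profile 1 g 1 s).
      by rewrite -ode; ring.
    have /(congr1 (fun z => c * s `^ p * z)) : s ^+ 2 * (profile 1 g 2 s - profile 1 g 0 s) - s * ((2 * g + 2) * profile 1 g 1 s) = 0.
      by rewrite e1 subrr.
    rewrite mulr0 => <-; rewrite /f1 /f2.
    have ss : s * s^-1 = 1 by rewrite mulfV// gt_eqF.
    rewrite (_ : - (1 / 2) - g = - p); last by rewrite /p; ring.
    rewrite (_ : 2 * g + 2 = 2 * p + 1); last by rewrite /p; field.
    by field; rewrite gt_eqF.
have := profile_pinfty (k := 0) (@ltr01 R) g1; rewrite /asymp_pinfty expr0 mul1r => h.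
have k0 : 2 `^ g != 0 :> R by rewrite gt_eqF ?powR_gt0.
have k1 : gamma_int g 1 != 0 :> R by rewrite gt_eqF ?gamma_int_gt0.
have s2 : Num.sqrt (pi / 2) != 0 :> R by rewrite gt_eqF// sqrtr_gt0 divr_gt0// pi_gt0.
have h3 : c / Num.sqrt (pi / 2) * (profile 1 g 0 s * expR (1 * s) / s `^ (-1 - g)) @[s --> +oo] -->
  c / Num.sqrt (pi / 2) * (2 `^ g * gamma_int g 1) by exact: cvgMr.
rewrite [X in _ --> X](_ : _ = 1) in h3; last by rewrite /c /bessel_coef; field; rewrite k0 k1 s2.
apply: cvg_trans h3; apply: near_eq_cvg; near=> s.
have s0 : 0 < s by near: s; exact: nbhs_pinfty_gt.
have ss0 : 0 < Num.sqrt s by rewrite sqrtr_gt0.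
rewrite mul1r powR_add// !powRN powRr1 ?ltW// /p powR_add//.
rewrite (_ : s `^ (1 / 2) = Num.sqrt s); last by rewrite mul1r powR12_sqrt// ltW.
rewrite (_ : pi / (2 * s) = pi / 2 * s^-1); last by field; rewrite gt_eqF.
have pi2 : 0 <= pi / 2 :> R by rewrite divr_ge0// pi_ge0.
rewrite (sqrtrM s^-1 pi2).
rewrite sqrtrV; last exact: ltW.
rewrite expRN (_ : s^-1 = (Num.sqrt s ^+ 2)^-1); last by rewrite sqr_sqrtr// ltW.
field.
by rewrite s2 !gt_eqF ?powR_gt0 ?expR_gt0.
Unshelve. all: by end_near. Qed.

Lemma besselK_profile g (s : R) : -1 < g -> 0 < s ->
  besselK (- (1 / 2) - g) s = bessel_coef g * (s `^ (1 / 2 + g) * profile 1 g 0 s).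
Proof.
move=> g1; have Hp := is_besselK_profile g1.
apply: (besselK_unique (besselK_spec (ex_intro _ _ Hp)) Hp) => t t0.
rewrite mulr_gt0//; last first.
  rewrite mulr_gt0 ?powR_gt0//; apply: Rintegral_oy_gt0 => [v v0|].
    by rewrite !mulr_gt0 ?weight_gt0 ?expR_gt0// ?expr0.
  exact: profile_integrable.
by rewrite divr_gt0 ?mulr_gt0 ?powR_gt0 ?gamma_int_gt0// sqrtr_gt0 divr_gt0// pi_gt0.
Qed.

End bessel.

(** * The cosine transform of the Cauchy kernel *)

Section cauchy_kernel.
Context {R : realType}.
Implicit Types (r x k : R).

Let q1 x : 0 < 1 + x ^+ 2.
Proof. by have := sqr_ge0 x; lra. Qed.

Let q1' x : 1 + x ^+ 2 != 0. Proof. by rewrite gt_eqF. Qed.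

Lemma cauchy_integrable_int :
  mu.-integrable `]0, +oo[ (fun x => ((1 + x ^+ 2)^-1)%:E) /\
  \int[mu]_(x in `]0, +oo[) (1 + x ^+ 2)^-1 = pi / 2 :> R.
Proof.
have dF (x : R) : 0 < x -> is_derive x 1 (@atan R) (1 + x ^+ 2)^-1.
  by move=> _; exact: is_derive1_atan.
have cF (x : R) : 0 < x -> {for x, continuous (fun x : R => (1 + x ^+ 2)^-1)}.
  by move=> _; eapply is_derive_continuous; derive_rule.
have F0 : atan x @[x --> 0^'+] --> (0 : R).
  rewrite -[X in _ --> X]atan0; apply: (cvg_right_for (f := @atan R)).
  by eapply is_derive_continuous; exact: is_derive1_atan.
have f0 (x : R) : 0 < x -> 0 <= (1 + x ^+ 2)^-1 by rewrite invr_ge0 ltW.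
split; first exact: ge0_FTC_oy_integrable dF cF F0 (@cvgy_atan R) f0.
by rewrite /Rintegral (ge0_FTC_oy dF cF F0 (@cvgy_atan R) f0) subr0.
Qed.

Let i1 := cauchy_integrable_int.1.

Let dominated_cauchy (f : R -> R) : (forall x : R, 0 < x -> {for x, continuous f}) ->
  (forall x : R, 0 < x -> `|f x| <= (1 + x ^+ 2)^-1) ->
  mu.-integrable `]0, +oo[ (EFin \o f).
Proof.
move=> cf fb; apply: (dominated_integrable (g := fun x => (1 + x ^+ 2)^-1)) => //.
  exact: continuous_measurable_oy.
by move=> x; rewrite /= in_itv/= andbT; exact: fb.
Qed.

(** The strategy is to show that J solves J'' = J. Differentiating J directly produces a divergent integral, so the decay of the integrand is first improved by an integration by parts, which expresses r J through S; P and S have convergent derivatives. *)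
Let J r := \int[mu]_(x in `]0, +oo[) (cos (x * r) * (1 + x ^+ 2)^-1).
Let P r := \int[mu]_(x in `]0, +oo[) (cos (x * r) * (1 + x ^+ 2)^-1 ^+ 2).
Let S r := \int[mu]_(x in `]0, +oo[) (x * sin (x * r) * (1 + x ^+ 2)^-1 ^+ 2).

Let norm_cos (y : R) : `|cos y| <= 1. Proof. by rewrite ler_norml cos_geN1 cos_le1. Qed.
Let norm_sin (y : R) : `|sin y| <= 1. Proof. by rewrite ler_norml sin_geN1 sin_le1. Qed.

Let inv_bounds x : [/\ 0 < (1 + x ^+ 2)^-1, (1 + x ^+ 2)^-1 <= 1,
  (1 + x ^+ 2) * (1 + x ^+ 2)^-1 = 1 & x ^+ 2 * (1 + x ^+ 2)^-1 <= 1].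
Proof.
have h : (1 + x ^+ 2) * (1 + x ^+ 2)^-1 = 1 by rewrite mulfV.
have i0 : 0 < (1 + x ^+ 2)^-1 by rewrite invr_gt0.
have := sqr_ge0 x => x0.
split => //; first by rewrite invf_le1//; lra.
by rewrite -[leRHS]h ler_pM2r//; lra.
Qed.

Let Jb r (x : R) : 0 < x -> `|cos (x * r) * (1 + x ^+ 2)^-1| <= (1 + x ^+ 2)^-1.
Proof.
have [i0 _ _ _] := inv_bounds x.
by move=> x0; rewrite normrM [X in _ * X]gtr0_norm// ler_piMl// ltW.
Qed.

Let Pb r (x : R) : 0 < x -> `|cos (x * r) * (1 + x ^+ 2)^-1 ^+ 2| <= (1 + x ^+ 2)^-1.
Proof.
have [i0 i2 _ _] := inv_bounds x.
move=> x0; rewrite expr2 mulrA normrM [X in _ * X]gtr0_norm// ler_piMl ?(ltW i0)//.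
by rewrite normrM [X in _ * X]gtr0_norm// mulr_ile1// ltW.
Qed.

Let Sb r (x : R) : 0 < x -> `|x * sin (x * r) * (1 + x ^+ 2)^-1 ^+ 2| <= (1 + x ^+ 2)^-1.
Proof.
have [i0 i2 ie i3] := inv_bounds x.
move=> x0; rewrite expr2 mulrA normrM [X in _ * X]gtr0_norm// ler_piMl ?(ltW i0)//.
rewrite mulrAC normrM mulr_ile1// gtr0_norm ?mulr_gt0//.
by move: i2 ie i3; rewrite expr2; move: (_^-1) i0 => z; nra.
Qed.

Let Qb r (x : R) : 0 < x -> `|x ^+ 2 * cos (x * r) * (1 + x ^+ 2)^-1 ^+ 2| <= (1 + x ^+ 2)^-1.
Proof.
have [i0 i2 ie i3] := inv_bounds x.
move=> x0; rewrite expr2 mulrA normrM [X in _ * X]gtr0_norm// ler_piMl ?(ltW i0)//.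
by rewrite mulrAC normrM mulr_ile1// gtr0_norm ?mulr_gt0// exprn_gt0.
Qed.

Let Ji r : mu.-integrable `]0, +oo[ (fun x => (cos (x * r) * (1 + x ^+ 2)^-1)%:E).
Proof.
by apply: dominated_cauchy (Jb r) => x _; eapply is_derive_continuous; derive_rule.
Qed.

Let Pi r : mu.-integrable `]0, +oo[ (fun x => (cos (x * r) * (1 + x ^+ 2)^-1 ^+ 2)%:E).
Proof.
by apply: dominated_cauchy (Pb r) => x _; eapply is_derive_continuous; derive_rule.
Qed.

Let Si r : mu.-integrable `]0, +oo[ (fun x => (x * sin (x * r) * (1 + x ^+ 2)^-1 ^+ 2)%:E).
Proof.
by apply: dominated_cauchy (Sb r) => x _; eapply is_derive_continuous; derive_rule.
Qed.

Let dP r : is_derive r 1 P (- S r).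
Proof.
rewrite (_ : - S r = \int[mu]_(x in `]0, +oo[) (- 1 * (x * sin (x * r) * (1 + x ^+ 2)^-1 ^+ 2))); last first.
  by rewrite RintegralZl ?mulN1r//; exact: Si.
apply: (is_derive_under_integral (u := r - 1) (v := r + 1)
  (f := fun r x => cos (x * r) * (1 + x ^+ 2)^-1 ^+ 2)
  (f' := fun r x => -1 * (x * sin (x * r) * (1 + x ^+ 2)^-1 ^+ 2))
  (G := fun x => (1 + x ^+ 2)^-1)) => //.
- lra.
- by move=> s _; exact: Pi.
- by move=> s x _ _; eapply is_derive_eq; [derive_rule|ring].
- by move=> s x _; rewrite /= in_itv/= andbT mulN1r normrN; exact: Sb.
Qed.

Let dS r : is_derive r 1 S (J r - P r).
Proof.
rewrite (_ : J r - P r = \int[mu]_(x in `]0, +oo[) (x ^+ 2 * cos (x * r) * (1 + x ^+ 2)^-1 ^+ 2)); last first.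
  rewrite /J /P -RintegralB//; try exact: Ji; try exact: Pi.
  apply: eq_Rintegral => x _; have [_ _ e _] := inv_bounds x.
  by rewrite -[X in X - _]mulr1 -[X in _ * X - _]e; ring.
apply: (is_derive_under_integral (u := r - 1) (v := r + 1)
  (f := fun r x => x * sin (x * r) * (1 + x ^+ 2)^-1 ^+ 2)
  (f' := fun r x => x ^+ 2 * cos (x * r) * (1 + x ^+ 2)^-1 ^+ 2)
  (G := fun x => (1 + x ^+ 2)^-1)) => //.
- lra.
- by move=> s _; exact: Si.
- by move=> s x _ _; eapply is_derive_eq; [derive_rule|ring].
- by move=> s x _; rewrite /= in_itv/= andbT; exact: Qb.
Qed.

Let rJ r : r * J r = 2 * S r.
Proof.
apply/eqP; rewrite -subr_eq0 /J /S -!RintegralZl//; try exact: Ji; try exact: Si.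
have e1 := integrable_scale r (measurable_itv _) (Ji r).
have e2 := integrable_scale 2 (measurable_itv _) (Si r).
rewrite -RintegralB//; apply/eqP; rewrite -[RHS](subrr 0).
apply: (@RFTC_oy _ _ (fun x => sin (x * r) * (1 + x ^+ 2)^-1)).
- move=> x _; eapply is_derive_eq; first by derive_rule.
  by field.
- by move=> x _; eapply is_derive_continuous; derive_rule.
- have := @cvg_right_for _ (fun x : R => sin (x * r) * (1 + x ^+ 2)^-1) 0.
  by rewrite mul0r sin0 mul0r; apply; eapply is_derive_continuous; derive_rule.
- apply/cvgr0Pnorm_lt => e e0; near=> x.
  have x0 : 0 < x by near: x; exact: nbhs_pinfty_gt.
  have x1 : 1 <= x by near: x; exact: nbhs_pinfty_ge.
  have xe : e^-1 < x by near: x; apply: nbhs_pinfty_gt; exact: num_real.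
  have [i0 _ _ _] := inv_bounds x.
  rewrite normrM [X in _ * X]gtr0_norm//; apply: (@le_lt_trans _ _ (1 + x ^+ 2)^-1).
    by rewrite ler_piMl// ltW.
  by rewrite -[ltRHS]invrK ltf_pV2 ?posrE ?invr_gt0//; rewrite expr2; nra.
- exact: integrable_sub e1 e2.
Unshelve. all: by end_near. Qed.

Let JP_bound r : `|J r| <= pi / 2 /\ `|P r| <= pi / 2.
Proof.
rewrite -cauchy_integrable_int.2; split.
- apply: (le_trans (le_normr_Rintegral _ (Ji r))) => //.
  apply: le_Rintegral => //; first exact: (@integrable_norm _ (measurableTypeR R) R mu _ _ (Ji r)).
  by move=> x; rewrite /= in_itv/= andbT; exact: Jb.
- apply: (le_trans (le_normr_Rintegral _ (Pi r))) => //.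
  apply: le_Rintegral => //; first exact: (@integrable_norm _ (measurableTypeR R) R mu _ _ (Pi r)).
  by move=> x; rewrite /= in_itv/= andbT; exact: Pb.
Qed.

Let J1 r := (J r - 2 * P r) / r.

Let dJ (r : R) : 0 < r -> is_derive r 1 J (J1 r).
Proof.
move=> r0; have h := dS r.
have JE (s : R) : 0 < s -> 2 * S s * s^-1 = J s.
  by move=> s0; rewrite -rJ; field; rewrite gt_eqF.
apply: (near_eq_is_derive (near_pos r0 JE)).
eapply is_derive_eq; first by derive_rule; rewrite gt_eqF.
by rewrite /J1 mul0r add0r mulN1r mulrN -rJ; field; rewrite gt_eqF.
Qed.

Let dJ1 (r : R) : 0 < r -> is_derive r 1 J1 (J r).
Proof.
move=> r0; have h := dJ r0; have h2 := dP r.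
rewrite /J1; eapply is_derive_eq; first by derive_rule; rewrite gt_eqF.
rewrite mul0r add0r mulrN opprK -rJ {1}/J1.
by field; rewrite gt_eqF.
Qed.

(** J + J' is a multiple of exp(r), and it is bounded by the estimates on J and P. *)
Let J1E (r : R) : 0 < r -> J r + J1 r = 0.
Proof.
pose H r := expR (- r) * (J r + J1 r).
have dH (y : R) : 0 < y -> is_derive y 1 H 0.
  move=> r0; have h := dJ r0; have h2 := dJ1 r0.
  by rewrite /H; eapply is_derive_eq; [derive_rule|ring].
have Hc := derive0_pos_cst dH.
have H0 : H s @[s --> +oo] --> (0 : R).
  have h : expR (- s) * (2 * pi) @[s --> +oo] --> (0 : R).
    by rewrite -[X in _ --> X](mul0r (2 * pi)); apply: cvgMl; exact: cvgr_expR.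
  apply: norm_cvg0; apply: (@squeeze_cvgr _ _ _ _ (cst 0)) h; last exact: cvg_cst.
  near=> s; have s1 : 1 <= s by near: s; exact: nbhs_pinfty_ge.
  have s0 : 0 < s by lra.
  rewrite /= normr_ge0/= /H normrM gtr0_norm ?expR_gt0// ler_pM2l ?expR_gt0//.
  have [j p] := JP_bound s.
  have : `|J1 s| <= pi / 2 + 2 * (pi / 2).
    rewrite /J1 normrM [X in _ * X]gtr0_norm ?invr_gt0// ler_pdivrMr//.
    apply: (@le_trans _ _ (pi / 2 + 2 * (pi / 2))).
      rewrite (le_trans (ler_normB _ _))// lerD// normrM ger0_norm//.
      by rewrite ler_wpM2l.
    by rewrite ler_peMr//; have := @pi_gt0 R; lra.
  have := ler_normD (J s) (J1 s); have := @pi_gt0 R; lra.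
move=> r0; have : H r = 0.
  apply: (cvg_unique _ _ H0) => //; apply: cvg_near_cst.
  by near=> t; apply: Hc => //; near: t; exact: nbhs_pinfty_gt.
by move/eqP; rewrite mulf_eq0 gt_eqF ?expR_gt0//= => /eqP.
Unshelve. all: by end_near. Qed.

Let J0 : J r @[r --> 0^'+] --> (pi / 2 : R).
Proof.
rewrite -cauchy_integrable_int.2.
apply: (@dominated_cvg_filter _ (measurableTypeR R) R mu _ (measurable_itv _) _
  (fun r x => cos (x * r) * (1 + x ^+ 2)^-1) _ (fun x => (1 + x ^+ 2)^-1)) => //.
- exact: sequential_at_right.
- by near=> r; apply/measurable_EFinP; exact: (measurable_int _ (Ji r)).
- move=> x _; rewrite -[X in _ --> X]mul1r; apply: cvgMl.
  have := @cvg_right_for _ (fun r : R => cos (x * r)) 0.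
  by rewrite mulr0 cos0; apply; eapply is_derive_continuous; derive_rule.
- by near=> r => x; rewrite /= in_itv/= andbT; exact: Jb.
Unshelve. all: by end_near. Qed.

(** J' = -J leaves a multiple of exp(-r), whose constant is the limit at 0. *)
Lemma cauchy_cos_integral (r : R) : 0 < r ->
  \int[mu]_(x in `]0, +oo[) (cos (x * r) * (1 + x ^+ 2)^-1) = pi / 2 * expR (- r).
Proof.
move=> r0; rewrite -/(J r).
pose H r := expR r * J r.
have dH (y : R) : 0 < y -> is_derive y 1 H 0.
  move=> {}r0; have h := dJ r0; rewrite /H; eapply is_derive_eq; first derive_rule.
  by rewrite mulr1 -mulrDr J1E// mulr0.
have Hc := derive0_pos_cst dH.
have H0 : H s @[s --> 0^'+] --> (1 * (pi / 2) : R).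
  apply: cvgM => //; have := @cvg_right_for _ (@expR R) 0.
  by rewrite expR0; apply; exact: continuous_expR.
have : H r = pi / 2.
  rewrite -[RHS]mul1r; apply/esym; apply: (cvg_unique _ H0) => //; apply: cvg_near_cst.
  by near=> t; apply: Hc => //; near: t; exact: nbhs_right_gt.
rewrite /H => <-; rewrite mulrAC -expRD subrr expR0 mul1r.
by [].
Unshelve. all: by end_near. Qed.

Lemma cauchy_scaled k : 0 < k ->
  mu.-integrable `]0, +oo[ (fun x => (2 * k / (x ^+ 2 + k ^+ 2))%:E) /\
  (forall r : R, 0 < r ->
  \int[mu]_(x in `]0, +oo[) (2 * k / (x ^+ 2 + k ^+ 2) * cos (x * r)) =
    pi * expR (- (k * r))).
Proof.
move=> k0; have ik0 : 0 < k^-1 by rewrite invr_gt0.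
have qk x : x ^+ 2 + k ^+ 2 != 0.
  by rewrite gt_eqF// ltr_wpDl ?sqr_ge0// exprn_gt0.
have qk' x : k ^+ 2 + x ^+ 2 != 0 by rewrite addrC.
have kk : k != 0 by rewrite gt_eqF.
split.
  have := integrable_affine ik0 i1.
  move=> /(integrable_scale (2 / k) (measurable_itv _)).
  apply: eq_integrable => // x _; congr EFin; rewrite add0r; field.
  by rewrite ?qk ?kk.
move=> r r0; have kr0 : 0 < k * r by rewrite mulr_gt0.
have := cauchy_cos_integral kr0; rewrite (Rintegral_affine ik0); last first.
  by apply/measurable_EFinP; exact: (measurable_int _ (Ji (k * r))).
move=> /(congr1 (fun z => 2 * z)); rewrite /= mulrA (_ : 2 * (pi / 2 * _) = pi * expR (- (k * r))); last by field.
move=> <-; rewrite -RintegralZl//; last exact: (integrable_affine ik0 (Ji (k * r))).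
apply: eq_Rintegral => x _; rewrite add0r (_ : k^-1 * x * (k * r) = x * r); last by field.
by field; rewrite ?qk ?qk' ?kk.
Qed.

End cauchy_kernel.

(** * A Stieltjes transform *)

Section stieltjes.
Context {R : realType}.
Implicit Types (p q g t x : R).

Lemma cvg_powR_neg q : q < 0 -> t `^ q @[t --> +oo] --> (0 : R).
Proof.
move=> q0; apply/cvgr0Pnorm_lt => e e0; near=> t.
have nq0 : 0 < - q by lra.
have t0 : 0 < t by near: t; exact: nbhs_pinfty_gt.
have te : e^-1 `^ (- q)^-1 < t by near: t; apply: nbhs_pinfty_gt; exact: num_real.
rewrite ger0_norm ?powR_ge0// -[q]opprK (powRN _ (- q)) -[ltRHS]invrK.
rewrite ltf_pV2 ?posrE ?powR_gt0 ?invr_gt0//.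
apply: (@le_lt_trans _ _ ((e^-1 `^ (- q)^-1) `^ (- q))).
  by rewrite -powRrM mulVf ?gt_eqF// powRr1// invr_ge0 ltW.
by apply: gt0_ltr_powR; rewrite ?nnegrE ?powR_ge0// ltW.
Unshelve. all: by end_near. Qed.

Lemma beta_integrable2 p q : -1 < p -> p + q < -1 ->
  mu.-integrable `]0, +oo[ (fun t => (t `^ p * (1 + t) `^ q)%:E).
Proof.
move=> p1 pq; have r0 : p + q + 1 != 0 by apply/eqP; lra.
have ir : mu.-integrable `]0, +oo[ (fun t => ((1 + t) `^ (p + q))%:E).
  apply: (@ge0_FTC_oy_integrable _ (fun t => (1 + t) `^ (p + q))
    (fun t => (p + q + 1)^-1 * (1 + t) `^ (p + q + 1)) 0
    ((p + q + 1)^-1 * (1 + 0) `^ (p + q + 1)) ((p + q + 1)^-1 * 0)).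
  - move=> t t0; have t1 : 0 < 1 + t by lra.
    eapply is_derive_eq; first by derive_rule.
    rewrite (_ : p + q + 1 - 1 = p + q); last by ring.
    by field.
  - move=> t t0; have t1 : 0 < 1 + t by lra.
    by eapply is_derive_continuous; derive_rule.
  - apply: cvgMr; apply: (cvg_right_for (f := fun t => (1 + t) `^ (p + q + 1))).
    by eapply is_derive_continuous; derive_rule; lra.
  - apply: cvgMr.
    have h : t `^ (p + q + 1) @[t --> +oo] --> (0 : R) by apply: cvg_powR_neg; lra.
    apply: (@squeeze_cvgr _ _ _ _ (cst 0)) h; last exact: cvg_cst.
    near=> t; have t0 : 0 < t by near: t; exact: nbhs_pinfty_gt.
    rewrite /= powR_ge0/= -[p + q + 1]opprK !(powRN _ (- (p + q + 1))).
    rewrite lef_pV2 ?posrE ?powR_gt0//; last by lra.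
    by apply: ge0_ler_powR; rewrite ?nnegrE//; lra.
  - by move=> t _; exact: powR_ge0.
have ib := beta_integrable p1.
(* C controls the range t <= 1, C' the range t >= 1. *)
pose C : R := 1 + 2 `^ (p + q + 2).
pose C' : R := 1 + 2 `^ (- p).
apply: (dominated_integrable (g := fun t =>
  C * (t `^ p * (1 + t) `^ (- p - 2)) + C' * (1 + t) `^ (p + q))) => //.
- apply: continuous_measurable_oy => t t0; have t1 : 0 < 1 + t by lra.
  by eapply is_derive_continuous; derive_rule.
- move=> t; rewrite /= in_itv/= andbT => t0; have t1 : 0 < 1 + t by lra.
  rewrite ger0_norm ?mulr_ge0 ?powR_ge0//.
  have C0 : 0 <= C by rewrite addr_ge0 ?powR_ge0.
  have C0' : 0 <= C' by rewrite addr_ge0 ?powR_ge0.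
  have [t2|t2] := leP t 1.
    apply: (@le_trans _ _ (C * (t `^ p * (1 + t) `^ (- p - 2)))).
      rewrite mulrCA ler_wpM2l ?powR_ge0//.
      rewrite {1}(_ : q = (p + q + 2) + (- p - 2)); last by ring.
      rewrite powR_add// ler_wpM2r ?powR_ge0//.
      rewrite (_ : C = 1 `^ (p + q + 2) + 2 `^ (p + q + 2)); last by rewrite /C powR1.
      by apply: powR_le_bracket; lra.
    by rewrite lerDl mulr_ge0// powR_ge0.
  apply: (@le_trans _ _ (C' * (1 + t) `^ (p + q))).
    rewrite powR_add// mulrA ler_wpM2r ?powR_ge0//.
    have -> : C' * (1 + t) `^ p = ((1 + t) / 2) `^ p + (1 + t) `^ p.
      by rewrite powR_div// /C' powRN; ring.
    by apply: powR_le_bracket; lra.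
  by rewrite lerDr mulr_ge0// mulr_ge0 ?powR_ge0.
- by apply: integrable_add => //; apply: integrable_scale.
Unshelve. all: by end_near. Qed.

Let s t : R := t * (2 + t).

Let s_gt0 t : 0 < t -> 0 < s t. Proof. by move=> t0; rewrite mulr_gt0//; lra. Qed.

Let St g x t := weight g t * (2 * (1 + t)) / (x + s t).

Lemma stieltjes_bound g x0 x t : 0 < x0 -> x0 <= 1 -> x0 <= x -> 0 < t ->
  `|St g x t| <= 2 / x0 * (1 + 2 `^ g) * (t `^ g * (1 + t) `^ (g - 1)).
Proof.
move=> x00 x01 xx0 t0; have t1 : 0 < 1 + t by lra.
have st0 := s_gt0 t0; have xs0 : 0 < x + s t by lra.
rewrite /St ger0_norm; last by rewrite divr_ge0 ?(ltW xs0)// mulr_ge0 ?weight_ge0//; lra.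
have h1 : (2 * (1 + t)) / (x + s t) <= 2 / x0 * (1 + t)^-1.
  rewrite ler_pdivrMr// (_ : _ * (x + s t) = (2 * (x + s t)) / (x0 * (1 + t))); last first.
    by field; rewrite !gt_eqF.
  rewrite ler_pdivlMr ?mulr_gt0//.
  have : 0 <= (1 - x0) * s t by rewrite mulr_ge0 ?subr_ge0// ltW.
  by rewrite /s; nra.
rewrite -mulrA; apply: (@le_trans _ _ ((1 + 2 `^ g) * (t `^ g * (1 + t) `^ g) * (2 / x0 * (1 + t)^-1))).
  by apply: ler_pM => //; [exact: weight_ge0|rewrite divr_ge0 ?(ltW xs0)//; lra|exact: weight_le].
by rewrite powR_add// powRN powRr1 ?(ltW t1)// le_eqVlt; apply/orP; left; apply/eqP; ring.
Qed.

Lemma stieltjes_integrable g x : -1 < g -> g < 0 -> 0 < x ->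
  mu.-integrable `]0, +oo[ (EFin \o St g x).
Proof.
move=> g1 g0 x0; set m := Num.min x 1.
have m0 : 0 < m by rewrite lt_min x0 ltr01.
apply: (dominated_integrable (g := fun t => 2 / m * (1 + 2 `^ g) * (t `^ g * (1 + t) `^ (g - 1)))) => //.
- apply: continuous_measurable_oy => t t0; have := s_gt0 t0; rewrite /s => st0.
  eapply is_derive_continuous; rewrite /St /weight /s; derive_rule => //.
  by rewrite gt_eqF//; lra.
- move=> t; rewrite /= in_itv/= andbT => t0; apply: stieltjes_bound => //.
    by rewrite ge_min lexx orbT.
  by rewrite ge_min lexx.
- by apply: integrable_scale => //; apply: beta_integrable2; lra.
Qed.

(** Let c(x) be the integral. Integrating the derivative of (t(2+t))^(g+1)/(x+t(2+t)) gives g c = x c', so that c(x) x^(-g) is constant. This avoids the substitution and the scaling that would identify c(1) as a Beta value; only its positivity matters. *)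
Lemma stieltjes_transform g : -1 < g -> g < 0 -> exists2 B : R, 0 < B &
  forall x : R, 0 < x -> \int[mu]_(t in `]0, +oo[) St g x t = B * x `^ g.
Proof.
move=> g1 g0.
pose c x := \int[mu]_(t in `]0, +oo[) St g x t.
pose c' x := \int[mu]_(t in `]0, +oo[) (- (St g x t / (x + s t))).
have c'i x : 0 < x -> mu.-integrable `]0, +oo[ (fun t => (- (St g x t / (x + s t)))%:E).
  move=> x0; apply: (dominated_integrable (g := fun t => x^-1 * `|St g x t|)) => //.
  - apply: continuous_measurable_oy => t t0; have := s_gt0 t0; rewrite /s => st0.
    eapply is_derive_continuous; rewrite /St /weight /s; derive_rule => //;
      by rewrite gt_eqF//; lra.
  - move=> t; rewrite /= in_itv/= andbT => t0; have st0 := s_gt0 t0.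
    rewrite normrN normrM mulrC ler_wpM2r// gtr0_norm ?invr_gt0//; last by lra.
    by rewrite lef_pV2 ?posrE//; lra.
  - apply: integrable_scale => //; apply: (@integrable_norm _ (measurableTypeR R) R mu).
    exact: stieltjes_integrable.
have dc (x : R) : 0 < x -> is_derive x 1 c (c' x).
  move=> x0; set m := Num.min (x / 2) 1.
  have m0 : 0 < m by rewrite lt_min ltr01 divr_gt0.
  have m1 : m <= 1 by rewrite ge_min lexx orbT.
  have mx : m <= x / 2 by rewrite ge_min lexx.
  apply: (is_derive_under_integral (u := x / 2) (v := x * 2) (f := St g)
    (f' := fun x t => - (St g x t / (x + s t)))
    (G := fun t => m^-1 * (2 / m * (1 + 2 `^ g) * (t `^ g * (1 + t) `^ (g - 1))))).
  - exact: measurable_itv.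
  - by lra.
  - by move=> y /andP[xy _]; apply: stieltjes_integrable => //; lra.
  - move=> y t /andP[xy _]; rewrite /= in_itv/= andbT => t0; have st0 := s_gt0 t0.
    rewrite /St; eapply is_derive_eq; first by derive_rule; rewrite gt_eqF//; lra.
    by field; rewrite gt_eqF//; lra.
  - by do 2 apply: integrable_scale => //; apply: beta_integrable2; lra.
  - move=> y t /andP[xy _]; rewrite /= in_itv/= andbT => t0; have st0 := s_gt0 t0.
    rewrite normrN normrM mulrC; apply: ler_pM => //.
      rewrite gtr0_norm ?invr_gt0//; last by lra.
      by rewrite lef_pV2 ?posrE//; lra.
    by apply: stieltjes_bound => //; lra.
have ode (x : R) : 0 < x -> g * c x - x * c' x = 0.
  move=> x0; rewrite -!RintegralZl//; [|exact: c'i|exact: stieltjes_integrable].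
  have e1 := integrable_scale g (measurable_itv _) (stieltjes_integrable g1 g0 x0).
  have e2 := integrable_scale x (measurable_itv _) (c'i _ x0).
  rewrite -RintegralB//; rewrite -[RHS](subrr 0).
  apply: (@RFTC_oy _ _ (fun t => (t * (2 + t)) `^ (g + 1) / (x + t * (2 + t)))).
  - move=> t t0; have := s_gt0 t0; rewrite /s => st0.
    eapply is_derive_eq; first by derive_rule => //; rewrite gt_eqF//; lra.
    rewrite (_ : g + 1 - 1 = g) ?powR_add ?powRr1 ?ltW//; last by ring.
    by rewrite /St /weight /s; field; rewrite gt_eqF//; lra.
  - move=> t t0; have := s_gt0 t0; rewrite /s => st0.
    eapply is_derive_continuous; rewrite /St /weight /s; derive_rule => //;
      by rewrite gt_eqF//; lra.
  - have h : x^-1 * (3 `^ (g + 1) * t `^ (g + 1)) @[t --> 0^'+] --> (0 : R).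
      rewrite -[X in _ --> X](mulr0 x^-1); apply: cvgMr.
      rewrite -[X in _ --> X](mulr0 (3 `^ (g + 1))); apply: cvgMr.
      by apply: powR_cvg0; lra.
    apply: (@squeeze_cvgr _ _ _ _ (cst 0)) h; last exact: cvg_cst.
    near=> t; have t0 : 0 < t by near: t; exact: nbhs_right_gt.
    have t1 : t <= 1 by near: t; exact: nbhs_right_le.
    have := s_gt0 t0; rewrite /s => st0.
    rewrite /= divr_ge0 ?powR_ge0//=; last by lra.
    rewrite mulrC; apply: ler_pM; rewrite ?powR_ge0 ?invr_ge0//; [lra| |].
      by rewrite lef_pV2 ?posrE//; lra.
    rewrite -powRM ?(ltW t0)//.
    by apply: ge0_ler_powR; rewrite ?nnegrE//; nra.
  - have h : (t * (2 + t)) `^ g @[t --> +oo] --> (0 : R).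
      apply: (cvg_comp (fun t => t * (2 + t)) (fun z => z `^ g)); last exact: cvg_powR_neg.
      apply/cvgryPge => A; near=> t.
      have t1 : 1 <= t by near: t; exact: nbhs_pinfty_ge.
      have tA : A <= t by near: t; apply: nbhs_pinfty_ge; exact: num_real.
      by nra.
    apply: (@squeeze_cvgr _ _ _ _ (cst 0)) h; last exact: cvg_cst.
    near=> t; have t0 : 0 < t by near: t; exact: nbhs_pinfty_gt.
    have := s_gt0 t0; rewrite /s => st0.
    rewrite /= divr_ge0 ?powR_ge0//=; last by lra.
    rewrite powR_add// powRr1 ?(ltW st0)// ler_pdivrMr; last by lra.
    by rewrite ler_wpM2l ?powR_ge0//; lra.
  - exact: integrable_sub e1 e2.
have cst_c : forall x y : R, 0 < x -> 0 < y -> c x * x `^ (- g) = c y * y `^ (- g).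
  apply: derive0_pos_cst => x x0; have h := dc _ x0.
  eapply is_derive_eq; first by derive_rule.
  rewrite (@powR_add _ _ (- g)) // (powRN _ 1) powRr1 ?ltW//.
  have -> : c' x = (g * c x) / x.
    by apply: (@mulfI _ x); rewrite ?gt_eqF// mulrCA mulfV ?gt_eqF// mulr1; have := ode _ x0; lra.
  by field; rewrite gt_eqF.
exists (c 1).
  apply: Rintegral_oy_gt0; last exact: stieltjes_integrable.
  move=> t t0; have st0 := s_gt0 t0.
  by rewrite /St divr_gt0 ?mulr_gt0 ?weight_gt0//; lra.
move=> x x0; rewrite -/(c x).
have := cst_c _ _ x0 ltr01; rewrite powR1 mulr1 => <-.
by rewrite -mulrA -powR_add// addNr powRr0 mulr1.
Unshelve. all: by end_near. Qed.

End stieltjes.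

(** * Cosine and Laplace transforms *)

Section decaying.
Context {R : realType}.
Implicit Types (h k : R -> R) (c e L lam kap a g x : R).

Lemma expR_integrable c : 0 < c ->
  mu.-integrable `]0, +oo[ (fun t => (expR (- (c * t)))%:E).
Proof.
move=> c0; have p0 : -1 < 0 :> R by lra.
have := gamma_integrable p0 c0; congr (mu.-integrable _ _).
by apply/funext => t; rewrite powRr0 mul1r.
Qed.

(** The class of functions to which the Fourier identity applies: they vanish near 0, so that no boundary term appears at 0, and N derivatives decay like exp(-c r). For negative c the functions may grow, which is needed in intermediate steps. *)
Definition decaying N c h := (exists2 d : R, 0 < d & forall x : R, 0 < x -> x <= d -> h x = 0) /\
  jet exp_bounded 0 N c 0 h.

Lemma decaying_bound N c h : decaying N c h ->
  exists2 C : R, 0 <= C & forall x : R, 0 < x -> `|h x| <= C * expR (- (c * x)).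
Proof.
move=> [[d d0 hd] /jet0 /(_ _ d0) [C HC]]; exists `|C| => // x x0.
have [xd|/ltW dx] := leP x d; first by rewrite hd// normr0 mulr_ge0 ?expR_ge0.
by apply: (le_trans (HC _ dx)); rewrite ler_wpM2r ?expR_ge0// ler_norm.
Qed.

Lemma decaying_leq N N' c h : (N <= N')%N -> decaying N' c h -> decaying N c h.
Proof. by move=> NN [hd jh]; split => //; exact: jet_leq jh. Qed.

Lemma decaying_ext N c h k : (forall x : R, 0 < x -> h x = k x) ->
  decaying N c h -> decaying N c k.
Proof.
move=> hk [[d d0 hd] jh]; split; last exact: jet_ext exp_bounded_compat hk jh.
by exists d => // x x0 xd; rewrite -hk// hd.
Qed.

Lemma decaying_is_derive N c h x : decaying N.+1 c h -> 0 < x ->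
  is_derive x 1 h (derive1 h x).
Proof. by move=> [_ jh] x0; exact: jet_derive jh _ x0. Qed.

Lemma decaying_derive N c h : decaying N.+1 c h -> decaying N c (derive1 h).
Proof.
move=> [[d d0 hd] [_ dh jh]]; split; last first.
  by move: jh; rewrite addr0; apply: exp_bounded_jet_irrel.
exists (d / 2); first by rewrite divr_gt0.
move=> x x0 xd; rewrite derive1E (@near_eq_derive _ _ _ h (cst 0) x 1).
  exact: derive_cst.
near=> y; have y0 : 0 < y by near: y; exact: lt_nbhsr.
have yd : y < d by near: y; apply: lt_nbhsl; lra.
by rewrite hd// ltW.
Unshelve. all: by end_near. Qed.

Lemma decaying_mul N c e k h : jet exp_bounded 0 N e 0 k -> decaying N c h ->
  decaying N (e + c) (fun x => k x * h x).
Proof.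
move=> jk [[d d0 hd] jh]; split; last exact: exp_bounded_jet_mul jk jh.
by exists d => // x x0 xd; rewrite hd// mulr0.
Qed.

Lemma decaying_scale N c (k : R) h : decaying N c h -> decaying N c (fun x => k * h x).
Proof.
by move=> /(decaying_mul (exp_bounded_cst k N 0)); rewrite add0r.
Qed.

Lemma decaying_add N c h k : decaying N c h -> decaying N c k ->
  decaying N c (fun x => h x + k x).
Proof.
move=> [[d d0 hd] jh] [[d' d'0 kd] jk]; split.
  exists (Num.min d d'); first by rewrite lt_min d0.
  by move=> x x0; rewrite le_min => /andP[xd xd']; rewrite hd// kd// addr0.
rewrite -[0 in X in jet _ _ _ _ X]addr0; apply: jet_add => //.
exact: exp_bounded_compat.
Qed.

Lemma decaying_continuous N c h x : decaying N.+1 c h -> 0 < x -> {for x, continuous h}.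
Proof. by move=> dh x0; exact: is_derive_continuous (decaying_is_derive dh x0). Qed.

Lemma decaying_measurable N c h : decaying N.+1 c h -> measurable_fun `](0 : R), +oo[ h.
Proof. by move=> dh; apply: continuous_measurable_oy => x; exact: decaying_continuous dh. Qed.

Lemma decaying_integrable N c h : 0 < c -> decaying N.+1 c h ->
  mu.-integrable `]0, +oo[ (EFin \o h).
Proof.
move=> c0 dh; have [C C0 HC] := decaying_bound dh.
apply: (dominated_integrable (g := fun x => C * expR (- (c * x)))) => //.
- exact: decaying_measurable dh.
- by move=> x; rewrite /= in_itv/= andbT; exact: HC.
- by apply: integrable_scale => //; exact: expR_integrable.
Qed.

Lemma decaying_cvg0 N c h : decaying N c h -> h x @[x --> 0^'+] --> (0 : R).
Proof.
move=> [[d d0 hd] _]; apply: (@cvg_trans _ ((cst 0 : R -> R) @ 0^'+)); last exact: cvg_cst.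
apply: near_eq_cvg; near=> x.
have x0 : 0 < x by near: x; exact: nbhs_right_gt.
by rewrite hd//; near: x; exact: nbhs_right_le.
Unshelve. all: by end_near. Qed.

Lemma decaying_cvgy N c h : 0 < c -> decaying N c h -> h x @[x --> +oo] --> (0 : R).
Proof.
move=> c0 dh; have [C C0 HC] := decaying_bound dh.
have h0 : C * expR (- (c * x)) @[x --> +oo] --> (0 : R).
  rewrite -[X in _ --> X](mulr0 C); apply: cvgMr.
  have := cvg_pow_expN 0 c0; apply: cvg_trans; apply: near_eq_cvg; near=> x.
  by rewrite powRr0 mul1r.
have h1 : `|h x| @[x --> +oo] --> (0 : R).
  apply: (@squeeze_cvgr _ _ _ _ (cst 0)) h0; last exact: cvg_cst.
  by near=> x; rewrite /= normr_ge0/= HC//; near: x; exact: nbhs_pinfty_gt.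
exact/norm_cvg0P.
Unshelve. all: by end_near. Qed.

Lemma decaying_int_derive N c h : 0 < c -> decaying N.+2 c h ->
  \int[mu]_(x in `]0, +oo[) derive1 h x = 0.
Proof.
move=> c0 dh; have dh' := decaying_derive dh.
rewrite -[RHS](subrr 0); apply: (@RFTC_oy _ _ h).
- by move=> x x0; exact: decaying_is_derive dh x0.
- by move=> x x0; exact: decaying_continuous dh' x0.
- exact: decaying_cvg0 dh.
- exact: decaying_cvgy dh.
- exact: decaying_integrable dh'.
Qed.

Lemma exp_bounded_exp (k : R) N L : jet exp_bounded 0 N k L (fun x : R => expR (- (k * x))).
Proof.
elim: N L => [|N IH] L; first by move=> d d0; exists 1 => r dr; rewrite mul1r ger0_norm ?expR_ge0.
apply: (jet_step exp_bounded_compat (f' := fun x => - k * expR (- (k * x)))).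
- by move=> d d0; exists 1 => r dr; rewrite mul1r ger0_norm ?expR_ge0.
- by move=> x x0; eapply is_derive_eq; first derive_rule; ring.
- rewrite addr0; apply: (@exp_bounded_jet_mul _ N 0 k k _ (fun=> - k) (fun x : R => expR (- (k * x)))).
  + by rewrite add0r.
  + exact: exp_bounded_cst.
  + exact: IH.
Qed.

End decaying.

Section cosine_transform.
Context {R : realType}.
Implicit Types (h k : R -> R) (c e L lam kap a g x : R).
Local Notation T := (measurableTypeR R).

Definition cos_transform h lam := \int[mu]_(x in `]0, +oo[) (h x * cos (lam * x)) : R.

Definition laplace_transform h kap := \int[mu]_(x in `]0, +oo[) (h x * expR (- (kap * x))) : R.

Lemma measurable_prod_fst (D E : set R) (f : R -> R) : measurable (D : set T) ->
  measurable (E : set T) ->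
  measurable_fun D f -> measurable_fun (D `*` E : set (T * T)) (fun z : T * T => f z.1).
Proof.
move=> mD mE mf; apply: (measurable_comp (F := D) (f := f) (g := fst)) => //.
  by move=> _ [z [Dz _] <-].
by apply: measurable_funTS; exact: measurable_fst.
Qed.

Lemma measurable_prod_snd (D E : set R) (f : R -> R) : measurable (D : set T) ->
  measurable (E : set T) ->
  measurable_fun E f -> measurable_fun (D `*` E : set (T * T)) (fun z : T * T => f z.2).
Proof.
move=> mD mE mf; apply: (measurable_comp (F := E) (f := f) (g := snd)) => //.
  by move=> _ [z [_ Ez] <-].
by apply: measurable_funTS; exact: measurable_snd.
Qed.

Lemma measurable_comp_pos d (X : measurableType d) (D : set X) (f : R -> R) (u : X -> R) :
  (forall x : R, 0 < x -> {for x, continuous f}) -> (forall z, D z -> 0 < u z) ->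
  measurable_fun D u -> measurable_fun D (fun z => f (u z)).
Proof.
move=> cf u0 mu_; apply: (@measurable_comp _ _ _ X T T `]0, +oo[%classic f D u) => //.
  by move=> _ [z Dz <-]; rewrite /= in_itv/= andbT; exact: u0.
exact: continuous_measurable_oy.
Qed.

Lemma decaying_cos N c h lam : decaying N c h -> decaying N c (fun x => h x * cos (lam * x)).
Proof.
move=> /(decaying_mul (exp_bounded_trig lam N 0).1); rewrite add0r.
by apply: decaying_ext => x _; rewrite mulrC.
Qed.

Lemma decaying_sin N c h lam : decaying N c h -> decaying N c (fun x => h x * sin (lam * x)).
Proof.
move=> /(decaying_mul (exp_bounded_trig lam N 0).2); rewrite add0r.
by apply: decaying_ext => x _; rewrite mulrC.
Qed.

Lemma decaying_exp N c h kap : decaying N c h ->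
  decaying N (kap + c) (fun x => h x * expR (- (kap * x))).
Proof.
move=> /(decaying_mul (exp_bounded_exp kap N 0)).
by apply: decaying_ext => x _; rewrite mulrC.
Qed.

Lemma cos_transform_bound c h lam : 0 < c -> decaying 1 c h ->
  `|cos_transform h lam| <= \int[mu]_(x in `]0, +oo[) `|h x|.
Proof.
move=> c0 dh; have ih := decaying_integrable c0 dh.
have ic := decaying_integrable c0 (decaying_cos lam dh).
apply: (le_trans (@le_normr_Rintegral _ T R mu _ _ (measurable_itv _) ic)).
apply: le_Rintegral => //.
- exact: (@integrable_norm _ T R mu _ _ ic).
- exact: (@integrable_norm _ T R mu _ _ ih).
- move=> x _ /=; rewrite normrM ler_piMr// ler_norml cos_geN1 cos_le1//.
Qed.

Lemma continuous_cos_transform c h lam : 0 < c -> decaying 1 c h -> {for lam, continuous (cos_transform h)}.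
Proof.
move=> c0 dh.
apply: (@dominated_cvg_filter _ T R mu _ (measurable_itv _) (nbhs lam)
   (fun l x => h x * cos (l * x)) _ (fun x => `|h x|)).
- exact: sequential_nbhs.
- by apply: nearW => l; exact: decaying_measurable (decaying_cos l dh).
- move=> x _; apply: cvgMr.
  have hc : {for lam, continuous (fun l : R => cos (l * x))}.
    by eapply is_derive_continuous; derive_rule.
  exact: hc.
- exact: (@integrable_norm _ T R mu _ _ (decaying_integrable c0 dh)).
- apply: nearW => l x _; rewrite normrM ler_piMr// ler_norml cos_geN1 cos_le1//.
Qed.

Lemma measurable_cos_transform c h : 0 < c -> decaying 1 c h -> measurable_fun `](0 : R), +oo[ (cos_transform h).
Proof. by move=> c0 dh; apply: continuous_measurable_oy => lam _; exact: continuous_cos_transform dh. Qed.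

Lemma cos_transform_poisson c h kap : 0 < c -> 0 < kap -> decaying 1 c h ->
  \int[mu]_(lam in `]0, +oo[) (2 * kap / (lam ^+ 2 + kap ^+ 2) * cos_transform h lam) =
  pi * laplace_transform h kap.
Proof.
move=> c0 k0 dh; have [ik Ek] := cauchy_scaled k0.
have ih := decaying_integrable c0 dh.
pose q lam := 2 * kap / (lam ^+ 2 + kap ^+ 2).
have q0 lam : 0 <= q lam by rewrite divr_ge0 ?addr_ge0 ?sqr_ge0// mulr_ge0 ?ltW.
have ic lam := decaying_integrable c0 (decaying_cos lam dh).
transitivity (\int[mu]_(lam in `]0, +oo[) \int[mu]_(x in `]0, +oo[)
    (q lam * (h x * cos (lam * x)))).
  by apply: eq_Rintegral => lam _; rewrite RintegralZl.
rewrite (RFubini (G := fun lam => (\int[mu]_(x in `]0, +oo[) `|h x|) * q lam)) //; last first.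
- move=> lam _.
  have iN : mu.-integrable `]0, +oo[ (EFin \o (fun x => `|h x|)).
    exact: (@integrable_norm _ T R mu _ _ ih).
  rewrite mulrC -RintegralZl//; apply: le_Rintegral => //.
  + exact: (@integrable_norm _ T R mu _ _ (integrable_scale (q lam) (measurable_itv _) (ic lam))).
  + exact: integrable_scale.
  + move=> x _; rewrite normrM ger0_norm// ler_wpM2l// normrM ler_piMr//.
    by rewrite ler_norml cos_geN1 cos_le1.
- by move=> lam _; exact: integrable_scale.
- exact: integrable_scale.
- apply: measurable_funM.
    apply: measurable_prod_fst => //.
    by apply/measurable_EFinP; case/integrableP : ik.
  apply: measurable_funM; first by apply: measurable_prod_snd => //; exact: decaying_measurable dh.
  apply: measurable_funTS; apply: measurableT_comp.
    exact: (continuous_measurable_fun (@continuous_cos R)).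
  by apply: measurable_funM; [exact: measurable_fst|exact: measurable_snd].
rewrite /laplace_transform -RintegralZl//; last first.
  by apply: decaying_integrable (decaying_exp _ dh); lra.
apply: eq_Rintegral => x; rewrite inE/= in_itv/= andbT => x0.
rewrite mulrCA -Ek// -RintegralZl//; last first.
  apply: (dominated_integrable (g := q)) => //.
    apply: measurable_funM; first by apply/measurable_EFinP; case/integrableP : ik.
    apply: measurable_funTS; apply: measurableT_comp; last exact: measurable_funM.
    exact: (continuous_measurable_fun (@continuous_cos R)).
  by move=> y _; rewrite -/(q y) normrM ger0_norm// ler_piMr// ler_norml cos_geN1 cos_le1.
by apply: eq_Rintegral => lam _; rewrite /q; ring.
Qed.

(** The exponential factor comes from the vanishing of h near 0; it compensates the growth of the weight at infinity. *)
Lemma laplace_transform_bound c h : 0 < c -> decaying 1 c h -> exists2 d : R, 0 < d &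
  forall kap : R, 0 < kap ->
    `|laplace_transform h kap| <= (\int[mu]_(x in `]0, +oo[) `|h x|) * expR (- (kap * d)).
Proof.
move=> c0 dh; have [[d d0 hd] _] := dh; exists d => // kap k0.
have ih := decaying_integrable c0 dh.
have iN : mu.-integrable `]0, +oo[ (EFin \o (fun x => `|h x|)).
  exact: (@integrable_norm _ T R mu _ _ ih).
have kc : 0 < kap + c by lra.
have ie := decaying_integrable kc (decaying_exp kap dh).
apply: (le_trans (@le_normr_Rintegral _ T R mu _ _ (measurable_itv _) ie)).
rewrite mulrC -RintegralZl//; apply: le_Rintegral => //.
- exact: (@integrable_norm _ T R mu _ _ ie).
- exact: integrable_scale.
- move=> x; rewrite /= in_itv/= andbT => x0; rewrite normrM mulrC.
  have [xd|dx] := leP x d; first by rewrite hd// normr0 !mulr0.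
  rewrite ger0_norm ?expR_ge0// ler_wpM2r// ler_expR; nra.
Qed.

Lemma continuous_laplace_transform c h kap : 0 < c -> 0 < kap -> decaying 1 c h ->
  {for kap, continuous (laplace_transform h)}.
Proof.
move=> c0 k0 dh.
apply: (@dominated_cvg_filter _ T R mu _ (measurable_itv _) (nbhs kap)
   (fun l x => h x * expR (- (l * x))) _ (fun x => `|h x|)).
- exact: sequential_nbhs.
- by apply: nearW => l; exact: decaying_measurable (decaying_exp l dh).
- move=> x _; apply: cvgMr.
  have hc : {for kap, continuous (fun l : R => expR (- (l * x)))}.
    by eapply is_derive_continuous; derive_rule.
  exact: hc.
- exact: (@integrable_norm _ T R mu _ _ (decaying_integrable c0 dh)).
- near=> l => x; rewrite /= in_itv/= andbT => x0.
  have l0 : 0 < l by near: l; exact: lt_nbhsr.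
  rewrite normrM ler_piMr// ger0_norm ?expR_ge0//.
  by rewrite expR_le1 oppr_le0 mulr_ge0// ltW.
Unshelve. all: by end_near. Qed.

Lemma weight_laplace_transform_integrable a g c h : 0 < a -> -1 < g -> 0 < c -> decaying 1 c h ->
  mu.-integrable `]0, +oo[ (fun t => (weight g t * laplace_transform h (a * (1 + t)))%:E).
Proof.
move=> a0 g1 c0 dh; have [d d0 hd] := laplace_transform_bound c0 dh.
set M := \int[mu]_(x in _) _ in hd.
apply: (dominated_integrable (g := fun t => M *
  (weight g t * (a * (1 + t)) ^+ 0 * expR (- (a * (1 + t) * d))))) => //.
- apply: continuous_measurable_oy => t t0.
  have st0 : 0 < t * (2 + t) by rewrite mulr_gt0//; lra.
  have k0 : 0 < a * (1 + t) by rewrite mulr_gt0//; lra.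
  have h1 : {for t, continuous (weight g)}.
    by rewrite /weight; eapply is_derive_continuous; derive_rule.
  have h2 : {for t, continuous (fun t : R => laplace_transform h (a * (1 + t)))}.
    apply: (@cvg_comp_for R R _ (laplace_transform h) (fun t : R => a * (1 + t))).
      have h3 : {for t, continuous (fun t : R => a * (1 + t))}.
        by eapply is_derive_continuous; derive_rule.
      exact: h3.
    exact: continuous_laplace_transform dh.
  exact: cvgM h1 h2.
- move=> t; rewrite /= in_itv/= andbT => t0.
  have k0 : 0 < a * (1 + t) by rewrite mulr_gt0//; lra.
  rewrite expr0 mulr1 normrM ger0_norm ?weight_ge0// mulrCA ler_wpM2l ?weight_ge0//.
  exact: hd.
- by apply: integrable_scale => //; exact: profile_integrable.
Qed.

Lemma poisson_cos_transform_integrable c h kap : 0 < c -> 0 < kap -> decaying 1 c h ->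
  mu.-integrable `]0, +oo[ (fun lam => (2 * kap / (lam ^+ 2 + kap ^+ 2) * cos_transform h lam)%:E).
Proof.
move=> c0 k0 dh; have [ik _] := cauchy_scaled k0.
have mk : measurable_fun `](0 : R), +oo[ (fun lam => 2 * kap / (lam ^+ 2 + kap ^+ 2)).
  by apply/measurable_EFinP; case/integrableP : ik.
apply: (dominated_integrable (g := fun lam => (\int[mu]_(x in `]0, +oo[) `|h x|) *
  (2 * kap / (lam ^+ 2 + kap ^+ 2)))) => //.
- by apply: measurable_funM => //; exact: measurable_cos_transform dh.
- move=> lam _; rewrite normrM ger0_norm; last first.
    by rewrite divr_ge0 ?addr_ge0 ?sqr_ge0// mulr_ge0 ?ltW.
  rewrite mulrC ler_wpM2r ?(cos_transform_bound _ c0)//.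
  by rewrite divr_ge0 ?addr_ge0 ?sqr_ge0// mulr_ge0 ?ltW.
- exact: integrable_scale.
Qed.

End cosine_transform.

(** * Integration of the symbol against a cosine transform *)

Section fourier_identity.
Context {R : realType}.
Implicit Types (h k : R -> R) (c e L lam kap a g x : R).
Local Notation T := (measurableTypeR R).

(** The function h' cos(lam x) + lam h sin(lam x) vanishes at both ends, and its derivative is (h'' + lam^2 h) cos(lam x). *)
Lemma cos_transform_derive2 c h lam : 0 < c -> decaying 3 c h ->
  cos_transform (derive1 (derive1 h)) lam = - lam ^+ 2 * cos_transform h lam.
Proof.
move=> c0 dh; have dh' := decaying_derive dh; have dh'' := decaying_derive dh'.
pose F x := derive1 h x * cos (lam * x) + lam * (h x * sin (lam * x)).
have dF : decaying 2 c F.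
  apply: decaying_add; first exact: decaying_cos.
  by apply: decaying_scale; apply: decaying_sin; exact: decaying_leq dh.
have i1 := decaying_integrable c0 (decaying_cos lam dh'').
have i2 := decaying_integrable c0 (decaying_cos lam dh).
have e2 := integrable_scale (lam ^+ 2) (measurable_itv _) i2.
apply/eqP; rewrite mulNr -addr_eq0 /cos_transform -RintegralZl// -RintegralD//.
apply/eqP; rewrite -[RHS](decaying_int_derive c0 dF).
apply: eq_Rintegral => x; rewrite inE/= in_itv/= andbT => x0.
have d1 := decaying_is_derive dh x0; have d2 := decaying_is_derive dh' x0.
symmetry; apply: is_derive_derive1.
rewrite /F; eapply is_derive_eq; first by derive_rule.
by ring.
Qed.

(** Same argument with (h' + kap h) exp(-kap x). *)
Lemma laplace_transform_derive2 c h kap : 0 < c -> 0 < kap -> decaying 3 c h ->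
  laplace_transform (derive1 (derive1 h)) kap = kap ^+ 2 * laplace_transform h kap.
Proof.
move=> c0 k0 dh; have dh' := decaying_derive dh; have dh'' := decaying_derive dh'.
have kc : 0 < kap + c by lra.
pose F x := derive1 h x * expR (- (kap * x)) + kap * (h x * expR (- (kap * x))).
have dF : decaying 2 (kap + c) F.
  apply: decaying_add; first exact: decaying_exp.
  by apply: decaying_scale; apply: decaying_exp; exact: decaying_leq dh.
have i1 := decaying_integrable kc (decaying_exp kap dh'').
have i2 := decaying_integrable kc (decaying_exp kap dh).
have e2 := integrable_scale (kap ^+ 2) (measurable_itv _) i2.
apply/eqP; rewrite -subr_eq0 /laplace_transform -RintegralZl// -RintegralB//.
apply/eqP; rewrite -[RHS](decaying_int_derive kc dF).
apply: eq_Rintegral => x; rewrite inE/= in_itv/= andbT => x0.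
have d1 := decaying_is_derive dh x0; have d2 := decaying_is_derive dh' x0.
symmetry; apply: is_derive_derive1.
rewrite /F; eapply is_derive_eq; first by derive_rule.
by ring.
Qed.

(** The operator a^2 - d^2/dx^2, which multiplies cosine transforms by lam^2 + a^2 and Laplace transforms at kap by a^2 - kap^2. *)
Definition helmholtz a h := fun x : R => a ^+ 2 * h x + - 1 * derive1 (derive1 h) x.

Lemma helmholtz_decaying N a c h : decaying N.+2 c h -> decaying N c (helmholtz a h).
Proof.
move=> dh; apply: decaying_add; apply: decaying_scale.
  by apply: decaying_leq dh; rewrite leqW// leqnSn.
by do 2 apply: decaying_derive.
Qed.

Lemma cos_transform_helmholtz a c h lam : 0 < c -> decaying 3 c h ->
  cos_transform (helmholtz a h) lam = (lam ^+ 2 + a ^+ 2) * cos_transform h lam.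
Proof.
move=> c0 dh; have dh'' := decaying_derive (decaying_derive dh).
have i1 := decaying_integrable c0 (decaying_cos lam dh'').
have i2 := decaying_integrable c0 (decaying_cos lam dh).
have e1 := integrable_scale (-1) (measurable_itv _) i1.
have e2 := integrable_scale (a ^+ 2) (measurable_itv _) i2.
transitivity (a ^+ 2 * cos_transform h lam + -1 * cos_transform (derive1 (derive1 h)) lam); last first.
  by rewrite (cos_transform_derive2 _ c0)//; ring.
rewrite /cos_transform -!RintegralZl// -RintegralD//.
by apply: eq_Rintegral => x _; rewrite /helmholtz; ring.
Qed.

Lemma laplace_transform_helmholtz a c h kap : 0 < c -> 0 < kap -> decaying 3 c h ->
  laplace_transform (helmholtz a h) kap = (a ^+ 2 - kap ^+ 2) * laplace_transform h kap.
Proof.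
move=> c0 k0 dh; have dh'' := decaying_derive (decaying_derive dh).
have kc : 0 < kap + c by lra.
have i1 := decaying_integrable kc (decaying_exp kap dh'').
have i2 := decaying_integrable kc (decaying_exp kap dh).
have e1 := integrable_scale (-1) (measurable_itv _) i1.
have e2 := integrable_scale (a ^+ 2) (measurable_itv _) i2.
transitivity (a ^+ 2 * laplace_transform h kap + -1 * laplace_transform (derive1 (derive1 h)) kap); last first.
  by rewrite (laplace_transform_derive2 c0 k0)//; ring.
rewrite /laplace_transform -!RintegralZl// -RintegralD//.
by apply: eq_Rintegral => x _; rewrite /helmholtz; ring.
Qed.

Lemma cos_transform_decay1 a c h : 0 < c -> decaying 3 c h -> exists2 C : R, 0 <= C &
  forall lam, `|cos_transform h lam| * (lam ^+ 2 + a ^+ 2) <= C.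
Proof.
move=> c0 dh; exists (\int[mu]_(x in `]0, +oo[) `|helmholtz a h x|).
  by apply: Rintegral_ge0.
move=> lam; rewrite -[X in _ * X <= _]ger0_norm ?addr_ge0 ?sqr_ge0//.
rewrite mulrC -normrM -(cos_transform_helmholtz _ _ c0)//.
by apply: (cos_transform_bound _ c0); exact: helmholtz_decaying.
Qed.

(** Applying the operator twice gives decay of order 4 in lam, enough for integrability against a symbol of order less than 2. *)
Lemma cos_transform_decay2 a c h : 0 < c -> decaying 5 c h -> exists2 C : R, 0 <= C &
  forall lam, `|cos_transform h lam| * (lam ^+ 2 + a ^+ 2) ^+ 2 <= C.
Proof.
move=> c0 dh; have [C C0 HC] := cos_transform_decay1 a c0 (helmholtz_decaying a dh).
exists C => // lam; apply: le_trans (HC lam).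
rewrite (cos_transform_helmholtz a lam c0 (decaying_leq (isT : (3 <= 5)%N) dh)) normrM.
rewrite [X in _ <= X * _ * _]ger0_norm ?addr_ge0 ?sqr_ge0// expr2.
by rewrite [_ * `|cos_transform h lam|]mulrC mulrA.
Qed.

Lemma symbol_inv_integrable a : 0 < a ->
  mu.-integrable `]0, +oo[ (fun lam : R => ((lam ^+ 2 + a ^+ 2)^-1)%:E).
Proof.
move=> a0; have [i _] := cauchy_scaled a0.
have := integrable_scale (2 * a)^-1 (measurable_itv _) i.
congr (mu.-integrable _ _); apply/funext => t; congr EFin.
have t0 : 0 < t ^+ 2 + a ^+ 2 by rewrite ltr_wpDl ?sqr_ge0 ?exprn_gt0.
by field; rewrite !gt_eqF.
Qed.

Lemma symbol_cos_transform_integrable a g c h : 0 < a -> g < 1 -> 0 < c -> decaying 5 c h ->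
  mu.-integrable `]0, +oo[ (fun lam => ((lam ^+ 2 + a ^+ 2) `^ g * cos_transform h lam)%:E).
Proof.
move=> a0 g1 c0 dh; have [C C0 HC] := cos_transform_decay2 a c0 dh.
have S0 lam : 0 < lam ^+ 2 + a ^+ 2 by rewrite ltr_wpDl ?sqr_ge0 ?exprn_gt0.
apply: (dominated_integrable (g := fun lam =>
  (C * (a ^+ 2) `^ (g - 1)) * (lam ^+ 2 + a ^+ 2)^-1)) => //.
- apply: measurable_funM; last exact: (measurable_cos_transform c0 (decaying_leq _ dh)).
  apply: continuous_measurable_oy => x _; have := S0 x => Sx.
  by eapply is_derive_continuous; derive_rule.
- move=> lam _; have Sl := S0 lam; move: (HC lam) Sl => {HC}.
  have : a ^+ 2 <= lam ^+ 2 + a ^+ 2 by rewrite lerDr sqr_ge0.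
  move: (lam ^+ 2 + a ^+ 2) => S aS HC Sl.
  rewrite normrM ger0_norm ?powR_ge0//.
  rewrite (_ : S `^ g = S `^ (g - 1) * S); last first.
    by rewrite -[in X in _ * X](powRr1 (ltW Sl)) -powR_add//; congr (_ `^ _); ring.
  have h1 : `|cos_transform h lam| <= C / S ^+ 2 by rewrite ler_pdivlMr ?exprn_gt0.
  have h2 : S `^ (g - 1) <= (a ^+ 2) `^ (g - 1).
    rewrite -[g - 1]opprB !(powRN _ (1 - g)) lef_pV2 ?posrE ?powR_gt0 ?exprn_gt0//.
    by apply: ge0_ler_powR; rewrite ?nnegrE ?subr_ge0// ?ltW// exprn_gt0.
  rewrite (_ : C * _ / S = (a ^+ 2) `^ (g - 1) * S * (C / S ^+ 2)); last by field; rewrite gt_eqF.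
  by apply: ler_pM => //; rewrite ?mulr_ge0 ?powR_ge0 ?(ltW Sl)// ler_wpM2r ?(ltW Sl).
- by apply: integrable_scale => //; exact: symbol_inv_integrable.
Qed.

Lemma stieltjes_integrand a g lam t : 0 < a -> 0 < t ->
  weight g t * (2 * (1 + t)) / ((lam ^+ 2 + a ^+ 2) / a ^+ 2 + t * (2 + t)) =
  a * (weight g t * (2 * (a * (1 + t)) / (lam ^+ 2 + (a * (1 + t)) ^+ 2))).
Proof.
move=> a0 t0.
have h1 : lam ^+ 2 + (a * (1 + t)) ^+ 2 != 0.
  by rewrite gt_eqF// ltr_wpDl ?sqr_ge0// exprn_gt0// mulr_gt0//; lra.
rewrite (_ : _ / a ^+ 2 + _ = (lam ^+ 2 + (a * (1 + t)) ^+ 2) / a ^+ 2); last first.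
  by field; rewrite gt_eqF.
by field; rewrite h1 gt_eqF.
Qed.

(** The integrand of the Stieltjes transform at x = (lam^2+a^2)/a^2, rewritten as a weight times the Cauchy kernel of parameter a(1+t). *)
Definition poisson_weight a g lam t : R :=
  weight g t * (2 * (a * (1 + t)) / (lam ^+ 2 + (a * (1 + t)) ^+ 2)).

Lemma poisson_weight_ge0 a g lam t : 0 < a -> 0 < t -> 0 <= poisson_weight a g lam t.
Proof.
move=> a0 t0; have k0 := ltW (mulr_gt0 a0 (addr_gt0 ltr01 t0)).
by rewrite mulr_ge0 ?weight_ge0// divr_ge0 ?addr_ge0 ?sqr_ge0// mulr_ge0.
Qed.

Lemma symbol_stieltjes a g : 0 < a -> -1 < g -> g < 0 -> exists2 K : R, 0 < K &
  forall lam, mu.-integrable `]0, +oo[ (EFin \o poisson_weight a g lam) /\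
    (lam ^+ 2 + a ^+ 2) `^ g = K * \int[mu]_(t in `]0, +oo[) poisson_weight a g lam t.
Proof.
move=> a0 g1 g0; have [B B0 HB] := stieltjes_transform g1 g0.
exists ((a ^+ 2) `^ g / B * a).
  by rewrite mulr_gt0// divr_gt0 ?powR_gt0 ?exprn_gt0.
move=> lam; have S0 : 0 < lam ^+ 2 + a ^+ 2 by rewrite ltr_wpDl ?sqr_ge0 ?exprn_gt0.
have x0 : 0 < (lam ^+ 2 + a ^+ 2) / a ^+ 2 by rewrite divr_gt0 ?exprn_gt0.
have qE (t : R) : `]0, +oo[%classic t -> weight g t * (2 * (1 + t)) /
   ((lam ^+ 2 + a ^+ 2) / a ^+ 2 + t * (2 + t)) = a * poisson_weight a g lam t.
  by rewrite /= in_itv/= andbT => t0; exact: stieltjes_integrand.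
have iq : mu.-integrable `]0, +oo[ (EFin \o poisson_weight a g lam).
  have := integrable_scale a^-1 (measurable_itv _) (stieltjes_integrable g1 g0 x0).
  apply: eq_integrable => // t /set_mem/qE e.
  by rewrite e mulrA mulVf ?gt_eqF// mul1r.
split=> //; rewrite -mulrA -RintegralZl//.
rewrite -(@eq_Rintegral _ _ _ mu _ _ _ (fun t => qE t \o set_mem)).
rewrite HB// powR_div ?exprn_gt0//; field.
by rewrite !gt_eqF ?powR_gt0 ?exprn_gt0.
Qed.

Lemma measurable_poisson_weight a g : 0 < a ->
  measurable_fun (`]0, +oo[ `*` `]0, +oo[ : set (T * T))
    (fun z : T * T => poisson_weight a g z.1 z.2).
Proof.
move=> a0; apply: measurable_funM.
  apply: (measurable_prod_snd (f := weight g)) => //.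
  apply: continuous_measurable_oy => t t0; have st0 : 0 < t * (2 + t).
    by rewrite mulr_gt0// addr_gt0.
  by rewrite /weight; eapply is_derive_continuous; derive_rule.
apply: measurable_funM.
  apply: (measurable_prod_snd (f := fun t => 2 * (a * (1 + t)))) => //.
  by apply: continuous_measurable_oy => t t0; eapply is_derive_continuous; derive_rule.
apply: (measurable_comp_pos (f := fun x : R => x^-1)).
- by move=> x x0; eapply is_derive_continuous; derive_rule; rewrite gt_eqF.
- move=> [l t]/= [_]; rewrite /= in_itv/= andbT => t0.
  by rewrite ltr_wpDl ?sqr_ge0 ?exprn_gt0// mulr_gt0// addr_gt0.
- apply: measurable_funTS; apply: measurable_funD.
    by apply: measurable_funX; exact: measurable_fst.
  apply: measurable_funX; apply: measurable_funM => //.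
  by apply: measurable_funD => //; exact: measurable_snd.
Qed.

Lemma norm_cos_transform_integrable a c h : 0 < a -> 0 < c -> decaying 3 c h ->
  mu.-integrable `]0, +oo[ (EFin \o (fun lam => `|cos_transform h lam|)).
Proof.
move=> a0 c0 dh; have [C C0 HC] := cos_transform_decay1 a c0 dh.
apply: (dominated_integrable (g := fun lam : R => C * (lam ^+ 2 + a ^+ 2)^-1)) => //.
- by apply: measurableT_comp => //; exact: measurable_cos_transform (decaying_leq _ dh).
- move=> lam _; rewrite normr_id ler_pdivlMr//.
  by rewrite ltr_wpDl ?sqr_ge0 ?exprn_gt0.
- by apply: integrable_scale => //; exact: symbol_inv_integrable.
Qed.

Lemma symbol_cos_transform_fubini a g K c h : 0 < a -> g < 0 -> 0 < K ->
  (forall lam, mu.-integrable `]0, +oo[ (EFin \o poisson_weight a g lam) /\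
    (lam ^+ 2 + a ^+ 2) `^ g = K * \int[mu]_(t in `]0, +oo[) poisson_weight a g lam t) ->
  0 < c -> decaying 3 c h ->
  \int[mu]_(lam in `]0, +oo[) ((lam ^+ 2 + a ^+ 2) `^ g * cos_transform h lam) =
  K * \int[mu]_(t in `]0, +oo[) \int[mu]_(lam in `]0, +oo[)
    (cos_transform h lam * poisson_weight a g lam t).
Proof.
move=> a0 g0 K0 HK c0 dh.
have mI : measurable (`]0, +oo[%classic : set T) by exact: measurable_itv.
have mf : measurable_fun (`]0, +oo[ `*` `]0, +oo[ : set (T * T))
    (fun z : T * T => cos_transform h z.1 * poisson_weight a g z.1 z.2).
  apply: measurable_funM; last exact: measurable_poisson_weight.
  by apply: measurable_prod_fst => //; exact: measurable_cos_transform (decaying_leq _ dh).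
have iG := integrable_scale ((a ^+ 2) `^ g / K) (measurable_itv _) (norm_cos_transform_integrable a0 c0 dh).
have ifE lam : `]0, +oo[%classic lam ->
  mu.-integrable `]0, +oo[ (EFin \o (fun t => cos_transform h lam * poisson_weight a g lam t)).
  by move=> _; apply: integrable_scale => //; exact: (HK lam).1.
have fG lam : `]0, +oo[%classic lam ->
   \int[mu]_(t in `]0, +oo[) `|cos_transform h lam * poisson_weight a g lam t|
   <= (a ^+ 2) `^ g / K * `|cos_transform h lam|.
  move=> _; rewrite (@eq_Rintegral _ _ _ mu _ (fun t => `|cos_transform h lam| * poisson_weight a g lam t)); last first.
    move=> t; rewrite inE/= in_itv/= andbT => t0.
    by rewrite normrM (ger0_norm (poisson_weight_ge0 _ _ a0 t0)).
  rewrite RintegralZl//; last exact: (HK lam).1.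
  rewrite mulrC ler_wpM2r// ler_pdivlMr// mulrC -(HK lam).2.
  rewrite -[g]opprK !(powRN _ (- g)) lef_pV2 ?posrE ?powR_gt0 ?exprn_gt0//; last first.
    by rewrite ltr_wpDl ?sqr_ge0 ?exprn_gt0.
  apply: ge0_ler_powR; rewrite ?nnegrE ?sqr_ge0 ?addr_ge0 ?sqr_ge0//; first by lra.
  by rewrite lerDr sqr_ge0.
have iR := integrable_Rintegral1 mI mI mf iG ifE fG.
rewrite -(RFubini mI mI mf iG ifE fG) -RintegralZl; [|exact: mI|exact: iR].
apply: eq_Rintegral => lam _; rewrite (HK lam).2 RintegralZl//; last exact: (HK lam).1.
by rewrite mulrAC mulrA.
Qed.

Lemma symbol_cos_transform_neg a g : 0 < a -> -1 < g -> g < 0 -> exists2 B : R, 0 < B &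
  forall c h, 0 < c -> decaying 3 c h ->
  \int[mu]_(lam in `]0, +oo[) ((lam ^+ 2 + a ^+ 2) `^ g * cos_transform h lam) =
  B * \int[mu]_(t in `]0, +oo[) (weight g t * laplace_transform h (a * (1 + t))).
Proof.
move=> a0 g1 g0; have [K K0 HK] := symbol_stieltjes a0 g1 g0.
exists (K * pi); first by rewrite mulr_gt0 ?pi_gt0.
move=> c h c0 dh; have dh1 := decaying_leq (isT : (1 <= 3)%N) dh.
rewrite (symbol_cos_transform_fubini a0 g0 K0 HK c0 dh) -[RHS]mulrA; congr (K * _).
rewrite -RintegralZl//; last exact: weight_laplace_transform_integrable a0 g1 c0 dh1.
apply: eq_Rintegral => t; rewrite inE/= in_itv/= andbT => t0.
have k0 := mulr_gt0 a0 (addr_gt0 ltr01 t0).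
rewrite mulrCA -(cos_transform_poisson c0 k0 dh1) -RintegralZl//; last first.
  exact: poisson_cos_transform_integrable dh1.
by apply: eq_Rintegral => lam _; rewrite mulrC mulrA.
Qed.

Definition laplace_weight a g h x t : R :=
  h x * (weight g t * (a * (1 + t)) ^+ 0 * expR (- (a * (1 + t) * x))).

Lemma weight_laplace_transform a g c h t : 0 < a -> 0 < c -> decaying 1 c h -> 0 < t ->
  weight g t * laplace_transform h (a * (1 + t)) =
  \int[mu]_(x in `]0, +oo[) laplace_weight a g h x t.
Proof.
move=> a0 c0 dh t0; have k0 := mulr_gt0 a0 (addr_gt0 ltr01 t0).
have ie := decaying_integrable (addr_gt0 k0 c0) (decaying_exp (a * (1 + t)) dh).
rewrite /laplace_transform -RintegralZl; [|exact: measurable_itv|exact: ie].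
by apply: eq_Rintegral => x _; rewrite /laplace_weight expr0; ring.
Qed.

Lemma measurable_laplace_weight a g c h : decaying 1 c h ->
  measurable_fun (`]0, +oo[ `*` `]0, +oo[ : set (T * T))
    (fun z : T * T => laplace_weight a g h z.1 z.2).
Proof.
move=> dh; apply: measurable_funM.
  by apply: measurable_prod_fst => //; exact: decaying_measurable dh.
apply: measurable_funM.
  apply: (measurable_prod_snd (f := fun t => weight g t * (a * (1 + t)) ^+ 0)) => //.
  apply: continuous_measurable_oy => t t0.
  have st0 : 0 < t * (2 + t) by rewrite mulr_gt0// addr_gt0.
  by rewrite /weight; eapply is_derive_continuous; derive_rule.
apply: measurable_funTS; apply: measurableT_comp => //.
apply: measurableT_comp => //; apply: measurable_funM; last exact: measurable_fst.
by apply: measurable_funM => //; apply: measurable_funD => //; exact: measurable_snd.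
Qed.

Lemma laplace_weight_integrable a g h x : 0 < a -> -1 < g -> 0 < x ->
  mu.-integrable `]0, +oo[ (EFin \o laplace_weight a g h x) /\
  \int[mu]_(t in `]0, +oo[) laplace_weight a g h x t = h x * profile a g 0 x.
Proof.
move=> a0 g1 x0; have ip := profile_integrable 0 a0 g1 x0; split.
  exact: integrable_scale.
by rewrite /laplace_weight RintegralZl; [|exact: measurable_itv|exact: ip].
Qed.

Lemma laplace_weight_bound a g c h : 0 < a -> -1 < g -> 0 < c -> decaying 1 c h ->
  exists C : R, forall x, 0 < x ->
  \int[mu]_(t in `]0, +oo[) `|laplace_weight a g h x t| <= C * `|h x|.
Proof.
move=> a0 g1 c0 dh; have [[d d0 hd] _] := dh.
exists (profile a g 0 d * expR (a * d)) => x x0.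
have ip := profile_integrable 0 a0 g1 x0.
rewrite (@eq_Rintegral _ _ _ mu _ (fun t => `|h x| *
  (weight g t * (a * (1 + t)) ^+ 0 * expR (- (a * (1 + t) * x))))); last first.
  move=> t _; rewrite /laplace_weight normrM [X in _ * X = _]ger0_norm//.
  by rewrite expr0 mulr1 mulr_ge0 ?weight_ge0 ?expR_ge0.
rewrite RintegralZl; [|exact: measurable_itv|exact: ip].
rewrite -/(profile a g 0 x).
have [xd|/ltW dx] := leP x d; first by rewrite hd// normr0 mul0r mulr0.
rewrite mulrC ler_wpM2r//; apply: (le_trans (ler_norm _)).
apply: (le_trans (profile_decay 0 a0 g1 d0 dx)).
rewrite ler_piMr ?mulr_ge0 ?expR_ge0//.
  apply: Rintegral_ge0 => // t _.
  by rewrite expr0 mulr1 mulr_ge0 ?weight_ge0 ?expR_ge0.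
by rewrite expR_le1 oppr_le0 mulr_ge0// ltW.
Qed.

Lemma laplace_transform_profile a g c h : 0 < a -> -1 < g -> 0 < c -> decaying 1 c h ->
  \int[mu]_(t in `]0, +oo[) (weight g t * laplace_transform h (a * (1 + t))) =
  \int[mu]_(x in `]0, +oo[) (h x * profile a g 0 x).
Proof.
move=> a0 g1 c0 dh.
have mI : measurable (`]0, +oo[%classic : set T) by exact: measurable_itv.
have [C HC] := laplace_weight_bound a0 g1 c0 dh.
have iG : mu.-integrable `]0, +oo[ (EFin \o (fun x => C * `|h x|)).
  apply: (integrable_scale C (measurable_itv _)).
  exact: (@integrable_norm _ T R mu _ _ (decaying_integrable c0 dh)).
have ifE x : `]0, +oo[%classic x -> mu.-integrable `]0, +oo[ (EFin \o laplace_weight a g h x).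
  by rewrite /= in_itv/= andbT => x0; exact: (laplace_weight_integrable h a0 g1 x0).1.
have fG x : `]0, +oo[%classic x ->
    \int[mu]_(t in `]0, +oo[) `|laplace_weight a g h x t| <= C * `|h x|.
  by rewrite /= in_itv/= andbT; exact: HC.
have := RFubini mI mI (measurable_laplace_weight a g dh) iG ifE fG => E.
transitivity (\int[mu]_(t in `]0, +oo[) \int[mu]_(x in `]0, +oo[) laplace_weight a g h x t).
  apply: eq_Rintegral => t; rewrite inE/= in_itv/= andbT => t0.
  exact: weight_laplace_transform c0 dh t0.
rewrite -E; apply: eq_Rintegral => x; rewrite inE/= in_itv/= andbT => x0.
exact: (laplace_weight_integrable h a0 g1 x0).2.
Qed.

(** For g > 0 the weight of exponent g - 1 meets the Laplace transform of a^2 h - h'' at a(1+t), which brings the factor a^2 - a^2(1+t)^2 = -a^2 t(2+t) and restores the exponent g. For g = 0 the Cauchy kernel of parameter a is the inverse of the symbol, and the factor a^2 - a^2 makes the integral vanish. *)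
Theorem cos_transform_symbol a g : 0 < a -> -1 < g -> g < 1 -> exists2 B : R, (g <> 0 -> B != 0) &
  forall c h, 0 < c -> decaying 5 c h ->
  \int[mu]_(lam in `]0, +oo[) ((lam ^+ 2 + a ^+ 2) `^ g * cos_transform h lam) =
  B * \int[mu]_(x in `]0, +oo[) (h x * profile a g 0 x).
Proof.
move=> a0 g1 g1'.
have S0 lam : 0 < lam ^+ 2 + a ^+ 2 by rewrite ltr_wpDl ?sqr_ge0 ?exprn_gt0.
have [g0|g0|g0] := ltgtP g 0.
- have [B B0 HB] := symbol_cos_transform_neg a0 g1 g0; exists B; first by rewrite gt_eqF.
  move=> c h c0 dh; rewrite (HB c h c0 (decaying_leq (isT : (3 <= 5)%N) dh)).
  by rewrite (laplace_transform_profile a0 g1 c0 (decaying_leq (isT : (1 <= 5)%N) dh)).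
- have g2 : -1 < g - 1 by lra. have g3 : g - 1 < 0 by lra.
  have [B B0 HB] := symbol_cos_transform_neg a0 g2 g3.
  exists (- (B * a ^+ 2)); first by rewrite oppr_eq0 mulf_neq0 ?gt_eqF ?exprn_gt0.
  move=> c h c0 dh; rewrite mulNr -mulrA -mulrN.
  have dh3 := decaying_leq (isT : (3 <= 5)%N) dh.
  rewrite -(laplace_transform_profile a0 g1 c0 (decaying_leq (isT : (1 <= 5)%N) dh)).
  transitivity (\int[mu]_(lam in `]0, +oo[)
      ((lam ^+ 2 + a ^+ 2) `^ (g - 1) * cos_transform (helmholtz a h) lam)).
    apply: eq_Rintegral => lam _; rewrite (cos_transform_helmholtz _ _ c0 dh3) mulrA.
    congr (_ * _); rewrite -[X in _ = _ * X](powRr1 (ltW (S0 lam))) -powR_add//.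
    by congr (_ `^ _); ring.
  rewrite (HB c _ c0 (helmholtz_decaying a dh)).
  have iw := weight_laplace_transform_integrable a0 g1 c0 (decaying_leq (isT : (1 <= 5)%N) dh).
  congr (B * _); rewrite -mulNr -RintegralZl; [|exact: measurable_itv|exact: iw].
  apply: eq_Rintegral => t; rewrite inE/= in_itv/= andbT => t0.
  have st0 : 0 < t * (2 + t) by rewrite mulr_gt0//; lra.
  rewrite (laplace_transform_helmholtz _ c0 _ dh3) ?mulr_gt0//; last by lra.
  rewrite (_ : weight g t = weight (g - 1) t * (t * (2 + t))); first by ring.
  rewrite /weight -[X in _ = _ * X](powRr1 (ltW st0)) -powR_add//.
  by congr (_ `^ _); ring.
- exists 0 => // c h c0 dh; rewrite mul0r g0.
  have dh3 := decaying_leq (isT : (3 <= 5)%N) dh.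
  have := cos_transform_poisson c0 a0 (decaying_leq (isT : (1 <= 3)%N) (helmholtz_decaying a dh)).
  rewrite (laplace_transform_helmholtz _ c0 a0 dh3) subrr mul0r mulr0.
  under eq_Rintegral => lam _.
    rewrite (cos_transform_helmholtz _ _ c0 dh3).
    rewrite (_ : _ * _ = (2 * a) * ((lam ^+ 2 + a ^+ 2) `^ 0 * cos_transform h lam)); last first.
      by rewrite powRr0; field; rewrite gt_eqF.
    over.
  have is0 := symbol_cos_transform_integrable a0 (@ltr01 R) c0 dh.
  rewrite RintegralZl; [|exact: measurable_itv|exact: is0].
  by move=> /eqP; rewrite mulf_eq0 mulf_eq0 pnatr_eq0 (gt_eqF a0)/= => /eqP.
Qed.

End fourier_identity.

(** * The adjoint of the radial derivative *)

Section transposition.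
Context {R : realType}.
Implicit Types (f h k phi psi : R -> R) (c d e x r : R).
Local Notation T := (measurableTypeR R).

Lemma exp_bounded_jet_derive N c f : jet exp_bounded 0 N.+1 c 0 f ->
  jet exp_bounded 0 N c 0 (derive1 f).
Proof. by move=> [_ _]; rewrite addr0; exact: exp_bounded_jet_irrel. Qed.

Definition adjoint k : R -> R := fun x => - derive1 (fun y => k y / sinh y) x.

Lemma decaying_div_sinh N c k : decaying N c k ->
  decaying N (c + 1) (fun y => k y / sinh y).
Proof.
move=> /(decaying_mul (exp_bounded_csch N 0)); rewrite addrC.
by apply: decaying_ext => x _; rewrite mulrC.
Qed.

Lemma decaying_adjoint N c k : decaying N.+1 c k -> decaying N (c + 1) (adjoint k).
Proof.
move=> /decaying_div_sinh/decaying_derive/(decaying_scale (-1)).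
by apply: decaying_ext => x _; rewrite mulN1r.
Qed.

Lemma decaying_iter_adjoint m N c k : decaying (N + m) c k ->
  decaying N (c + m%:R) (iter m adjoint k).
Proof.
elim: m N => [|m IH] N; first by rewrite addn0 addr0.
by rewrite addnS -addSn => /IH/decaying_adjoint; rewrite -addrA natr1.
Qed.

(** Only e + c > -1 is required: the division by sinh supplies one unit of decay, so that functions growing slowly are still admissible. *)
Lemma int_radial_deriv f k e c : jet exp_bounded 0 2 e 0 f -> decaying 2 c k ->
  0 < e + c + 1 ->
  \int[mu]_(x in `]0, +oo[) (radial_deriv f x * k x) =
  \int[mu]_(x in `]0, +oo[) (f x * adjoint k x).
Proof.
move=> jf dk e0; have dks := decaying_div_sinh dk.
have df x : 0 < x -> is_derive x 1 f (derive1 f x) by exact: jet_derive jf x.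
have jf' := exp_bounded_jet_derive jf.
have d1 : decaying 1 (e + (c + 1)) (fun x => derive1 f x * (k x / sinh x)).
  exact: decaying_mul jf' (decaying_leq _ dks).
have d2 : decaying 1 (e + (c + 1)) (fun x => f x * derive1 (fun y => k y / sinh y) x).
  exact: decaying_mul (jet_weaken jf) (decaying_derive dks).
have d3 : decaying 2 (e + (c + 1)) (fun x => f x * (k x / sinh x)) by exact: decaying_mul jf dks.
rewrite addrA in d1 d2 d3.
have i1 := decaying_integrable e0 d1; have i2 := decaying_integrable e0 d2.
have E : \int[mu]_(x in `]0, +oo[) (derive1 f x * (k x / sinh x)) +
   \int[mu]_(x in `]0, +oo[) (f x * derive1 (fun y => k y / sinh y) x) = 0.
  rewrite -RintegralD; [|exact: measurable_itv|exact: i1|exact: i2].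
  rewrite -[RHS](decaying_int_derive e0 d3).
  apply: eq_Rintegral => x; rewrite inE/= in_itv/= andbT => x0; symmetry.
  apply: is_derive_derive1; apply: dmul (df _ x0) _.
  exact: decaying_is_derive dks x0.
move/eqP: E; rewrite addr_eq0 => /eqP E.
transitivity (\int[mu]_(x in `]0, +oo[) (derive1 f x * (k x / sinh x))).
  by apply: eq_Rintegral => x _; rewrite /radial_deriv mulrAC mulrA.
rewrite E -mulN1r -RintegralZl; [|exact: measurable_itv|exact: i2].
by apply: eq_Rintegral => x _; rewrite /adjoint mulN1r mulrN.
Qed.

Lemma jet_bounded_iter_radial m N e f : jet exp_bounded 0 (N + m) e 0 f ->
  jet exp_bounded 0 N (e + m%:R) 0 (iter m (@radial_deriv R) f).
Proof.
move=> jf; have := jet_iter_radial_deriv exp_bounded_compat exp_bounded_mul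
  (fun N => exp_bounded_csch N 0) jf.
by rewrite add0r mulr1 => -[L [_]]; exact: exp_bounded_jet_irrel.
Qed.

Lemma int_iter_radial_deriv m f k e c : jet exp_bounded 0 (2 + m) e 0 f ->
  decaying (2 + m) c k -> 0 < e + c + 1 ->
  \int[mu]_(x in `]0, +oo[) (iter m (@radial_deriv R) f x * k x) =
  \int[mu]_(x in `]0, +oo[) (f x * iter m adjoint k x).
Proof.
elim: m c k => [//|m IH] c k jf dk e0.
have jm : jet exp_bounded 0 2 (e + m%:R) 0 (iter m (@radial_deriv R) f).
  by apply: jet_bounded_iter_radial; apply: jet_leq jf; rewrite !addnS.
have dk2 : decaying 2 c k by apply: decaying_leq dk; rewrite leq_addr.
have e1 : 0 < e + m%:R + c + 1 by have := ler0n R m; move: (m%:R) => z; lra.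
rewrite iterS (int_radial_deriv jm dk2 e1) iterSr.
apply: (IH (c + 1)).
- by apply: jet_leq jf; rewrite !addnS.
- by apply: decaying_adjoint; rewrite -addnS.
- by lra.
Qed.

Lemma iter_adjoint_supp m k b : (forall x : R, b < x -> k x = 0) ->
  forall x : R, b < x -> iter m adjoint k x = 0.
Proof.
move=> kb; elim: m => [//|m IH] x bx.
rewrite iterS /adjoint derive1E (@near_eq_derive _ _ _ _ (cst 0) x 1).
  by rewrite derive_cst oppr0.
near=> y; rewrite /= IH ?mul0r//; near: y; exact: lt_nbhsr.
Unshelve. all: by end_near. Qed.

Lemma test_function_decaying phi : test_function phi ->
  (forall N c, decaying N c phi) /\ exists2 b : R, 0 < b & forall x, b < x -> phi x = 0.
Proof.
move=> [dphi [a [b [a0 ab]]]].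
have phi_a x : x < a -> phi x = 0.
  by move=> xa; apply/eqP; apply: contraTT xa => /ab /andP[ax _]; rewrite -leNgt.
have phi_b x : b < x -> phi x = 0.
  by move=> bx; apply/eqP; apply: contraTT bx => /ab /andP[_ xb]; rewrite -leNgt.
have db m x : b < x -> derive1n m phi x = 0.
  elim: m x => [|m IH] x bx; first exact: phi_b.
  rewrite derive1nS derive1E (@near_eq_derive _ _ _ _ (cst 0) x 1).
    by rewrite derive_cst.
  by near=> y; rewrite IH//; near: y; exact: lt_nbhsr.
(* The upper end of the support may be negative when phi is 0. *)
pose B := Num.max b 1; have B0 : 0 < B by rewrite lt_max ltr01 orbT.
have bB : b <= B by rewrite le_max lexx.
have Q m c L : exp_bounded c L (derive1n m phi).
  move=> delta delta0.
  have cm x : {for x, continuous (fun x => `|derive1n m phi x|)}.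
    apply: continuous_comp; last exact: norm_continuous.
    exact: is_derive_continuous (derivable_is_derive (dphi m x)).
  have [z _ Hz] := @EVT_max R (fun x => `|derive1n m phi x|) 0 B (ltW B0)
    (continuous_subspaceT cm).
  exists (`|derive1n m phi z| * expR (`|c| * B)) => r dr.
  have r0 := lt_le_trans delta0 dr.
  have [rB|/ltW Br] := leP r B; last first.
    have [rb|br] := leP r b; last by rewrite db// normr0 !mulr_ge0 ?expR_ge0.
    have rB : r = B by apply/eqP; rewrite eq_le Br (le_trans rb bB).
    rewrite -mulrA -expRD; apply: le_trans (Hz r _) _.
      by rewrite in_itv/= (ltW r0) rB lexx.
    rewrite ler_peMr// -[leLHS]expR0 ler_expR rB -mulrBl mulr_ge0 ?(ltW B0)//.
    by rewrite subr_ge0 ler_norm.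
  rewrite -mulrA -expRD; apply: le_trans (Hz r _) _.
    by rewrite in_itv/= (ltW r0) rB.
  rewrite ler_peMr// -[leLHS]expR0 ler_expR subr_ge0.
  by apply: le_trans (ler_norm _) _; rewrite normrM (gtr0_norm r0) ler_wpM2l.
have J N m c L : jet exp_bounded 0 N c L (derive1n m phi).
  elim: N m c L => [|N IH] m c L; first exact: Q.
  apply: (jet_step exp_bounded_compat (f' := derive1n m.+1 phi)); first exact: Q.
    by move=> x _; rewrite derive1nS; apply: derivable_is_derive; exact: dphi.
  exact: IH.
split; last by exists B => // x Bx; apply: phi_b; exact: le_lt_trans Bx.
move=> N c; split; last exact: (J N 0%N).
exists (a / 2); first by rewrite divr_gt0.
by move=> x _ xa; apply: phi_a; lra.
Unshelve. all: by end_near. Qed.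

End transposition.

(** * The adjoint of the Abel transform *)

Section hyperbolic_difference.
Context {R : realType}.
Implicit Types (x t r b : R).

Lemma cosh_sub x t : cosh (x + t) - cosh x =
  (expR t - 1) * (expR x - expR (- (x + t))) / 2.
Proof.
rewrite /cosh opprD !expRD !expRN.
by field; rewrite !gt_eqF ?expR_gt0.
Qed.

Lemma cosh_lt x r : 0 <= x -> x < r -> cosh x < cosh r.
Proof.
move=> x0 xr; rewrite -subr_gt0 -{1}(subrKC x r) cosh_sub.
rewrite divr_gt0// mulr_gt0//; first by rewrite subr_gt0 expR_gt1 subr_gt0.
by rewrite subr_gt0 ltr_expR subrKC; lra.
Qed.

Lemma cosh_le x r : 0 <= x -> x <= r -> cosh x <= cosh r.
Proof. by move=> x0; rewrite le_eqVlt => /orP[/eqP->//|/(cosh_lt x0)/ltW]. Qed.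

Lemma cosh_sub_exp b : 0 < b -> exists2 k : R, 0 < k &
  forall r, b + 1 <= r -> k * expR r <= cosh r - cosh b.
Proof.
move=> b0; have e1 : expR (-1) < 1 :> R by rewrite expR_lt1; lra.
exists ((1 - expR (-1)) ^+ 2 / 2); first by rewrite divr_gt0// exprn_gt0// subr_gt0.
move=> r br; rewrite -(subrKC b r) cosh_sub; set t := r - b.
have t1 : 1 <= t by rewrite /t; lra.
have d0 : 0 <= 1 - expR (-1) :> R by lra.
have h1 : (1 - expR (-1)) * expR t <= expR t - 1.
  by rewrite mulrBl mul1r lerD2l lerN2 -expRD -[leLHS]expR0 ler_expR; lra.
have h2 : (1 - expR (-1)) * expR b <= expR b - expR (- (b + t)).
  by rewrite mulrBl mul1r lerD2l lerN2 -expRD ler_expR; lra.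
rewrite expRD mulrAC ler_pM2r ?invr_gt0//.
rewrite (_ : _ * _ = ((1 - expR (-1)) * expR t) * ((1 - expR (-1)) * expR b)); last by ring.
by apply: ler_pM => //; rewrite mulr_ge0// expR_ge0.
Qed.

End hyperbolic_difference.

Section sqrt_kernel.
Context {R : realType}.
Implicit Types (f h k phi psi : R -> R) (c d e x r b p : R).
Local Notation T := (measurableTypeR R).

(** The power 3/2 of the positive part: the square root vanishes for negative arguments. It is differentiable on the whole line, which is why integrals against it can be differentiated without following the moving end point of the support. *)
Definition pow32 (y : R) : R := y * Num.sqrt y.

Lemma is_derive_pow32 (y : R) : is_derive y 1 pow32 (3 / 2 * Num.sqrt y).
Proof.
have [y0|y0|y0] := ltgtP y 0.
- have h : is_derive y 1 (fun _ : R => 0 : R) 0 by exact: dcst.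
  rewrite ler0_sqrtr ?mulr0 ?(ltW y0)//.
  apply: (near_eq_is_derive _ h); near=> z.
  rewrite /pow32 ler0_sqrtr ?mulr0//; apply/ltW.
  by near: z; exact: lt_nbhsl.
- have s0 : Num.sqrt y != 0 by rewrite sqrtr_eq0 -ltNge.
  rewrite /pow32; eapply is_derive_eq; first by derive_rule.
  by rewrite -[X in _ + X * _](sqr_sqrtr (ltW y0)); field.
- rewrite y0 sqrtr0 mulr0.
  have h : (fun h : R => h^-1 *: (pow32 (h *: 1 + 0) - pow32 0)) @ 0^' --> (0 : R).
    have h1 : Num.sqrt z @[z --> (0 : R)^'] --> (0 : R).
      rewrite -[X in _ --> X]sqrtr0; apply: cvg_within_filter.
      exact: sqrt_continuous.
    apply: cvg_trans h1; apply: near_eq_cvg; near=> z.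
    rewrite /pow32 mul0r subr0 addr0 /GRing.scale/= mulr1 mulrA mulVf ?mul1r//.
    by near: z; exact: nbhs_dnbhs_neq.
  split; first exact: cvgP h.
  exact: cvg_lim h.
Unshelve. all: by end_near. Qed.

Lemma pow32_le (y M : R) : 0 <= M -> y <= M -> `|pow32 y| <= M * Num.sqrt M.
Proof.
move=> M0 yM; have [y0|/ltW y0] := leP y 0.
  by rewrite /pow32 ler0_sqrtr// mulr0 normr0 mulr_ge0 ?sqrtr_ge0.
by rewrite /pow32 ger0_norm ?mulr_ge0 ?sqrtr_ge0//; apply: ler_pM; rewrite ?sqrtr_ge0 ?ler_sqrt.
Qed.

(** Smoothness and compact support in the open half-line, expressed by conditions at positive arguments; this makes the class stable under the adjoint and under division by sinh. *)
Definition bump psi := (forall N c, decaying N c psi) /\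
  exists2 b : R, 0 < b & forall x : R, b < x -> psi x = 0.

Lemma bump_adjoint psi : bump psi -> bump (adjoint psi).
Proof.
move=> [dp [b b0 pb]]; split; last by exists b => // x bx; exact: (iter_adjoint_supp 1 pb).
by move=> N c; rewrite -(subrK 1 c); apply: decaying_adjoint.
Qed.

Lemma bump_iter_adjoint m psi : bump psi -> bump (iter m adjoint psi).
Proof. by elim: m => [//|m IH] /IH/bump_adjoint. Qed.

Lemma bump_div_sinh psi : bump psi -> bump (fun y => psi y / sinh y).
Proof.
move=> [dp [b b0 pb]]; split; last by exists b => // x bx; rewrite pb// mul0r.
by move=> N c; rewrite -(subrK 1 c); apply: decaying_div_sinh.
Qed.

Lemma bump_cvg0 psi (w : R -> R) : bump psi ->
  psi x * w x @[x --> 0^'+] --> (0 : R) /\ psi x * w x @[x --> +oo] --> (0 : R).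
Proof.
move=> [/(_ 0%N 0) [[d d0 hd] _] [b b0 hb]]; split.
  apply: (@cvg_trans _ ((cst 0 : R -> R) @ 0^'+)); last exact: cvg_cst.
  apply: near_eq_cvg; near=> x.
  have x0 : 0 < x by near: x; exact: nbhs_right_gt.
  by rewrite hd ?mul0r//; near: x; exact: nbhs_right_le.
apply: (@cvg_trans _ ((cst 0 : R -> R) @ +oo)); last exact: cvg_cst.
apply: near_eq_cvg; near=> x.
by rewrite hb ?mul0r//; near: x; apply: nbhs_pinfty_gt; exact: num_real.
Unshelve. all: by end_near. Qed.

Lemma bump_integrable psi : bump psi -> mu.-integrable `]0, +oo[ (EFin \o psi).
Proof. by move=> [dp _]; exact: decaying_integrable ltr01 (dp 1%N 1). Qed.

Lemma bump_kernel_integrable psi (w : R -> R) (M : R) : bump psi ->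
  (forall x : R, 0 < x -> {for x, continuous w}) -> (forall x : R, 0 < x -> `|w x| <= M) ->
  mu.-integrable `]0, +oo[ (fun x => (psi x * w x)%:E).
Proof.
move=> bp cw wM; have ip := bump_integrable bp.
apply: (dominated_integrable (g := fun x => M * `|psi x|)) => //.
- apply: measurable_funM; last exact: continuous_measurable_oy.
  by apply/measurable_EFinP; case/integrableP : ip.
- move=> x; rewrite /= in_itv/= andbT => x0.
  by rewrite normrM mulrC ler_wpM2r// wM.
- apply: integrable_scale => //; exact: (@integrable_norm _ T R mu _ _ ip).
Qed.

Lemma is_derive_pow32_cosh r x :
  is_derive x 1 (fun x => pow32 (cosh r - cosh x)) (- (3 / 2 * Num.sqrt (cosh r - cosh x) * sinh x)).
Proof.
have h : is_derive x 1 (fun x : R => cosh r - cosh x) (0 - sinh x).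
  by have hx := is_derive_cosh x; derive_rule.
apply: (is_derive_eq (dcomp (is_derive_pow32 _) h)).
by rewrite sub0r mulrN.
Qed.

Lemma is_derive_pow32_cosh_l r x :
  is_derive r 1 (fun r => pow32 (cosh r - cosh x)) (3 / 2 * Num.sqrt (cosh r - cosh x) * sinh r).
Proof.
have h : is_derive r 1 (fun r : R => cosh r - cosh x) (sinh r - 0).
  by have hx := is_derive_cosh r; derive_rule.
apply: (is_derive_eq (dcomp (is_derive_pow32 _) h)).
by rewrite subr0.
Qed.

Lemma continuous_sqrt_cosh r x : {for x, continuous (fun x : R => Num.sqrt (cosh r - cosh x))}.
Proof.
apply: continuous_comp; last exact: sqrt_continuous.
apply: (@is_derive_continuous _ (fun x : R => cosh r - cosh x) x (0 - sinh x)).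
by have hx := is_derive_cosh x; derive_rule.
Qed.

Lemma sqrt_cosh_le r x M : cosh r <= M -> `|Num.sqrt (cosh r - cosh x)| <= Num.sqrt M.
Proof.
move=> rM; rewrite ger0_norm ?sqrtr_ge0// ler_sqrt//; last first.
  by apply: le_trans rM; apply: le_trans (cosh_ge1 r); exact: ler01.
by apply: le_trans rM; have := cosh_ge1 x; lra.
Qed.

Definition int_pow32 psi r := \int[mu]_(x in `]0, +oo[) (psi x * pow32 (cosh r - cosh x)) : R.

Definition int_sqrt psi r := \int[mu]_(x in `]0, +oo[) (psi x * Num.sqrt (cosh r - cosh x)) : R.

(** The integral is over x < r only: beyond r the square root is 0, and so is its inverse. *)
Definition int_rsqrt psi r := \int[mu]_(x in `]0, +oo[) (psi x / Num.sqrt (cosh r - cosh x)) : R.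

Lemma int_pow32_integrable psi r : bump psi ->
  mu.-integrable `]0, +oo[ (fun x => (psi x * pow32 (cosh r - cosh x))%:E).
Proof.
move=> bp; apply: (bump_kernel_integrable bp (w := fun x => pow32 (cosh r - cosh x)) (M := cosh r * Num.sqrt (cosh r))).
- by move=> x _; exact: is_derive_continuous (is_derive_pow32_cosh r x).
- move=> x _; apply: pow32_le; first by apply: le_trans (cosh_ge1 r); exact: ler01.
  by have := cosh_ge1 x; lra.
Qed.

Lemma int_sqrt_integrable psi r : bump psi ->
  mu.-integrable `]0, +oo[ (fun x => (psi x * Num.sqrt (cosh r - cosh x))%:E).
Proof.
move=> bp; apply: (bump_kernel_integrable bp (w := fun x => Num.sqrt (cosh r - cosh x)) (M := Num.sqrt (cosh r))).
- by move=> x _; exact: continuous_sqrt_cosh.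
- by move=> x _; exact: sqrt_cosh_le.
Qed.

Lemma int_sqrt_pow32 psi r : bump psi ->
  int_sqrt psi r = - (2 / 3) * int_pow32 (adjoint psi) r.
Proof.
move=> bp; have bs := bump_div_sinh bp.
have i1 := int_sqrt_integrable r bp; have i2 := int_pow32_integrable r (bump_adjoint bp).
have e1 := integrable_scale (3 / 2) (measurable_itv _) i1.
have e2 := integrable_add (measurable_itv _) i2 e1.
suff : \int[mu]_(x in `]0, +oo[) (adjoint psi x * pow32 (cosh r - cosh x) +
   3 / 2 * (psi x * Num.sqrt (cosh r - cosh x))) = 0.
  rewrite RintegralD; [|exact: measurable_itv|exact: i2|exact: e1].
  rewrite RintegralZl; [|exact: measurable_itv|exact: i1].
  rewrite -/(int_sqrt psi r) -/(int_pow32 (adjoint psi) r).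
  by move: (int_sqrt _ _) (int_pow32 _ _) => u v; lra.
have [c0 cy] := bump_cvg0 (fun x => - pow32 (cosh r - cosh x)) bs.
rewrite -[RHS](subrr 0).
have ds x : 0 < x -> is_derive x 1 (fun y => psi y / sinh y) (- adjoint psi x).
  by move=> x0; rewrite /adjoint opprK; exact: decaying_is_derive (bs.1 1%N 0) x0.
apply: (@RFTC_oy _ _ (fun x => psi x / sinh x * - pow32 (cosh r - cosh x))) => //.
- move=> x x0.
  apply: (is_derive_eq (dmul (ds _ x0) (dopp (is_derive_pow32_cosh r x)))).
  by field; rewrite gt_eqF// sinh_gt0.
- move=> x x0; apply: cvgD; apply: cvgM.
  + exact: decaying_continuous ((bump_adjoint bp).1 1%N 0) x0.
  + exact: is_derive_continuous (is_derive_pow32_cosh r x).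
  + exact: cvg_cst.
  + apply: cvgM; first exact: decaying_continuous (bp.1 1%N 0) x0.
    exact: continuous_sqrt_cosh.
Qed.

(** Differentiation turns the power 3/2 into a square root times sinh r, and an integration by parts turns it back at the price of the adjoint of the radial derivative. *)
Lemma is_derive_int_pow32 psi r : bump psi -> 0 < r ->
  is_derive r 1 (int_pow32 psi) (- (sinh r * int_pow32 (adjoint psi) r)).
Proof.
move=> bp r0; have ip := bump_integrable bp.
have mp : measurable_fun `](0 : R), +oo[ psi by apply/measurable_EFinP; case/integrableP : ip.
pose M := expR (r * 2).
have h : is_derive r 1 (int_pow32 psi) (\int[mu]_(x in `]0, +oo[)
    (psi x * (3 / 2 * Num.sqrt (cosh r - cosh x) * sinh r))).
  apply: (is_derive_under_integral (u := r / 2) (v := r * 2)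
    (f := fun r x => psi x * pow32 (cosh r - cosh x))
    (f' := fun r x => psi x * (3 / 2 * Num.sqrt (cosh r - cosh x) * sinh r))
    (G := fun x => (3 / 2 * Num.sqrt M * M) * `|psi x|)).
  - exact: measurable_itv.
  - by apply/andP; split; lra.
  - by move=> s _; exact: int_pow32_integrable.
  - move=> s x _ _.
    apply: (is_derive_eq (dmul (dcst (psi x) s) (is_derive_pow32_cosh_l s x))).
    by rewrite mul0r add0r.
  - apply: integrable_scale; first exact: measurable_itv.
    exact: (@integrable_norm _ T R mu _ _ ip).
  - move=> s x /andP[s1 s2] _.
    have s0 : 0 <= s by lra.
    have [cs ss] := cosh_bounds s0.
    have sM : expR s <= M by rewrite ler_expR ltW.
    rewrite normrM mulrC ler_wpM2r// normrM; apply: ler_pM => //.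
      rewrite normrM (ger0_norm (_ : 0 <= 3 / 2 :> R)) ?ler_wpM2l//; try lra.
      apply: sqrt_cosh_le; apply: le_trans sM; apply: le_trans cs; exact: ler_norm.
    exact: le_trans sM.
apply: (is_derive_eq h).
rewrite (_ : - _ = (3 / 2 * sinh r) * int_sqrt psi r); last first.
  by rewrite (int_sqrt_pow32 r bp); field.
rewrite /int_sqrt -RintegralZl; [|exact: measurable_itv|exact: int_sqrt_integrable].
by apply: eq_Rintegral => x _; ring.
Qed.

Lemma Rintegral_vanish r f : 0 < r -> (forall x : R, r <= x -> f x = 0) ->
  \int[mu]_(x in `]0, +oo[) f x = \int[mu]_(x in `]0, r[) f x.
Proof.
move=> r0 fr; rewrite /Rintegral; congr fine.
rewrite [LHS]integral_mkcond [RHS]integral_mkcond; apply: eq_integral => x _.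
rewrite !patchE; case: ifPn => [/set_mem|/negP xI]; case: ifPn => [/set_mem|/negP xJ] //.
- move=> /= /[!in_itv]/= /andP[x0] _; rewrite fr// leNgt; apply/negP => xr.
  by apply: xJ; rewrite inE/= in_itv/= x0.
- by move=> xJ; exfalso; apply: xI; move: xJ; rewrite inE/= !in_itv/= andbT => /andP[].
Qed.

Lemma continuous_rsqrt_cosh r x : 0 < x < r ->
  {for x, continuous (fun x : R => (Num.sqrt (cosh r - cosh x))^-1)}.
Proof.
move=> /andP[x0 xr]; have nz : Num.sqrt (cosh r - cosh x) != 0.
  by rewrite gt_eqF// sqrtr_gt0 subr_gt0 cosh_lt// ltW.
by apply: cvgV => //; exact: continuous_sqrt_cosh.
Qed.

Lemma is_derive_sqrt_cosh r x : 0 < x < r ->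
  is_derive x 1 (fun x : R => Num.sqrt (cosh r - cosh x))
    (- (sinh x / (2 * Num.sqrt (cosh r - cosh x)))).
Proof.
move=> /andP[x0 xr]; have hx := is_derive_cosh x.
eapply is_derive_eq; first by derive_rule; rewrite subr_gt0 cosh_lt// ltW.
by rewrite sub0r mulNr.
Qed.

(** The function sinh x / sqrt(cosh r - cosh x) has the primitive -2 sqrt(cosh r - cosh x), and the remaining factor psi / sinh is bounded. *)
Lemma rsqrt_integrable psi r : bump psi -> 0 < r ->
  mu.-integrable `]0, r[ (fun x => (psi x / Num.sqrt (cosh r - cosh x))%:E).
Proof.
move=> bp r0; have bs := bump_div_sinh bp.
have i0 : mu.-integrable `]0, r[ (fun x => (sinh x * (Num.sqrt (cosh r - cosh x))^-1)%:E).
  apply: (@ge0_FTC_oo_integrable _ (fun x => sinh x * (Num.sqrt (cosh r - cosh x))^-1)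
    (fun x => - 2 * Num.sqrt (cosh r - cosh x)) 0
    (- 2 * Num.sqrt (cosh r - cosh 0)) (- 2 * Num.sqrt (cosh r - cosh r)) r r0).
  - move=> x xr; apply: (is_derive_eq (dmul (dcst (- 2) x) (is_derive_sqrt_cosh xr))).
    have /andP[x0 xr'] := xr.
    by field; rewrite gt_eqF// sqrtr_gt0 subr_gt0 cosh_lt// ltW.
  - move=> x xr; apply: cvgM; last exact: continuous_rsqrt_cosh.
    exact: continuous_sinh.
  - apply: cvgMr; apply: (cvg_right_for (f := fun x => Num.sqrt (cosh r - cosh x))).
    exact: continuous_sqrt_cosh.
  - apply: cvgMr; apply: cvg_at_left_filter; exact: continuous_sqrt_cosh.
  - move=> x /andP[x0 _]; rewrite mulr_ge0 ?invr_ge0 ?sqrtr_ge0//.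
    by apply: ltW; exact: sinh_gt0.
have m1 : measurable_fun `]0, r[ (fun x => psi x / sinh x).
  have := decaying_measurable (bs.1 1%N 0); apply: measurable_funS => //.
  by move=> x /=; rewrite !in_itv/= andbT => /andP[].
have [C C0 HC] := decaying_bound (bs.1 0%N 0).
have e : mu.-integrable `]0, r[
    (fun x => (psi x / sinh x * (sinh x * (Num.sqrt (cosh r - cosh x))^-1))%:E).
  apply: (dominated_integrable (g := fun x => C * (sinh x * (Num.sqrt (cosh r - cosh x))^-1))) => //.
  - by apply: measurable_funM => //; apply/measurable_EFinP; case/integrableP : i0.
  - move=> x; rewrite /= in_itv/= => /andP[x0 xr].
    have s0 := sinh_gt0 x0.
    rewrite normrM ler_pM//; first by have := HC _ x0; rewrite mul0r oppr0 expR0 mulr1.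
    by rewrite ger0_norm// mulr_ge0 ?invr_ge0 ?sqrtr_ge0// ltW.
  - exact: integrable_scale.
move: e; apply: eq_integrable => // x; rewrite inE/= in_itv/= => /andP[x0 xr].
by rewrite mulrA mulfVK// gt_eqF// sinh_gt0.
Qed.

Lemma int_rsqrt_sqrt psi r : bump psi -> 0 < r ->
  int_rsqrt psi r = - 2 * int_sqrt (adjoint psi) r.
Proof.
move=> bp r0; have bs := bump_div_sinh bp; have ba := bump_adjoint bp.
rewrite /int_rsqrt /int_sqrt !(@Rintegral_vanish r)//; last first.
- by move=> x rx; rewrite ler0_sqrtr ?invr0 ?mulr0// subr_le0 cosh_le// ltW.
- by move=> x rx; rewrite ler0_sqrtr ?mulr0// subr_le0 cosh_le// ltW.
have sr x : 0 < x < r -> 0 < cosh r - cosh x.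
  by case/andP=> x0 xr; rewrite subr_gt0 cosh_lt// ltW.
have ds x : 0 < x -> is_derive x 1 (fun y => psi y / sinh y) (- adjoint psi x).
  by move=> x0; rewrite /adjoint opprK; exact: decaying_is_derive (bs.1 1%N 0) x0.
have lim_r (w : R -> R) : {for r, continuous w} -> w x @[x --> r^'-] --> w r.
  exact: cvg_at_left_filter.
have i1 := rsqrt_integrable bp r0.
have i2 : mu.-integrable `]0, r[ (fun x => (adjoint psi x * Num.sqrt (cosh r - cosh x))%:E).
  apply: (integrableS _ _ _ (int_sqrt_integrable r ba)) => //.
  by move=> x /=; rewrite !in_itv/= andbT => /andP[].
have e1 := integrable_scale (1 / 2) (measurable_itv _) i1.
have e2 := integrable_add (measurable_itv _) i2 e1.
suff : \int[mu]_(x in `]0, r[) (adjoint psi x * Num.sqrt (cosh r - cosh x) +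
   1 / 2 * (psi x / Num.sqrt (cosh r - cosh x))) = 0.
  rewrite RintegralD; [|exact: measurable_itv|exact: i2|exact: e1].
  rewrite RintegralZl; [|exact: measurable_itv|exact: i1].
  by move: (\int[mu]_(x in _) _) (\int[mu]_(x in _) _) => u v; lra.
rewrite -[RHS](subrr 0).
apply: (@RFTC_oo _ _ (fun x => psi x / sinh x * - Num.sqrt (cosh r - cosh x)) _ _ _ _ r0 _ _ _ _ e2).
- move=> x xr; have /andP[x0 _] := xr.
  apply: (is_derive_eq (dmul (ds _ x0) (dopp (is_derive_sqrt_cosh xr)))).
  by field; rewrite !gt_eqF ?sinh_gt0// sqrtr_gt0; exact: sr.
- move=> x xr; have /andP[x0 _] := xr; apply: cvgD; apply: cvgM.
  + exact: decaying_continuous (ba.1 1%N 0) x0.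
  + exact: continuous_sqrt_cosh.
  + exact: cvg_cst.
  + apply: cvgM; last exact: continuous_rsqrt_cosh.
    exact: decaying_continuous (bp.1 1%N 0) x0.
- exact: (bump_cvg0 (fun x => - Num.sqrt (cosh r - cosh x)) bs).1.
- have h : {for r, continuous (fun x => psi x / sinh x * - Num.sqrt (cosh r - cosh x))}.
    apply: cvgM; first exact: decaying_continuous (bs.1 1%N 0) r0.
    by apply: cvgN; exact: continuous_sqrt_cosh.
  by have := lim_r _ h; rewrite subrr sqrtr0 oppr0 mulr0.
Qed.

(** Smoothness in r of the singular integral follows from this formula. *)
Lemma int_rsqrt_pow32 psi r : bump psi -> 0 < r ->
  int_rsqrt psi r = 4 / 3 * int_pow32 (iter 2 adjoint psi) r.
Proof.
move=> bp r0; rewrite int_rsqrt_sqrt// int_sqrt_pow32; last exact: bump_adjoint.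
by rewrite /=; field.
Qed.

End sqrt_kernel.

Section sqrt_kernel_decay.
Context {R : realType}.
Implicit Types (phi psi : R -> R) (c x r b p : R).
Local Notation T := (measurableTypeR R).

(** For r beyond the support of psi any exponent p is allowed, which makes it possible to integrate by parts down to negative exponents. *)
Definition int_pow p psi r := \int[mu]_(x in `]0, r[) (psi x * (cosh r - cosh x) `^ p) : R.

Let sub_oy r : `]0, r[%classic `<=` `](0 : R), +oo[%classic.
Proof. by move=> x /=; rewrite !in_itv/= andbT => /andP[]. Qed.

Let cosh_gt r x : 0 < x < r -> 0 < cosh r - cosh x.
Proof. by case/andP=> x0 xr; rewrite subr_gt0 cosh_lt// ltW. Qed.

Lemma is_derive_powR_cosh p r x : 0 < x < r ->
  is_derive x 1 (fun x => (cosh r - cosh x) `^ p)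
    (- (p * (cosh r - cosh x) `^ (p - 1) * sinh x)).
Proof.
move=> xr; have hx := is_derive_cosh x.
eapply is_derive_eq; first by derive_rule; exact: cosh_gt.
by rewrite sub0r mulrN.
Qed.

Lemma int_pow_integrable p psi r b : bump psi -> 0 < b -> (forall x, b < x -> psi x = 0) ->
  b < r -> mu.-integrable `]0, r[ (fun x => (psi x * (cosh r - cosh x) `^ p)%:E).
Proof.
move=> bp b0 pb br; have ip := bump_integrable bp.
have r0 := lt_trans b0 br.
have cb : 0 < cosh r - cosh b by apply: cosh_gt; rewrite b0.
pose M := (cosh r - cosh b) `^ p + cosh r `^ p.
have mI : measurable (`]0, r[%classic : set T) by exact: measurable_itv.
apply: (dominated_integrable (g := fun x => M * `|psi x|)) => //.
- apply: measurable_funM.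
    by apply: (measurable_funS _ (@sub_oy r)) => //; apply/measurable_EFinP; case/integrableP : ip.
  apply: (measurable_comp_pos (f := fun z : R => z `^ p)).
  + by move=> z z0; exact: powR_continuous.
  + by move=> z; rewrite /= in_itv/=; exact: cosh_gt.
  + apply: measurable_funTS; apply: measurable_funB => //.
    exact: continuous_measurable_fun continuous_cosh.
- move=> x; rewrite /= in_itv/= => /andP[x0 xr].
  have [bx|xb] := ltP b x; first by rewrite pb// mul0r normr0 mulr0.
  rewrite normrM mulrC ler_wpM2r// ger0_norm ?powR_ge0//.
  apply: powR_le_bracket => //; first by rewrite lerD2l lerN2 cosh_le// ltW.
  by rewrite gerBl; apply: le_trans (cosh_ge1 x); exact: ler01.
- apply: integrable_scale => //.
  have iN : mu.-integrable `]0, +oo[ (EFin \o (fun x => `|psi x|)).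
    exact: (@integrable_norm _ T R mu _ _ ip).
  by apply: (integrableS _ _ _ iN) => //; exact: sub_oy.
Qed.

Lemma int_pow_adjoint p psi r b : bump psi -> 0 < b -> (forall x, b < x -> psi x = 0) ->
  b < r -> int_pow p (adjoint psi) r = - p * int_pow (p - 1) psi r.
Proof.
move=> bp b0 pb br; have r0 := lt_trans b0 br.
have bs := bump_div_sinh bp; have ba := bump_adjoint bp.
have i1 := int_pow_integrable p ba b0 (iter_adjoint_supp 1 pb) br.
have i2 := int_pow_integrable (p - 1) bp b0 pb br.
have e2 := integrable_scale p (measurable_itv _) i2.
have e := integrable_add (measurable_itv _) i1 e2.
have ds x : 0 < x -> is_derive x 1 (fun y => psi y / sinh y) (- adjoint psi x).
  by move=> x0; rewrite /adjoint opprK; exact: decaying_is_derive (bs.1 1%N 0) x0.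
suff : \int[mu]_(x in `]0, r[) (adjoint psi x * (cosh r - cosh x) `^ p +
   p * (psi x * (cosh r - cosh x) `^ (p - 1))) = 0.
  rewrite RintegralD; [|exact: measurable_itv|exact: i1|exact: e2].
  rewrite RintegralZl; [|exact: measurable_itv|exact: i2].
  rewrite -/(int_pow _ _ _) -/(int_pow _ _ _) => /eqP; rewrite addr_eq0 => /eqP ->.
  by rewrite mulNr.
rewrite -[RHS](subrr 0).
apply: (@RFTC_oo _ _ (fun x => psi x / sinh x * - (cosh r - cosh x) `^ p) _ _ _ _ r0 _ _ _ _ e).
- move=> x xr; have /andP[x0 _] := xr.
  apply: (is_derive_eq (dmul (ds _ x0) (dopp (is_derive_powR_cosh p xr)))).
  by field; rewrite gt_eqF// sinh_gt0.
- move=> x xr; have /andP[x0 _] := xr; apply: cvgD; apply: cvgM.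
  + exact: decaying_continuous (ba.1 1%N 0) x0.
  + exact: is_derive_continuous (is_derive_powR_cosh p xr).
  + exact: cvg_cst.
  + apply: cvgM; first exact: decaying_continuous (bp.1 1%N 0) x0.
    exact: is_derive_continuous (is_derive_powR_cosh (p - 1) xr).
- exact: (bump_cvg0 (fun x => - (cosh r - cosh x) `^ p) bs).1.
- apply: (@cvg_trans _ ((cst 0 : R -> R) @ r^'-)); last exact: cvg_cst.
  apply: near_eq_cvg; near=> x.
  have bx : b < x by near: x; exact: nbhs_left_gt.
  by rewrite pb ?mul0r.
Unshelve. all: by end_near. Qed.

(** Each adjoint is traded for one power of cosh r - cosh x. This is the source of decay: the exponent 3/2 becomes 3/2 - j. *)
Lemma int_pow_iter_adjoint j p psi b : bump psi -> 0 < b ->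
  (forall x, b < x -> psi x = 0) -> exists C : R, forall r, b < r ->
  int_pow p (iter j adjoint psi) r = C * int_pow (p - j%:R) psi r.
Proof.
move=> bp b0 pb; elim: j p => [|j IH] p; first by exists 1 => r _; rewrite subr0 mul1r.
have [C HC] := IH (p - 1); exists (- p * C) => r br; rewrite iterS.
rewrite (int_pow_adjoint p (bump_iter_adjoint j bp) b0 (iter_adjoint_supp j pb) br).
by rewrite HC// mulrA -addrA -opprD -natr1 [1 + _]addrC.
Qed.

Lemma int_pow_le p psi r b : bump psi -> 0 < b -> (forall x, b < x -> psi x = 0) ->
  b < r -> p <= 0 -> `|int_pow p psi r| <=
  (\int[mu]_(x in `]0, +oo[) `|psi x|) * (cosh r - cosh b) `^ p.
Proof.
move=> bp b0 pb br p0; have ip := bump_integrable bp.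
have i := int_pow_integrable p bp b0 pb br.
have iN : mu.-integrable `]0, r[ (EFin \o (fun x => `|psi x|)).
  have iN : mu.-integrable `]0, +oo[ (EFin \o (fun x => `|psi x|)).
    exact: (@integrable_norm _ T R mu _ _ ip).
  by apply: (integrableS _ _ _ iN) => //; exact: sub_oy.
have cb : 0 < cosh r - cosh b by apply: cosh_gt; rewrite b0.
rewrite (@Rintegral_vanish _ r (fun x => `|psi x|)) ?(lt_trans b0 br)//; last first.
  by move=> x rx; rewrite pb ?normr0//; exact: lt_le_trans rx.
rewrite mulrC; apply: (le_trans (@le_normr_Rintegral _ T R mu _ _ (measurable_itv _) i)).
rewrite -RintegralZl; [|exact: measurable_itv|exact: iN].
apply: le_Rintegral.
- exact: measurable_itv.
- exact: (@integrable_norm _ T R mu _ _ i).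
- by apply: integrable_scale => //; exact: iN.
- move=> x; rewrite /= in_itv/= => /andP[x0 xr].
  have [bx|xb] := ltP b x; first by rewrite pb// mul0r normr0 mulr0.
  rewrite normrM mulrC ler_wpM2r// ger0_norm ?powR_ge0//.
  rewrite -[p]opprK !(powRN _ (- p)) lef_pV2 ?posrE ?powR_gt0//; last first.
    by apply: cosh_gt; rewrite x0.
  apply: ge0_ler_powR; rewrite ?nnegrE ?oppr_ge0// ?(ltW cb)//.
    by apply: ltW; apply: cosh_gt; rewrite x0.
  by rewrite lerD2l lerN2 cosh_le// ltW.
Qed.

Lemma int_pow32E psi r : bump psi -> 0 < r -> int_pow32 psi r = int_pow (3 / 2) psi r.
Proof.
move=> bp r0; rewrite /int_pow32 (@Rintegral_vanish _ r)//; last first.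
  by move=> x rx; rewrite /pow32 ler0_sqrtr ?mulr0// subr_le0 cosh_le// ltW.
apply: eq_Rintegral => x; rewrite inE/= in_itv/= => xr; congr (_ * _).
have c0 := cosh_gt xr; rewrite /pow32 -powR12_sqrt ?ltW//.
by rewrite -[X in X * _]powRr1 ?ltW// -powR_add//; congr (_ `^ _); field.
Qed.

Lemma int_pow32_le psi r M : bump psi -> cosh r <= M ->
  `|int_pow32 psi r| <= (\int[mu]_(x in `]0, +oo[) `|psi x|) * (M * Num.sqrt M).
Proof.
move=> bp rM; have ip := bump_integrable bp; have i := int_pow32_integrable r bp.
have iN : mu.-integrable `]0, +oo[ (EFin \o (fun x => `|psi x|)).
  exact: (@integrable_norm _ T R mu _ _ ip).
have M0 : 0 <= M by apply: le_trans rM; apply: le_trans (cosh_ge1 r); exact: ler01.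
rewrite mulrC; apply: (le_trans (@le_normr_Rintegral _ T R mu _ _ (measurable_itv _) i)).
rewrite -RintegralZl; [|exact: measurable_itv|exact: iN].
apply: le_Rintegral.
- exact: measurable_itv.
- exact: (@integrable_norm _ T R mu _ _ i).
- by apply: integrable_scale => //; exact: iN.
- move=> x _; rewrite normrM mulrC ler_wpM2r//; apply: pow32_le => //.
  by apply: le_trans rM; have := cosh_ge1 x; lra.
Qed.

(** Beyond the support, the exponent 3/2 - (j+2) = -(j+1/2) of cosh r - cosh b gives the rate; on the remaining bounded interval it suffices that the integral is bounded. *)
Lemma int_pow32_exp_bounded j phi L : bump phi ->
  exp_bounded (j%:R + 1 / 2) L (int_pow32 (iter j.+2 adjoint phi)).
Proof.
move=> bp; have [_ [b b0 pb]] := bp; have bj := bump_iter_adjoint j.+2 bp.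
set c := j%:R + 1 / 2; have c0 : 0 < c by rewrite /c ltr_wpDl.
have [C HC] := int_pow_iter_adjoint j.+2 (3 / 2) bp b0 pb.
have [k k0 Hk] := cosh_sub_exp b0.
set A := \int[mu]_(x in `]0, +oo[) `|phi x|.
have A0 : 0 <= A by apply: Rintegral_ge0.
have pE : 3 / 2 - j.+2%:R = - c :> R by rewrite /c -!natr1; field.
set M := expR (b + 1); set A' := \int[mu]_(x in `]0, +oo[) `|iter j.+2 adjoint phi x|.
have A'0 : 0 <= A' by apply: Rintegral_ge0.
have C10 : 0 <= A' * (M * Num.sqrt M) by rewrite !mulr_ge0 ?expR_ge0 ?sqrtr_ge0.
have C20 : 0 <= `|C| * (A * k `^ (- c)) by rewrite !mulr_ge0 ?powR_ge0.
move=> d d0; exists (A' * (M * Num.sqrt M) * expR (c * (b + 1)) + `|C| * (A * k `^ (- c))).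
move=> r dr; have r0 := lt_le_trans d0 dr; rewrite mulrDl.
have [br|/ltW rb] := leP (b + 1) r.
  have br' : b < r by apply: lt_le_trans br; rewrite ltrDl ltr01.
  apply: (@le_trans _ _ (`|C| * (A * k `^ (- c)) * expR (- (c * r)))); last first.
    by rewrite lerDr !mulr_ge0 ?expR_ge0 ?sqrtr_ge0.
  rewrite int_pow32E// HC// normrM -mulrA ler_wpM2l//.
  rewrite pE; have cN : - c <= 0 by rewrite oppr_le0 ltW.
  apply: (le_trans (int_pow_le bp b0 pb br' cN)); rewrite -mulrA ler_wpM2l//.
  have -> : expR (- (c * r)) = expR r `^ (- c) by rewrite -expRM mulrN mulrC.
  rewrite -powRM ?expR_ge0 ?(ltW k0)// !(powRN _ c) lef_pV2 ?posrE ?powR_gt0 ?mulr_gt0 ?expR_gt0//; last first.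
    by apply: cosh_gt; rewrite b0.
  apply: ge0_ler_powR; rewrite ?nnegrE ?(ltW c0) ?mulr_ge0 ?expR_ge0 ?(ltW k0)//.
    by apply: ltW; apply: cosh_gt; rewrite b0.
  exact: Hk.
apply: (@le_trans _ _ (A' * (M * Num.sqrt M) * expR (c * (b + 1)) * expR (- (c * r)))); last first.
  by rewrite lerDl mulr_ge0 ?expR_ge0.
rewrite -mulrA -expRD; have rM : cosh r <= M.
  have [h _] := cosh_bounds (ltW r0); apply: (le_trans (ler_norm _)); apply: (le_trans h).
  by rewrite ler_expR.
apply: (le_trans (int_pow32_le bj rM)); rewrite ler_peMr//.
by rewrite -[leLHS]expR0 ler_expR -mulrBr mulr_ge0 ?(ltW c0)// subr_ge0.
Qed.

(** The derivative is -sinh r times the same integral with one more adjoint; the growth of sinh is absorbed by the gain in decay. *)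
Lemma int_pow32_decaying N j phi : bump phi ->
  decaying N (j%:R + 1 / 2) (int_pow32 (iter j.+2 adjoint phi)).
Proof.
move=> bp; split.
  have [/(_ 0%N 0) [[d d0 hd] _] _] := bump_iter_adjoint j.+2 bp.
  exists d => // r r0 rd; rewrite /int_pow32 /Rintegral integral0_eq//.
  move=> x; rewrite /= in_itv/= andbT => x0; congr EFin.
  have [xd|/ltW dx] := leP x d; first by rewrite [X in X * _](hd _ x0 xd) mul0r.
  by rewrite /pow32 ler0_sqrtr ?mulr0// subr_le0 cosh_le// ?(ltW r0)// (le_trans rd).
elim: N j => [|N IH] j; first exact: int_pow32_exp_bounded.
apply: (jet_step exp_bounded_compat (int_pow32_exp_bounded j _ bp)
  (f' := fun r => - (sinh r * int_pow32 (iter j.+3 adjoint phi) r))).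
  by move=> r r0; apply: is_derive_int_pow32 => //; exact: bump_iter_adjoint.
rewrite addr0; apply: jet_opp; first exact: exp_bounded_compat.
apply: (@exp_bounded_jet_mul _ N (-1) (j.+1%:R + 1 / 2) _ _ (@sinh R)
  (int_pow32 (iter j.+3 adjoint phi)) _ (exp_bounded_cosh_sinh N 0).2 (IH j.+1)).
by rewrite -natr1; ring.
Qed.

Lemma int_rsqrt_decaying N phi : bump phi ->
  decaying N (1 / 2) (int_rsqrt phi).
Proof.
move=> bp; have := decaying_scale (4 / 3) (int_pow32_decaying N 0 bp).
rewrite add0r; apply: decaying_ext => r r0; symmetry; exact: int_rsqrt_pow32.
Qed.

Lemma sinh_int_rsqrt_decaying N phi : bump phi ->
  decaying N (- (1 / 2)) (fun r => sinh r * int_rsqrt phi r).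
Proof.
move=> /(int_rsqrt_decaying N)/(decaying_mul (exp_bounded_cosh_sinh N 0).2).
by congr decaying; field.
Qed.

End sqrt_kernel_decay.

(** * The Abel transform *)

Section abel_dominator.
Context {R : realType}.
Implicit Types (t x y d r : R).

(** The singularity of the Abel kernel in the variable t = r - x, up to exponential factors. *)
Definition abel_dom t : R := (Num.sqrt (expR t - 1))^-1.

(** A primitive is 2 atan(sqrt(exp(r-x)-1)). *)
Lemma abel_dom_integrable x : mu.-integrable `]x, +oo[ (fun r => (abel_dom (r - x))%:E) /\
  \int[mu]_(r in `]x, +oo[) abel_dom (r - x) = pi.
Proof.
have pos r : x < r -> 0 < expR (r - x) - 1 by move=> xr; rewrite subr_gt0 expR_gt1 subr_gt0.
pose F r : R := 2 * atan (Num.sqrt (expR (r - x) - 1)).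
have dF r : x < r -> is_derive r 1 F (abel_dom (r - x)).
  move=> xr; have p := pos _ xr; have sp : 0 < Num.sqrt (expR (r - x) - 1) by rewrite sqrtr_gt0.
  have h : is_derive r 1 (fun r => Num.sqrt (expR (r - x) - 1))
      (expR (r - x) / (2 * Num.sqrt (expR (r - x) - 1))).
    eapply is_derive_eq; first by derive_rule.
    by rewrite !addr0 mulr1.
  have ha := @dcomp R (@atan R) (fun r => Num.sqrt (expR (r - x) - 1)) r _ _ (is_derive1_atan _) h.
  apply: (is_derive_eq (dmul (dcst 2 r) ha)).
  rewrite mul0r add0r sqr_sqrtr ?(ltW p)// subrKC /abel_dom.
  by field; rewrite !gt_eqF ?expR_gt0.
have cf r : x < r -> {for r, continuous (fun r => abel_dom (r - x))}.
  move=> xr; have p := pos _ xr; have sp : 0 < Num.sqrt (expR (r - x) - 1) by rewrite sqrtr_gt0.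
  by rewrite /abel_dom; eapply is_derive_continuous; derive_rule; rewrite ?gt_eqF.
have Fx : F r @[r --> x^'+] --> (0 : R).
  rewrite -[X in _ --> X](mulr0 2) -atan0; apply: cvgMr.
  have c0 : {for x, continuous (fun r => atan (Num.sqrt (expR (r - x) - 1)))}.
    apply: continuous_comp; last exact: is_derive_continuous (is_derive1_atan _).
    apply: continuous_comp; last exact: sqrt_continuous.
    by eapply is_derive_continuous; derive_rule.
  have := cvg_right_for c0; by rewrite subrr expR0 subrr sqrtr0.
have Fy : F r @[r --> +oo] --> (pi : R).
  rewrite -[X in _ --> X](_ : 2 * (pi / 2) = pi); last by field.
  apply: cvgMr; apply: (cvg_comp (fun r => Num.sqrt (expR (r - x) - 1)) (@atan R)); last exact: cvgy_atan.
  apply/cvgryPge => A; near=> r.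
  have Ar : x + A ^+ 2 <= r by near: r; apply: nbhs_pinfty_ge; exact: num_real.
  apply: (@le_trans _ _ `|A|); first exact: ler_norm.
  rewrite -sqrtr_sqr; apply: ler_wsqrtr; rewrite lerBrDl.
  by apply: le_trans (expR_ge1Dx _); rewrite lerD2l; lra.
have f0 r : x < r -> 0 <= abel_dom (r - x) by rewrite invr_ge0 sqrtr_ge0.
split; first exact: ge0_FTC_oy_integrable dF cf Fx Fy f0.
by rewrite /Rintegral (ge0_FTC_oy dF cf Fx Fy f0) subr0.
Unshelve. all: by end_near. Qed.

Definition abel_kernel x r : R := sinh r / Num.sqrt (cosh r - cosh x).

Lemma continuous_abel_kernel x r : 0 < x -> x < r -> {for r, continuous (abel_kernel x)}.
Proof.
move=> x0 xr; have p : 0 < cosh r - cosh x by rewrite subr_gt0 cosh_lt// ltW.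
have hs := is_derive_sinh r; have hc := is_derive_cosh r.
rewrite /abel_kernel; eapply is_derive_continuous; derive_rule => //.
by rewrite gt_eqF// sqrtr_gt0.
Qed.

Lemma continuous_abel_kernel_shift x t : 0 < x -> 0 < t ->
  {for x, continuous (fun x => abel_kernel x (x + t))}.
Proof.
move=> x0 t0; have p : 0 < cosh (x + t) - cosh x by rewrite subr_gt0 cosh_lt ?ltrDl// ltW.
have hc := is_derive_cosh x.
have ht : is_derive x 1 (fun x : R => x + t) (1 + 0) by derive_rule.
have hst := @dcomp R (@sinh R) (fun x => x + t) x _ _ (is_derive_sinh _) ht.
have hct := @dcomp R (@cosh R) (fun x => x + t) x _ _ (is_derive_cosh _) ht.
rewrite /abel_kernel; eapply is_derive_continuous; derive_rule => //.
by rewrite gt_eqF// sqrtr_gt0.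
Qed.

Lemma abel_kernel_ge0 x r : 0 < r -> 0 <= abel_kernel x r.
Proof. by move=> r0; rewrite divr_ge0 ?sqrtr_ge0// ltW// sinh_gt0. Qed.

Lemma abel_kernel_eq0 x r : 0 <= r -> r <= x -> abel_kernel x r = 0.
Proof. by move=> r0 rx; rewrite /abel_kernel ler0_sqrtr ?invr0 ?mulr0// subr_le0 cosh_le. Qed.

(** Use cosh(x+t) - cosh x = (exp(t)-1)(exp(x)-exp(-x-t))/2 and bound the second factor below by a multiple of exp(x), for x >= d. *)
Lemma abel_kernel_le d : 0 < d -> exists2 K : R, 0 < K & forall x t, d <= x -> 0 < t ->
  abel_kernel x (x + t) <= K * (expR (x / 2 + t) * abel_dom t).
Proof.
move=> d0; set k := (1 - expR (- (2 * d))) / 2.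
have k0 : 0 < k by rewrite divr_gt0// subr_gt0 expR_lt1; lra.
exists (Num.sqrt k)^-1; first by rewrite invr_gt0 sqrtr_gt0.
move=> x t dx t0; have x0 : 0 < x by exact: lt_le_trans dx.
have xt0 : 0 < x + t by exact: addr_gt0.
have et : 0 < expR t - 1 by rewrite subr_gt0 expR_gt1.
have h1 : sinh (x + t) <= expR (x + t).
  by have [_ h] := cosh_bounds (ltW xt0); exact: le_trans (ler_norm _) h.
have h2 : k * expR x * (expR t - 1) <= cosh (x + t) - cosh x.
  have h3 : k * expR x <= (expR x - expR (- (x + t))) / 2.
    rewrite /k mulrAC mulrBl mul1r -expRD ler_pM2r ?invr_gt0// lerD2l lerN2 ler_expR; lra.
  by rewrite cosh_sub -[leRHS]mulrA [leRHS]mulrC ler_pM2r.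
clearbody k; rewrite /abel_kernel; apply: (@le_trans _ _ (expR (x + t) / Num.sqrt (k * expR x * (expR t - 1)))).
  apply: ler_pM => //; first by apply: ltW; exact: sinh_gt0.
  rewrite lef_pV2 ?posrE ?sqrtr_gt0 ?mulr_gt0 ?expR_gt0//; last first.
    by rewrite subr_gt0 cosh_lt ?ltrDl// ltW.
  exact: ler_wsqrtr.
rewrite !sqrtrM ?mulr_ge0 ?expR_ge0 ?(ltW k0)// /abel_dom.
have e2 : expR x = expR (x / 2) ^+ 2 :> R by rewrite expr2 -expRD; congr expR; field.
rewrite e2 sqrtr_sqr ger0_norm ?expR_ge0//.
rewrite (_ : expR (x + t) = expR (x / 2 + t) * expR (x / 2)); last first.
  by rewrite -expRD; congr expR; field.
rewrite le_eqVlt; apply/orP; left; apply/eqP; field.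
by rewrite !gt_eqF ?expR_gt0 ?sqrtr_gt0.
Qed.

Lemma Rintegral_oy_vanish x (f : R -> R) : 0 <= x -> (forall r, 0 < r -> r <= x -> f r = 0) ->
  (mu.-integrable `]x, +oo[ (EFin \o f) -> mu.-integrable `]0, +oo[ (EFin \o f)) /\
  \int[mu]_(r in `]0, +oo[) f r = \int[mu]_(r in `]x, +oo[) f r.
Proof.
move=> x0 fx.
have E : (EFin \o f) \_ (`]0, +oo[%classic : set R) = (EFin \o f) \_ (`]x, +oo[%classic : set R).
  apply/funext => r; rewrite !patchE; case: ifPn => [/set_mem|/negP rI];
    case: ifPn => [/set_mem|/negP rJ] //.
  - move=> /= /[!in_itv]/= /[!andbT] r0; rewrite fx// leNgt; apply/negP => xr.
    by apply: rJ; rewrite inE/= in_itv/= xr.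
  - move=> rJ; exfalso; apply: rI; move: rJ; rewrite inE/= !in_itv/= !andbT.
    exact: le_lt_trans.
split; last by rewrite /Rintegral integral_mkcond E -integral_mkcond.
have mI (i : interval R) : measurable ([set` i] : set (measurableTypeR R)) by exact: measurable_itv.
by move=> h; apply/(integrable_mkcond _ (mI _)); rewrite E; apply/(integrable_mkcond _ (mI _)).
Qed.

End abel_dominator.

Section abel_transform.
Context {R : realType}.
Local Notation T := (measurableTypeR R).
Variables (F : R -> R) (c : R).
Hypothesis c1 : 1 <= c.
Hypothesis jF : jet exp_bounded 0 1 c 0 F.
Implicit Types (x r t d : R) (phi : R -> R).

Let cF r : 0 < r -> {for r, continuous F}.
Proof. by move=> r0; exact: is_derive_continuous (jet_derive jF r0). Qed.

Let cK x r : 0 < x -> x < r -> {for r, continuous (fun r => abel_kernel x r * F r)}.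
Proof.
move=> x0 xr; apply: cvgM; first exact: continuous_abel_kernel.
by apply: cF; exact: lt_trans xr.
Qed.

Let mK x : 0 < x -> measurable_fun `]x, +oo[ (fun r => abel_kernel x r * F r).
Proof. by move=> x0; apply: continuous_measurable_oy => r; exact: cK. Qed.

(** The growth exp(x/2+t) of the kernel is compensated as soon as F decays like exp(-r). *)
Lemma abel_integrand_le d : 0 < d -> exists2 M : R, 0 <= M & forall x t, d <= x -> 0 < t ->
  `|abel_kernel x (x + t) * F (x + t)| <= M * abel_dom t.
Proof.
move=> d0; have [K K0 HK] := abel_kernel_le d0.
have [C HC] := (jet0 jF : exp_bounded c 0 F) d d0; exists (K * `|C|); first by rewrite mulr_ge0// ltW.
move=> x t dx t0; have x0 : 0 < x by exact: lt_le_trans dx.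
have xt : d <= x + t by apply: (le_trans dx); rewrite lerDl ltW.
have hF : `|F (x + t)| <= `|C| * expR (- (c * (x + t))).
  by apply: (le_trans (HC _ xt)); rewrite ler_wpM2r ?expR_ge0// ler_norm.
rewrite normrM ger0_norm ?abel_kernel_ge0 ?addr_gt0//.
have aD : 0 <= abel_dom t by rewrite invr_ge0 sqrtr_ge0.
apply: (@le_trans _ _ (K * (expR (x / 2 + t) * abel_dom t) * (`|C| * expR (- (c * (x + t)))))).
  by apply: ler_pM => //; [exact: abel_kernel_ge0 (addr_gt0 x0 t0)|exact: HK].
rewrite (_ : _ * _ * _ = K * `|C| * abel_dom t * expR (x / 2 + t - c * (x + t))); last first.
  by rewrite [expR (x / 2 + t - _)]expRD; ring.
rewrite ler_piMr ?mulr_ge0 ?(ltW K0)//.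
rewrite expR_le1; have : 0 <= (c - 1) * (x + t) by rewrite mulr_ge0 ?subr_ge0// ltW// addr_gt0.
by lra.
Qed.

Lemma abel_integrand_integrable d : 0 < d -> exists2 M : R, 0 <= M & forall x, d <= x ->
  mu.-integrable `]x, +oo[ (fun r => (abel_kernel x r * F r)%:E) /\
  \int[mu]_(r in `]x, +oo[) `|abel_kernel x r * F r| <= M.
Proof.
move=> d0; have [M M0 HM] := abel_integrand_le d0.
exists (M * pi); first by rewrite mulr_ge0// ltW// pi_gt0.
move=> x dx; have x0 : 0 < x by exact: lt_le_trans dx.
have [i0 e0] := abel_dom_integrable x.
have iM := integrable_scale M (measurable_itv _) i0.
have le r : `]x, +oo[%classic r -> `|abel_kernel x r * F r| <= M * abel_dom (r - x).
  rewrite /= in_itv/= andbT => xr; rewrite -{1 2}(subrKC x r).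
  by apply: HM => //; rewrite subr_gt0.
have i : mu.-integrable `]x, +oo[ (fun r => (abel_kernel x r * F r)%:E).
  by apply: (dominated_integrable (g := fun r => M * abel_dom (r - x))) => //; exact: mK.
split=> //; rewrite -e0 -RintegralZl; [|exact: measurable_itv|exact: i0].
apply: le_Rintegral => //.
exact: (@integrable_norm _ T R mu _ _ i).
Qed.

Lemma abel_integral_shift x : 0 < x -> abel_integral F x =
  \int[mu]_(t in `]0, +oo[) (abel_kernel x (x + t) * F (x + t)).
Proof.
move=> x0; rewrite /abel_integral (Rintegral_affine ltr01 (mK x0)) mul1r.
by apply: eq_Rintegral => t _; rewrite mul1r.
Qed.

Lemma measurable_abel_shift x : 0 < x ->
  measurable_fun `](0 : R), +oo[ (fun t => abel_kernel x (x + t) * F (x + t)).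
Proof.
move=> x0; have := measurable_affine ltr01 (mK x0).
by congr measurable_fun; apply/funext => t; rewrite mul1r.
Qed.

Lemma continuous_abel_integral x : 0 < x -> {for x, continuous (abel_integral F)}.
Proof.
move=> x0; have x20 : 0 < x / 2 by rewrite divr_gt0.
have [M M0 HM] := abel_integrand_le x20.
have [i0 _] := abel_dom_integrable (0 : R).
have iM : mu.-integrable `]0, +oo[ (fun t => (M * abel_dom t)%:E).
  have := integrable_scale M (measurable_itv _) i0; congr (mu.-integrable _ _).
  by apply/funext => t; rewrite subr0.
change (abel_integral F y @[y --> x] --> abel_integral F x); rewrite [X in _ --> X](abel_integral_shift x0).
have near0 : \forall y \near x, 0 < y by exact: lt_nbhsr.
apply: (@cvg_trans _ ((fun y : R => \int[mu]_(t in `]0, +oo[) (abel_kernel y (y + t) * F (y + t))) @ x)).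
  apply: near_eq_cvg; near=> y; symmetry; apply: abel_integral_shift.
  by near: y; exact: lt_nbhsr.
apply: (@dominated_cvg_filter _ T R mu _ (measurable_itv _) (nbhs x)
   (fun y t => abel_kernel y (y + t) * F (y + t)) _ (fun t => M * abel_dom t)).
- exact: sequential_nbhs.
- near=> y; apply: measurable_abel_shift; by near: y; exact: lt_nbhsr.
- move=> t; rewrite /= in_itv/= andbT => t0.
  have h1 := continuous_abel_kernel_shift x0 t0.
  have h2 : {for x, continuous (fun y => F (y + t))}.
    apply: continuous_comp; last by apply: cF; exact: addr_gt0.
    by eapply is_derive_continuous; derive_rule.
  exact: cvgM h1 h2.
- exact: iM.
- near=> y => t; rewrite /= in_itv/= andbT => t0; apply: HM => //.
  by apply: ltW; near: y; apply: lt_nbhsr; lra.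
Unshelve. all: by end_near. Qed.

(** The inverse is written as a power, because it is discontinuous at 0 where its value is 0. *)
Lemma measurable_rsqrt : measurable_fun setT (fun y : T => (Num.sqrt y)^-1 : T).
Proof.
have -> : (fun y : R => (Num.sqrt y)^-1) = (fun y => Num.sqrt y `^ (-1)).
  apply/funext => y; have := sqrtr_ge0 y; rewrite le_eqVlt => /orP[/eqP <-|s0].
    by rewrite invr0 powR0// oppr_eq0 oner_neq0.
  by rewrite powRN powRr1// ltW.
have mp := @measurable_powR R (-1).
apply: (measurableT_comp (f := fun z : T => z `^ (-1)) mp).
exact: continuous_measurable_fun (@sqrt_continuous R).
Qed.

Lemma measurable_abel_kernel :
  measurable_fun setT (fun z : T * T => abel_kernel z.1 z.2).
Proof.
have mc : measurable_fun setT (@cosh R : T -> T).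
  exact: continuous_measurable_fun continuous_cosh.
have ms : measurable_fun setT (@sinh R : T -> T).
  exact: continuous_measurable_fun continuous_sinh.
apply: measurable_funM; first by apply: (measurableT_comp ms); exact: measurable_snd.
apply: (measurableT_comp measurable_rsqrt); apply: measurable_funB.
  by apply: (measurableT_comp mc); exact: measurable_snd.
by apply: (measurableT_comp mc); exact: measurable_fst.
Qed.

(** Fubini. The kernel vanishes for r <= x, so both variables range over the half-line. *)
Lemma abel_transposition phi : bump phi ->
  \int[mu]_(x in `]0, +oo[) (abel_integral F x * phi x) =
  \int[mu]_(r in `]0, +oo[) (F r * (sinh r * int_rsqrt phi r)).
Proof.
move=> bp; have ip := bump_integrable bp.
have [/(_ 0%N 0) [[d d0 hd] _] _] := bp.
have [M M0 HM] := abel_integrand_integrable d0.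
have mI : measurable (`]0, +oo[%classic : set T) by exact: measurable_itv.
pose f x r := phi x * (abel_kernel x r * F r).
have vx x : 0 < x -> forall r : R, 0 < r -> r <= x -> abel_kernel x r * F r = 0.
  by move=> x0 r r0 rx; rewrite abel_kernel_eq0 ?mul0r// ltW.
have iG : mu.-integrable `]0, +oo[ (EFin \o (fun x => M * `|phi x|)).
  apply: (integrable_scale M (measurable_itv _)).
  exact: (@integrable_norm _ T R mu _ _ ip).
have ifE x : `]0, +oo[%classic x -> mu.-integrable `]0, +oo[ (EFin \o f x).
  rewrite /= in_itv/= andbT => x0.
  apply: (integrable_scale (phi x) (measurable_itv _)).
  apply: (Rintegral_oy_vanish (ltW x0) (vx _ x0)).1.
  have [N _ HN] := abel_integrand_integrable x0.
  exact: (HN x (lexx x)).1.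
have fG x : `]0, +oo[%classic x -> \int[mu]_(r in `]0, +oo[) `|f x r| <= M * `|phi x|.
  rewrite /= in_itv/= andbT => x0.
  have [xd|/ltW dx] := leP x d.
    rewrite hd// normr0 mulr0 /Rintegral integral0_eq//.
    by move=> r _; rewrite /f hd// mul0r normr0.
  have [i le] := HM x dx.
  have iN : mu.-integrable `]x, +oo[ (EFin \o (fun r => `|abel_kernel x r * F r|)).
    exact: (@integrable_norm _ T R mu _ _ i).
  rewrite (Rintegral_oy_vanish (f := fun r => `|f x r|) (ltW x0) _).2; last first.
    by move=> r r0 rx; rewrite /f (vx _ x0)// mulr0 normr0.
  rewrite (@eq_Rintegral _ _ _ mu _ (fun r => `|phi x| * `|abel_kernel x r * F r|)); last first.
    by move=> r _; rewrite /f normrM.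
  rewrite RintegralZl; [|exact: measurable_itv|exact: iN].
  by rewrite mulrC ler_wpM2r.
have mf : measurable_fun (`]0, +oo[ `*` `]0, +oo[ : set (T * T)) (fun z : T * T => f z.1 z.2).
  apply: measurable_funM.
    apply: (measurable_prod_fst (f := phi)) => //.
    by apply/measurable_EFinP; case/integrableP : ip.
  apply: measurable_funM; first exact: measurable_funTS measurable_abel_kernel.
  apply: (measurable_prod_snd (f := F)) => //.
  exact: continuous_measurable_oy.
transitivity (\int[mu]_(x in `]0, +oo[) \int[mu]_(r in `]0, +oo[) f x r).
  apply: eq_Rintegral => x; rewrite inE/= in_itv/= andbT => x0.
  have [N _ HN] := abel_integrand_integrable x0; have [i _] := HN x (lexx x).
  rewrite RintegralZl; [|exact: measurable_itv|]; last first.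
    exact: (Rintegral_oy_vanish (ltW x0) (vx _ x0)).1.
  by rewrite (Rintegral_oy_vanish (ltW x0) (vx _ x0)).2 mulrC.
rewrite (RFubini mI mI mf iG ifE fG).
apply: eq_Rintegral => r; rewrite inE/= in_itv/= andbT => r0.
have van x : r <= x -> phi x / Num.sqrt (cosh r - cosh x) = 0.
  by move=> rx; rewrite ler0_sqrtr ?invr0 ?mulr0// subr_le0 cosh_le// ltW.
rewrite /int_rsqrt mulrA (Rintegral_vanish r0 van).
rewrite -RintegralZl; [|exact: measurable_itv|exact: rsqrt_integrable].
rewrite (Rintegral_vanish (f := fun x => f x r) r0); last first.
  by move=> x rx; rewrite /f abel_kernel_eq0 ?mul0r ?mulr0// ltW.
apply: eq_Rintegral => x _; rewrite /f /abel_kernel.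
by move: (Num.sqrt _)^-1 => q; ring.
Qed.

End abel_transform.

(** * Asymptotics of the Abel transform *)

Section abel_asymptotics.
Context {R : realType}.
Local Notation T := (measurableTypeR R).
Variables (F : R -> R) (c : R).
Hypothesis c1 : 1 <= c.
Hypothesis jF : jet exp_bounded 0 1 c 0 F.
Implicit Types (x r t d L p g k : R).

Let cF r : 0 < r -> {for r, continuous F}.
Proof. by move=> r0; exact: is_derive_continuous (jet_derive jF r0). Qed.

Lemma abel_dom_integrable0 : mu.-integrable `]0, +oo[ (fun t => (abel_dom t)%:E : \bar R).
Proof.
have [i0 _] := abel_dom_integrable (0 : R); move: i0; congr (mu.-integrable _ _).
by apply/funext => t; rewrite subr0.
Qed.

Lemma abel_dom_ge0 t : 0 <= abel_dom t. Proof. by rewrite invr_ge0 sqrtr_ge0. Qed.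

Lemma abel_shift_integrable x : 0 < x ->
  mu.-integrable `]0, +oo[ (fun t => (abel_kernel x (x + t) * F (x + t))%:E).
Proof.
move=> x0; have [M M0 HM] := abel_integrand_le c1 jF x0.
apply: (dominated_integrable (g := fun t => M * abel_dom t)) => //.
- have h := measurable_abel_shift jF x0; exact: h.
- by move=> t; rewrite /= in_itv/= andbT => t0; exact: HM.
- by apply: integrable_scale => //; exact: abel_dom_integrable0.
Qed.

Definition abel_limit_kernel t : R := expR t / 2 / Num.sqrt ((expR t - 1) / 2).

(** Multiply the numerator and the radicand by exp(-x); both then converge. *)
Lemma abel_kernel_cvg_pinfty t : 0 < t ->
  abel_kernel x (x + t) * expR (- (x / 2)) @[x --> +oo] --> abel_limit_kernel t.
Proof.
move=> t0; have et : 0 < expR t - 1 by rewrite subr_gt0 expR_gt1.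
have et2 : 0 < (expR t - 1) / 2 by rewrite divr_gt0.
have e2 := @cvg_expRN2 R.
have hq : expR (- t) * (expR (- x) * expR (- x)) @[x --> +oo] --> expR (- t) * 0 by exact: cvgMr.
have hn : (expR t - expR (- t) * (expR (- x) * expR (- x))) / 2 @[x --> +oo] -->
    (expR t - expR (- t) * 0) / 2.
  by apply: cvgMl; apply: cvgB hq; exact: cvg_cst.
have hd : (expR t - 1) * (1 - expR (- t) * (expR (- x) * expR (- x))) / 2 @[x --> +oo] -->
    (expR t - 1) * (1 - expR (- t) * 0) / 2.
  by apply: cvgMl; apply: cvgMr; apply: cvgB hq; exact: cvg_cst.
rewrite !mulr0 !subr0 ?mulr1 in hn hd.
have hs := cvg_comp_for hd (@sqrt_continuous R ((expR t - 1) / 2)).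
have nz : Num.sqrt ((expR t - 1) / 2) != 0 by rewrite gt_eqF// sqrtr_gt0.
have h : (expR t - expR (- t) * (expR (- x) * expR (- x))) / 2 /
    Num.sqrt ((expR t - 1) * (1 - expR (- t) * (expR (- x) * expR (- x))) / 2)
    @[x --> +oo] --> abel_limit_kernel t by apply: cvgM hn _; exact: cvgV.
apply: (cvg_trans _ h); apply: near_eq_cvg; near=> x.
have x0 : 0 < x by near: x; exact: nbhs_pinfty_gt.
have p : 0 < cosh (x + t) - cosh x by rewrite subr_gt0 cosh_lt ?ltrDl// ltW.
rewrite /= /abel_kernel -[in RHS]mulrA.
have eh : expR (- (x / 2)) = expR (- x) / Num.sqrt (expR (- x)).
  have -> : expR (- x) = expR (- (x / 2)) ^+ 2 by rewrite expr2 -expRD; congr expR; field.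
  by rewrite sqrtr_sqr ger0_norm ?expR_ge0//; field; rewrite gt_eqF ?expR_gt0.
rewrite eh.
have -> : (expR t - 1) * (1 - expR (- t) * (expR (- x) * expR (- x))) / 2 =
    (cosh (x + t) - cosh x) * expR (- x).
  rewrite cosh_sub opprD expRD !expRN; field.
  by rewrite !gt_eqF ?expR_gt0.
have -> : (expR t - expR (- t) * (expR (- x) * expR (- x))) / 2 = sinh (x + t) * expR (- x).
  rewrite /sinh opprD !expRD !expRN; field.
  by rewrite !gt_eqF ?expR_gt0.
rewrite sqrtrM ?(ltW p)//; field.
by rewrite !gt_eqF ?sqrtr_gt0 ?expR_gt0.
Unshelve. all: by end_near. Qed.

Lemma abel_limit_kernel_bound t : 0 < t ->
  0 < expR (- (c * t)) * abel_limit_kernel t <= abel_dom t.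
Proof.
move=> t0; have et : 0 < expR t - 1 by rewrite subr_gt0 expR_gt1.
have s0 : 0 < Num.sqrt (expR t - 1) by rewrite sqrtr_gt0.
have h0 : 0 < Num.sqrt (2^-1) :> R by rewrite sqrtr_gt0.
have e : expR (- (c * t)) * abel_limit_kernel t =
    expR (t - c * t) * (abel_dom t * (2 * Num.sqrt (2^-1))^-1).
  rewrite /abel_limit_kernel /abel_dom sqrtrM ?(ltW et)// expRD; field.
  by rewrite !gt_eqF.
rewrite e; apply/andP; split.
  by rewrite !mulr_gt0 ?expR_gt0// invr_gt0// mulr_gt0.
rewrite mulrCA ler_piMr ?abel_dom_ge0//.
have k1 : 1 <= 2 * Num.sqrt (2^-1) :> R.
  rewrite -(@ler_pXn2r _ 2)// ?nnegrE ?mulr_ge0 ?(ltW h0)// exprMn sqr_sqrtr// expr1n.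
  by rewrite expr2; lra.
rewrite -[leRHS]mulr1; apply: ler_pM; rewrite ?expR_ge0 ?invr_ge0 ?mulr_ge0 ?(ltW h0)//.
  rewrite expR_le1; have : 0 <= (c - 1) * t by rewrite mulr_ge0 ?subr_ge0// ltW.
  by lra.
by rewrite invf_le1 ?(lt_le_trans _ k1).
Qed.

Lemma near_pinfty_le (P : R -> Prop) : (\forall x \near +oo, P x) ->
  exists M : R, forall x, M < x -> P x.
Proof. by move=> [M [_ HM]]; exists M. Qed.

(** In the variable t = r - x, the kernel behaves like exp(x/2) times a function of t and F(x+t) like its leading term; since c >= 1 the product is dominated by the integrable abel_dom. The limiting integrand is positive, so a nonzero leading coefficient is preserved. *)
Lemma abel_asymp_pinfty g L : -1 < g -> asymp_pinfty (fun r => r `^ (- 1 - g)) c L F ->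
  exists2 A : R, 0 < A &
    asymp_pinfty (fun r => r `^ (- 1 - g)) (c - 1 / 2) (L * A) (abel_integral F).
Proof.
move=> g1 aF; set w := fun r : R => r `^ (- 1 - g).
have mk : measurable_fun `](0 : R), +oo[ (fun t => expR (- (c * t)) * abel_limit_kernel t).
  apply: continuous_measurable_oy => t t0.
  have et : 0 < (expR t - 1) / 2 by rewrite divr_gt0// subr_gt0 expR_gt1.
  rewrite /abel_limit_kernel; eapply is_derive_continuous; derive_rule => //.
  by rewrite gt_eqF// sqrtr_gt0.
have ik : mu.-integrable `]0, +oo[ (fun t => (expR (- (c * t)) * abel_limit_kernel t)%:E).
  apply: (dominated_integrable (g := abel_dom)) => //; last exact: abel_dom_integrable0.
  move=> t; rewrite /= in_itv/= andbT => t0.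
  by have /andP[a b] := abel_limit_kernel_bound t0; rewrite gtr0_norm.
exists (\int[mu]_(t in `]0, +oo[) (expR (- (c * t)) * abel_limit_kernel t)).
  by apply: Rintegral_oy_gt0 ik => t /abel_limit_kernel_bound/andP[].
rewrite -RintegralZl; [|exact: measurable_itv|exact: ik].
pose H x t := abel_kernel x (x + t) * F (x + t) * (expR ((c - 1 / 2) * x) / w x).
apply: (@cvg_trans _ ((fun x => \int[mu]_(t in `]0, +oo[) H x t) @ +oo)).
  apply: near_eq_cvg; near=> x.
  have x0 : 0 < x by near: x; exact: nbhs_pinfty_gt.
  rewrite /= (abel_integral_shift jF x0) -mulrA mulrC.
  rewrite -RintegralZl; [|exact: measurable_itv|exact: abel_shift_integrable].
  by apply: eq_Rintegral => t _; rewrite /H mulrC.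
have [K K0 HK] := abel_kernel_le (@ltr01 R).
have [X HX] : exists X : R, forall x, X < x -> `|F x * expR (c * x) / w x| <= `|L| + 1.
  have aF' : F r * expR (c * r) / w r @[r --> +oo] --> L by exact: aF.
  apply: near_pinfty_le; move: aF' => /cvgr_norm_le; apply.
  by rewrite ltrDl.
apply: (@dominated_cvg_filter _ T R mu _ (measurable_itv _) (+oo_R) H _
   (fun t => (K * (`|L| + 1)) * abel_dom t)).
- exact: sequential_pinfty.
- near=> x; have x0 : 0 < x by near: x; exact: nbhs_pinfty_gt.
  have h := measurable_abel_shift jF x0; by apply: measurable_funM => //; exact: h.
- move=> t; rewrite /= in_itv/= andbT => t0.
  have sh : (x + t) @[x --> +oo] --> +oo_R.
    apply/cvgryPge => A; near=> x; rewrite -lerBlDr.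
    by near: x; apply: nbhs_pinfty_ge; exact: num_real.
  have h1 := abel_kernel_cvg_pinfty t0.
  have h2 := cvg_comp _ _ sh aF.
  have h3 : ((x + t) / x) `^ (- 1 - g) @[x --> +oo] --> (1 : R).
    have e1 : (1 : R) `^ (- 1 - g) = 1 by rewrite powR1.
    rewrite -[X in _ --> X]e1.
    apply: (cvg_comp_for (h := fun z => z `^ (- 1 - g))); last exact: powR_continuous.
    have h4 : 1 + t * x^-1 @[x --> +oo] --> (1 + t * 0 : R).
      by apply: cvgD; [exact: cvg_cst|apply: cvgMr; exact: cvg_invr_pinfty].
    rewrite mulr0 addr0 in h4.
    apply: (cvg_trans _ h4); apply: near_eq_cvg; near=> x.
    have x0 : 0 < x by near: x; exact: nbhs_pinfty_gt.
    by field; rewrite gt_eqF.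
  have h : (abel_kernel x (x + t) * expR (- (x / 2)) * expR (- (c * t))) *
     (F (x + t) * expR (c * (x + t)) / w (x + t)) * ((x + t) / x) `^ (- 1 - g) @[x --> +oo] -->
     (abel_limit_kernel t * expR (- (c * t))) * L * 1.
    by apply: cvgM h3; apply: cvgM h2; apply: cvgMl.
  rewrite mulr1 in h.
  rewrite (_ : L * _ = abel_limit_kernel t * expR (- (c * t)) * L); last by ring.
  apply: (cvg_trans _ h); apply: near_eq_cvg; near=> x.
  have x0 : 0 < x by near: x; exact: nbhs_pinfty_gt.
  have wx : 0 < w x by exact: powR_gt0.
  have wxt : 0 < w (x + t) by apply: powR_gt0; exact: addr_gt0.
  rewrite /H powR_div ?addr_gt0// -/(w x) -/(w (x + t)).
  have -> : expR ((c - 1 / 2) * x) = expR (- (x / 2)) * expR (- (c * t)) * expR (c * (x + t)).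
    by rewrite -!expRD; congr expR; field.
  by field; rewrite !gt_eqF.
- by apply: integrable_scale => //; exact: abel_dom_integrable0.
- near=> x => t; rewrite /= in_itv/= andbT => t0.
  have x1 : 1 <= x by near: x; apply: nbhs_pinfty_ge; exact: num_real.
  have xX : X < x by near: x; apply: nbhs_pinfty_gt; exact: num_real.
  have x0 : 0 < x by exact: lt_le_trans x1.
  have xt0 : 0 < x + t by exact: addr_gt0.
  have wx : 0 < w x by exact: powR_gt0.
  have wxt : 0 < w (x + t) by exact: powR_gt0.
  have wle : w (x + t) <= w x.
    rewrite /w (_ : - 1 - g = - (1 + g)); last by ring.
    rewrite !(powRN _ (1 + g)) lef_pV2 ?posrE ?powR_gt0//.
    apply: ge0_ler_powR; rewrite ?nnegrE ?(ltW x0) ?(ltW xt0)//; first by lra.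
    by rewrite lerDl ltW.
  have hF : `|F (x + t)| <= (`|L| + 1) * (w (x + t) * expR (- (c * (x + t)))).
    have xtX : X < x + t by apply: (lt_trans xX); rewrite ltrDl.
    have := HX _ xtX; rewrite !normrM (gtr0_norm (expR_gt0 _)) normfV (gtr0_norm wxt).
    rewrite ler_pdivrMr// -ler_pdivlMr ?expR_gt0// => h; apply: (le_trans h).
    by rewrite expRN -mulrA.
  have ew : 0 <= expR ((c - 1 / 2) * x) / w x by rewrite divr_ge0 ?expR_ge0// ltW.
  rewrite /H normrM (ger0_norm ew) normrM (ger0_norm (abel_kernel_ge0 x xt0)).
  have h1 := HK x t x1 t0.
  apply: (@le_trans _ _ (K * (expR (x / 2 + t) * abel_dom t) *
     ((`|L| + 1) * (w (x + t) * expR (- (c * (x + t))))) * (expR ((c - 1 / 2) * x) / w x))).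
    rewrite ler_wpM2r ?divr_ge0 ?expR_ge0 ?(ltW wx)//.
    by apply: ler_pM => //; exact: abel_kernel_ge0.
  rewrite (_ : _ * _ * _ = (K * (`|L| + 1) * abel_dom t) *
     (expR (x / 2 + t) * expR (- (c * (x + t))) * expR ((c - 1 / 2) * x) * (w (x + t) / w x))); last first.
    by field; rewrite gt_eqF.
  rewrite -!expRD ler_piMr ?mulr_ge0 ?abel_dom_ge0 ?(ltW K0) ?addr_ge0//.
  rewrite -[leRHS]mulr1; apply: ler_pM; rewrite ?expR_ge0 ?divr_ge0 ?powR_ge0//.
    rewrite expR_le1; have : 0 <= (c - 1) * t by rewrite mulr_ge0 ?subr_ge0// ltW.
    by lra.
  by rewrite ler_pdivrMr// mul1r.
Unshelve. all: by end_near. Qed.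

End abel_asymptotics.

Section abel_asymptotics_zero.
Context {R : realType}.
Local Notation T := (measurableTypeR R).
Implicit Types (F : R -> R) (x r t c d L p k : R).

Lemma sinh_ge x : 0 <= x -> x <= sinh x.
Proof.
rewrite le_eqVlt => /orP[/eqP <-|x0]; first by rewrite sinh_cosh0.1.
have [z _] := @MVT R (@sinh R) (@cosh R) 0 x x0 (fun z _ => is_derive_sinh z)
  (continuous_subspaceT continuous_sinh).
by rewrite sinh_cosh0.1 !subr0 => ->; rewrite ler_peMl ?(ltW x0)// cosh_ge1.
Qed.

Lemma sinh_le x : 0 <= x -> sinh x <= x * expR x.
Proof.
move=> x0; rewrite /sinh ler_pdivrMr//.
have := expR_ge1Dx (- (2 * x)); have e0 := expR_gt0 x.
move=> /(ler_wpM2l (ltW e0)); rewrite -expRD (_ : x - 2 * x = - x); last by ring.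
by lra.
Qed.

Lemma cosh_sub_sinh r x : cosh r - cosh x = 2 * sinh ((r + x) / 2) * sinh ((r - x) / 2).
Proof.
have e y z : expR (y / 2 + z / 2) = expR (y / 2) * expR (z / 2) :> R by rewrite expRD.
rewrite /cosh /sinh.
rewrite (_ : expR r = expR ((r + x) / 2) * expR ((r - x) / 2)); last by rewrite -expRD; congr expR; field.
rewrite (_ : expR (- r) = expR (- ((r + x) / 2)) * expR (- ((r - x) / 2))); last by rewrite -expRD; congr expR; field.
rewrite (_ : expR x = expR ((r + x) / 2) * expR (- ((r - x) / 2))); last by rewrite -expRD; congr expR; field.
rewrite (_ : expR (- x) = expR (- ((r + x) / 2)) * expR ((r - x) / 2)); last by rewrite -expRD; congr expR; field.
by field.
Qed.

Lemma cvg_sinhM_div k : sinh (k * x) / x @[x --> 0^'+] --> k.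
Proof.
have ds (x : R) : is_derive x 1 (fun x => sinh (k * x)) (cosh (k * x) * k).
  have h : is_derive x 1 (fun x : R => k * x) k.
    eapply is_derive_eq; first by derive_rule.
    by rewrite mul0r add0r mulr1.
  exact: (@dcomp R (@sinh R) (fun x => k * x) x _ _ (is_derive_sinh _) h).
rewrite -[X in _ --> X]divr1.
apply: (@lhopital_at_right _ (fun x => sinh (k * x)) (fun x => cosh (k * x) * k) id (fun=> 1) 0 1 _ ltr01).
- have := cvg_right_for (is_derive_continuous (ds 0)).
  by rewrite mulr0 sinh_cosh0.1.
- by apply: cvg_at_right_filter; exact: cvg_id.
- by move=> x _; exact: oner_neq0.
- under eq_cvg do rewrite divr1; rewrite divr1.
  have h : {for (0 : R), continuous (fun x : R => cosh (k * x) * k)}.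
    have hc : is_derive (0 : R) 1 (fun x : R => k * x) (0 * 0 + k * 1) by derive_rule.
    have hd := @dcomp R (@cosh R) (fun x => k * x) 0 _ _ (is_derive_cosh _) hc.
    by eapply is_derive_continuous; derive_rule.
  have := cvg_right_for h; by rewrite mulr0 sinh_cosh0.2 mul1r.
Qed.

Lemma abel_kernel_cvg_zero t : 0 < t ->
  abel_kernel x (x + x * t) @[x --> 0^'+] --> (1 + t) / Num.sqrt (t * (2 + t) / 2).
Proof.
move=> t0; have q0 : 0 < t * (2 + t) / 2 by rewrite divr_gt0// mulr_gt0// addr_gt0.
have hn := @cvg_sinhM_div (1 + t).
have ha := @cvg_sinhM_div ((2 + t) / 2); have hb := @cvg_sinhM_div (t / 2).
have hd : 2 * (sinh ((2 + t) / 2 * x) / x) * (sinh (t / 2 * x) / x) @[x --> 0^'+] -->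
    2 * ((2 + t) / 2) * (t / 2) by apply: cvgM hb; exact: cvgMr.
rewrite (_ : 2 * ((2 + t) / 2) * (t / 2) = t * (2 + t) / 2) in hd; last by field.
have hs := cvg_comp_for hd (@sqrt_continuous R (t * (2 + t) / 2)).
have nz : Num.sqrt (t * (2 + t) / 2) != 0 by rewrite gt_eqF// sqrtr_gt0.
have h : sinh ((1 + t) * x) / x /
    Num.sqrt (2 * (sinh ((2 + t) / 2 * x) / x) * (sinh (t / 2 * x) / x)) @[x --> 0^'+] -->
    (1 + t) / Num.sqrt (t * (2 + t) / 2) by apply: cvgM hn _; exact: cvgV.
apply: (cvg_trans _ h); apply: near_eq_cvg; near=> x.
have x0 : 0 < x by near: x; exact: nbhs_right_gt.
rewrite /= /abel_kernel cosh_sub_sinh.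
rewrite (_ : (x + x * t + x) / 2 = (2 + t) / 2 * x); last by field.
rewrite (_ : (x + x * t - x) / 2 = t / 2 * x); last by field.
rewrite (_ : x + x * t = (1 + t) * x); last by ring.
have sa : 0 < sinh ((2 + t) / 2 * x) by rewrite sinh_gt0// mulr_gt0// divr_gt0// addr_gt0.
have sb : 0 < sinh (t / 2 * x) by rewrite sinh_gt0// mulr_gt0// divr_gt0.
move: (sinh _) (sinh _) (sinh _) sa sb => N B A A0 B0.
rewrite (_ : 2 * (A / x) * (B / x) = 2 * A * B / x ^+ 2); last by field; rewrite gt_eqF.
rewrite sqrtrM; last by rewrite !mulr_ge0 ?(ltW A0) ?(ltW B0).
rewrite sqrtrV ?sqr_ge0// sqrtr_sqr (gtr0_norm x0); field.
by rewrite !gt_eqF// sqrtr_gt0 !mulr_gt0.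
Unshelve. all: by end_near. Qed.

Lemma abel_kernel_le_zero x t : 0 < x -> 0 < t ->
  abel_kernel x (x + x * t) <= (1 + t) / Num.sqrt (t * (2 + t) / 2) * expR (x + x * t).
Proof.
move=> x0 t0; have q0 : 0 < t * (2 + t) / 2 by rewrite divr_gt0// mulr_gt0// addr_gt0.
have sq0 : 0 < Num.sqrt (t * (2 + t) / 2) by rewrite sqrtr_gt0.
have r0 : 0 < x + x * t by rewrite addr_gt0// mulr_gt0.
have a0 : 0 <= (x + x * t + x) / 2 by rewrite divr_ge0// addr_ge0// ltW.
have b0 : 0 <= (x + x * t - x) / 2 by rewrite addrAC subrr add0r divr_ge0// mulr_ge0 ?ltW.
have h : x ^+ 2 * (t * (2 + t) / 2) <= cosh (x + x * t) - cosh x.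
  rewrite cosh_sub_sinh (_ : x ^+ 2 * _ = 2 * ((x + x * t + x) / 2) * ((x + x * t - x) / 2)); last by field.
  apply: ler_pM; [by rewrite mulr_ge0|exact: b0|by rewrite ler_wpM2l// sinh_ge|exact: sinh_ge].
rewrite /abel_kernel; apply: (@le_trans _ _ ((x + x * t) * expR (x + x * t) / Num.sqrt (x ^+ 2 * (t * (2 + t) / 2)))).
  apply: ler_pM; rewrite ?invr_ge0 ?sqrtr_ge0 ?(ltW (sinh_gt0 r0)) ?sinh_le ?(ltW r0)//.
  have p : 0 < x ^+ 2 * (t * (2 + t) / 2) by rewrite mulr_gt0// exprn_gt0.
  by rewrite lef_pV2 ?posrE ?sqrtr_gt0 ?(lt_le_trans p h)//; exact: ler_wsqrtr.
rewrite sqrtrM ?sqr_ge0// sqrtr_sqr (gtr0_norm x0) le_eqVlt; apply/orP; left; apply/eqP.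
by field; rewrite !gt_eqF.
Qed.

(** The behaviour at 0 and the decay at infinity combine into a bound valid on the half-line; the exponential is needed because the kernel at scale x is bounded only up to exp(r). *)
Lemma asymp_zero_global F c p L : 1 < c -> exp_bounded c 0 F -> 0 < p -> asymp_zero p L F ->
  exists2 C : R, 0 <= C & forall r, 0 < r -> `|F r| * r `^ p <= C * expR (- r).
Proof.
move=> c1 eF p0 aF.
have [d d0 Hd] : exists2 d : R, 0 < d & forall r, 0 < r -> r < d -> `|F r * r `^ p| <= `|L| + 1.
  have aF' : F r * r `^ p @[r --> 0^'+] --> L by exact: aF.
  have : \forall r \near 0^'+, `|F r * r `^ p| <= `|L| + 1.
    by move: aF' => /cvgr_norm_le; apply; rewrite ltrDl.
  move=> [e /= e0 He]; exists e => // r r0 re; apply: He => //=.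
  by rewrite sub0r normrN gtr0_norm.
have [C1 HC1] := eF d d0.
have cm : 0 < c - 1 by rewrite subr_gt0.
have [C2 C20 HC2] := powR_le_expR p cm.
exists ((`|L| + 1) * expR d + `|C1| * C2).
  by rewrite addr_ge0// mulr_ge0 ?expR_ge0 ?addr_ge0// ltW.
move=> r r0; rewrite mulrDl; have [rd|dr] := ltP r d.
  apply: (@le_trans _ _ ((`|L| + 1) * expR d * expR (- r))); last first.
    by rewrite lerDl !mulr_ge0 ?expR_ge0// ltW.
  have := Hd r r0 rd; rewrite normrM (ger0_norm (powR_ge0 _ _)) => h.
  apply: (le_trans h); rewrite -mulrA ler_peMr ?addr_ge0// -expRD.
  by rewrite -[leLHS]expR0 ler_expR subr_ge0 ltW.
apply: (@le_trans _ _ (`|C1| * C2 * expR (- r))); last first.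
  by rewrite lerDr !mulr_ge0 ?expR_ge0 ?addr_ge0.
apply: (@le_trans _ _ ((`|C1| * expR (- (c * r))) * (C2 * expR ((c - 1) * r)))).
  apply: ler_pM; rewrite ?powR_ge0//.
    by apply: (le_trans (HC1 _ dr)); rewrite ler_wpM2r ?expR_ge0// ler_norm.
  apply: le_trans (HC2 r (ltW r0)); apply: ge0_ler_powR; rewrite ?nnegrE ?(ltW p0) ?(ltW r0)//.
    by rewrite addr_ge0// ltW.
  by rewrite lerDr.
rewrite (_ : _ * _ = `|C1| * C2 * (expR (- (c * r)) * expR ((c - 1) * r))); last by ring.
by rewrite -expRD le_eqVlt; apply/orP; left; apply/eqP; congr (_ * expR _); ring.
Qed.

(** Substituting r = x(1+t) makes the kernel converge to (1+t)/sqrt(t(2+t)/2) while F contributes x^(-p)(1+t)^(-p); the Jacobian x accounts for the loss of one power. *)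
Lemma abel_asymp_zero F c p L : 1 < c -> jet exp_bounded 0 1 c 0 F -> 1 < p ->
  asymp_zero p L F -> exists2 A : R, 0 < A & asymp_zero (p - 1) (L * A) (abel_integral F).
Proof.
move=> c1 jF p1 aF; have p0 : 0 < p by exact: lt_trans p1.
have [C C0 HC] := asymp_zero_global c1 (jet0 jF) p0 aF.
pose k t : R := (1 + t) `^ (- p) * ((1 + t) / Num.sqrt (t * (2 + t) / 2)).
have q0 t : 0 < t -> 0 < t * (2 + t) / 2 by move=> t0; rewrite divr_gt0// mulr_gt0// addr_gt0.
have k0 t : 0 < t -> 0 < k t.
  move=> t0; rewrite mulr_gt0 ?powR_gt0 ?divr_gt0 ?addr_gt0// sqrtr_gt0; exact: q0.
have ik : mu.-integrable `]0, +oo[ (fun t => (k t)%:E).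
  have n1 : -1 < - (1 / 2) :> R by lra.
  have n2 : - (1 / 2) + (1 / 2 - p) < -1 by lra.
  apply: (dominated_integrable (g := fun t => Num.sqrt 2 * (t `^ (- (1 / 2)) * (1 + t) `^ (1 / 2 - p)))) => //.
  - apply: continuous_measurable_oy => t t0; have qt := q0 _ t0.
    have t1 : 0 < 1 + t by rewrite addr_gt0.
    rewrite /k; eapply is_derive_continuous; derive_rule => //.
    by rewrite gt_eqF// sqrtr_gt0.
  - move=> t; rewrite /= in_itv/= andbT => t0; rewrite gtr0_norm ?k0//.
    have t1 : 0 < 1 + t by rewrite addr_gt0.
    rewrite /k; apply: (@le_trans _ _ ((1 + t) `^ (- p) * ((1 + t) * (Num.sqrt 2 * (t `^ (- (1/2)) * (1 + t) `^ (- (1/2))))))).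
      rewrite ler_wpM2l ?powR_ge0// ler_wpM2l ?(ltW t1)//.
      have s2 : 0 < Num.sqrt 2 :> R by rewrite sqrtr_gt0.
      rewrite sqrtrM ?sqrtrV ?mulr_ge0 ?(ltW t0) ?addr_ge0 ?(ltW t0)//.
      rewrite invf_div ler_wpM2l ?(ltW s2)//.
      rewrite !(powRN _ (1 / 2)) -invfM -powRM ?(ltW t0) ?(ltW t1)//.
      rewrite (_ : 1 / 2 = 2^-1); last by field.
      rewrite powR12_sqrt ?mulr_ge0 ?(ltW t0) ?(ltW t1)//.
      rewrite lef_pV2 ?posrE ?sqrtr_gt0 ?mulr_gt0 ?addr_gt0//.
      by apply: ler_wsqrtr; rewrite ler_wpM2l ?(ltW t0)//; lra.
    rewrite le_eqVlt; apply/orP; left; apply/eqP.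
    rewrite -[X in _ * (X * _)](powRr1 (ltW t1)).
    transitivity (Num.sqrt 2 * (t `^ (- (1 / 2)) * ((1 + t) `^ (- p) * (1 + t) `^ 1 * (1 + t) `^ (- (1 / 2))))).
      by ring.
    by rewrite -!powR_add//; congr (_ * (_ * _ `^ _)); field.
  - by apply: integrable_scale => //; exact: beta_integrable2.
exists (\int[mu]_(t in `]0, +oo[) k t); first exact: Rintegral_oy_gt0 k0 ik.
rewrite -RintegralZl; [|exact: measurable_itv|exact: ik].
pose H x t := abel_kernel x (x + x * t) * F (x + x * t) * x `^ p.
have cF r : 0 < r -> {for r, continuous F}.
  by move=> r0; exact: is_derive_continuous (jet_derive jF r0).
have mK x : 0 < x -> measurable_fun `]x, +oo[ (fun r => abel_kernel x r * F r).
  move=> x0; apply: continuous_measurable_oy => r xr; apply: cvgM.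
    exact: continuous_abel_kernel.
  by apply: cF; exact: lt_trans xr.
have Hle x t : 0 < x -> 0 < t -> `|H x t| <= C * k t.
  move=> x0 t0; have r0 : 0 < x + x * t by rewrite addr_gt0// mulr_gt0.
  have t1 : 0 < 1 + t by rewrite addr_gt0.
  rewrite /H normrM (ger0_norm (powR_ge0 _ _)) normrM (ger0_norm (abel_kernel_ge0 _ r0)).
  have e : x `^ p = (x + x * t) `^ p * (1 + t) `^ (- p).
    rewrite powRN (_ : x + x * t = x * (1 + t)); last by ring.
    by rewrite powRM ?(ltW x0) ?(ltW t1)// mulfK// gt_eqF// powR_gt0.
  rewrite e (_ : _ * _ * _ = abel_kernel x (x + x * t) * (`|F (x + x * t)| * (x + x * t) `^ p) * (1 + t) `^ (- p)); last by ring.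
  rewrite /k [C * _]mulrCA [leLHS]mulrC ler_wpM2l ?powR_ge0//.
  apply: (@le_trans _ _ (((1 + t) / Num.sqrt (t * (2 + t) / 2) * expR (x + x * t)) * (C * expR (- (x + x * t))))).
    apply: ler_pM; [exact: abel_kernel_ge0|by rewrite mulr_ge0 ?powR_ge0|exact: abel_kernel_le_zero|exact: HC].
  rewrite mulrACA [_ * C]mulrC -mulrA -expRD subrr expR0 mulr1.
  by rewrite lexx.
apply: (@cvg_trans _ ((fun x => \int[mu]_(t in `]0, +oo[) H x t) @ 0^'+)).
  apply: near_eq_cvg; near=> x.
  have x0 : 0 < x by near: x; exact: nbhs_right_gt.
  have iH : mu.-integrable `]0, +oo[ (fun t => (abel_kernel x (x + x * t) * F (x + x * t))%:E).
    have [M _ HM] := abel_integrand_integrable (ltW c1) jF x0.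
    have h := integrable_affine (f := fun r => abel_kernel x r * F r) x0 (HM x (lexx x)).1.
    exact: h.
  rewrite /= /abel_integral (Rintegral_affine x0 (mK x x0)).
  have ep : x * x `^ (p - 1) = x `^ p.
    by rewrite -[X in X * _](powRr1 (ltW x0)) -powR_add// subrKC.
  rewrite mulrAC ep.
  rewrite -RintegralZl; [|exact: measurable_itv|exact: iH].
  by apply: eq_Rintegral => t _; rewrite /H mulrC.
apply: (@dominated_cvg_filter _ T R mu _ (measurable_itv _) (0^'+) H _ (fun t => C * k t)).
- exact: sequential_at_right.
- near=> x; have x0 : 0 < x by near: x; exact: nbhs_right_gt.
  have h := measurable_affine x0 (mK x x0).
  by apply: measurable_funM => //; exact: h.
- move=> t; rewrite /= in_itv/= andbT => t0.
  have t1 : 0 < 1 + t by rewrite addr_gt0.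
  have sh : (x + x * t) @[x --> 0^'+] --> (0 : R)^'+.
    move=> A [e /= e0 He]; change (\forall x \near 0^'+, A (x + x * t)); near=> x.
    have x0 : 0 < x by near: x; exact: nbhs_right_gt.
    have r0 : 0 < x + x * t by rewrite addr_gt0// mulr_gt0.
    apply: He => //=; rewrite sub0r normrN gtr0_norm//.
    rewrite (_ : x + x * t = x * (1 + t)); last by ring.
    by rewrite -ltr_pdivlMr//; near: x; apply: nbhs_right_lt; rewrite divr_gt0.
  have h2 : F (x + x * t) * (x + x * t) `^ p @[x --> 0^'+] --> L by exact: cvg_comp sh aF.
  have h1 := abel_kernel_cvg_zero t0.
  have h : abel_kernel x (x + x * t) * (F (x + x * t) * (x + x * t) `^ p) * (1 + t) `^ (- p) @[x --> 0^'+] -->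
     (1 + t) / Num.sqrt (t * (2 + t) / 2) * L * (1 + t) `^ (- p).
    by apply: cvgMl; exact: cvgM.
  rewrite /k (_ : L * _ = (1 + t) / Num.sqrt (t * (2 + t) / 2) * L * (1 + t) `^ (- p)); last by ring.
  apply: (cvg_trans _ h); apply: near_eq_cvg; near=> x.
  have x0 : 0 < x by near: x; exact: nbhs_right_gt.
  rewrite /H (_ : x `^ p = (x + x * t) `^ p * (1 + t) `^ (- p)); first by ring.
  rewrite powRN (_ : x + x * t = x * (1 + t)); last by ring.
  by rewrite powRM ?(ltW x0) ?(ltW t1)// mulfK// gt_eqF// powR_gt0.
- exact: integrable_scale.
- near=> x; have x0 : 0 < x by near: x; exact: nbhs_right_gt.
  by move=> t; rewrite /= in_itv/= andbT => t0; exact: Hle.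
Unshelve. all: by end_near. Qed.

End abel_asymptotics_zero.

(** * From the half-line to the kernel *)

Section even_integral.
Context {R : realType}.
Local Notation T := (measurableTypeR R).
Implicit Types f : R -> R.

Lemma ge0_even_integral f : continuous f -> (forall x, f (- x) = f x) -> (forall x, 0 <= f x) ->
  (\int[mu]_x (f x)%:E = 2%:E * \int[mu]_(x in `]0%R, +oo[) (f x)%:E)%E.
Proof.
move=> cf ef f0; rewrite ge0_symfun_integralT//; last by move=> x /=; rewrite ef.
congr (_ * _)%E; rewrite -set_itvcy integral_itv_obnd_cbnd//.
by apply: measurable_funTS; apply/measurable_EFinP; exact: continuous_measurable_fun.
Qed.

Lemma ge0_even_integrable f : continuous f -> (forall x, f (- x) = f x) -> (forall x, 0 <= f x) ->
  mu.-integrable `]0, +oo[ (EFin \o f) ->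
  mu.-integrable setT (EFin \o f) /\ \int[mu]_x f x = 2 * \int[mu]_(x in `]0, +oo[) f x.
Proof.
move=> cf ef f0 fi; have E := ge0_even_integral cf ef f0.
have ff : (\int[mu]_(x in `]0%R, +oo[) (f x)%:E)%E \is a fin_num by exact: integrable_fin_num fi.
split; last by rewrite /Rintegral E fineM.
apply/integrableP; split; first by apply/measurable_EFinP; exact: continuous_measurable_fun.
under eq_integral do rewrite /= ger0_norm//.
rewrite E -[X in (_ * X)%E]fineK// -EFinM; exact: ltry.
Qed.

Lemma even_integral f : continuous f -> (forall x, f (- x) = f x) ->
  mu.-integrable `]0, +oo[ (EFin \o f) ->
  mu.-integrable setT (EFin \o f) /\ \int[mu]_x f x = 2 * \int[mu]_(x in `]0, +oo[) f x.
Proof.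
move=> cf ef fi.
pose q x := `|f x|; pose p x := `|f x| + f x.
have iq : mu.-integrable `]0, +oo[ (EFin \o q) by exact: (@integrable_norm _ T R mu _ _ fi).
have ip : mu.-integrable `]0, +oo[ (EFin \o p) by exact: integrable_add (measurable_itv _) iq fi.
have cq : continuous q by move=> x; apply: cvg_norm; exact: cf.
have cp : continuous p by move=> x; apply: cvgD; [exact: cq|exact: cf].
have [iq' eq'] : mu.-integrable setT (EFin \o q) /\ \int[mu]_x q x = 2 * \int[mu]_(x in `]0, +oo[) q x.
  by apply: ge0_even_integrable => // x; rewrite /q ?ef.
have [ip' ep'] : mu.-integrable setT (EFin \o p) /\ \int[mu]_x p x = 2 * \int[mu]_(x in `]0, +oo[) p x.
  apply: ge0_even_integrable => // x; rewrite /p ?ef//.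
  by have := ler_norm (- f x); rewrite normrN -subr_ge0 opprK.
have e : f = fun x => p x - q x by apply/funext => x; rewrite /p /q addrAC subrr add0r.
split; first by rewrite e; exact: (integrable_sub measurableT ip' iq').
rewrite e RintegralB; [|exact: measurableT|exact: ip'|exact: iq'].
rewrite RintegralB; [|exact: measurable_itv|exact: ip|exact: iq].
by rewrite ep' eq' mulrBr.
Qed.

End even_integral.

Section radial_kernel.
Context {R : realType}.
Local Notation T := (measurableTypeR R).
Implicit Types (f h phi : R -> R) (a e c g k x L : R) (n : nat).

(** The operation that produces the spectral kernel from cos(lambda r) and the kernel of the fractional Laplacian from the Bessel profile. *)
Definition radial_kernel n f : R -> R :=
  if odd n then iter n.-1./2 (@radial_deriv R) f
  else abel_integral (iter n./2 (@radial_deriv R) f).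

Lemma half_odd n : (2 <= n)%N -> odd n -> n%:R = 2 * n.-1./2%:R + 1 :> R /\ (1 <= n.-1./2)%N.
Proof.
case: n => // n n2 /= on; have e : n = (n./2).*2.
  by rewrite -[LHS]odd_double_half (negbTE on).
split; last by case: n e n2 on => [|[|n]].
by rewrite -natr1 [in LHS]e -mul2n natrM.
Qed.

Lemma half_even n : (2 <= n)%N -> ~~ odd n -> n%:R = 2 * n./2%:R :> R /\ (1 <= n./2)%N.
Proof.
move=> n2 on; have e : n = (n./2).*2 by rewrite -[LHS]odd_double_half (negbTE on).
by split; [rewrite [in LHS]e -mul2n natrM|case: n e n2 on => [|[|n]]].
Qed.

(** The function h depends on phi only. The same h therefore serves for cosines and for the profile. *)
Lemma radial_kernel_transposition n phi : (2 <= n)%N -> bump phi ->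
  exists2 h, exists2 c, 0 < c & decaying 5 c h &
  forall f e, 0 <= e -> jet exp_bounded 0 (2 + n) e 0 f ->
    \int[mu]_(x in `]0, +oo[) (radial_kernel n f x * phi x) =
    \int[mu]_(x in `]0, +oo[) (f x * h x).
Proof.
move=> n2 bp; rewrite /radial_kernel; case: (boolP (odd n)) => on.
  exists (iter n.-1./2 adjoint phi).
    by exists 1 => //; exact: (bump_iter_adjoint _ bp).1.
  move=> f e e0 jf; apply: (@int_iter_radial_deriv _ _ _ _ e 1).
  - apply: jet_leq jf; rewrite leq_add2l.
    by apply: leq_trans (leq_pred n); rewrite -{2}(odd_double_half n.-1) -addnn addnA leq_addl.
  - exact: bp.1.
  - by lra.
have [en m1] := half_even n2 on; set m := n./2 in en m1 *.
pose k r := sinh r * int_rsqrt phi r.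
exists (iter m adjoint k).
  exists (- (1 / 2) + m%:R).
    have : 1 <= m%:R :> R by rewrite ler1n.
    by move: (m%:R) => z; lra.
  by apply: decaying_iter_adjoint; exact: sinh_int_rsqrt_decaying.
move=> f e e0 jf.
have mn : (m <= n)%N by rewrite /m -{2}(odd_double_half n) -addnn addnA leq_addl.
have j1 : jet exp_bounded 0 1 (e + m%:R) 0 (iter m (@radial_deriv R) f).
  by apply: jet_bounded_iter_radial; apply: jet_leq jf; rewrite leq_add.
have em : 1 <= e + m%:R.
  have : 1 <= m%:R :> R by rewrite ler1n.
  by move: (m%:R) => z; lra.
rewrite (abel_transposition em j1 bp).
apply: (@int_iter_radial_deriv _ m f k e (- (1 / 2))).
- by apply: jet_leq jf; rewrite leq_add2l.
- exact: sinh_int_rsqrt_decaying.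
- by lra.
Qed.

Lemma iter_radial_scale m f h k c : jet exp_bounded 0 m c 0 f ->
  (forall x, 0 < x -> h x = k * f x) -> forall x, 0 < x ->
  iter m (@radial_deriv R) h x = k * iter m (@radial_deriv R) f x.
Proof.
move=> jf hf; elim: m jf => [|m IH] jf x x0; first exact: hf.
have jm : jet exp_bounded 0 1 (c + m%:R) 0 (iter m (@radial_deriv R) f).
  by apply: jet_bounded_iter_radial; rewrite add1n.
rewrite !iterS /radial_deriv mulrA; congr (_ / _).
rewrite (derive1_ext (g := fun y => k * iter m (@radial_deriv R) f y) _ x0); last first.
  by move=> y y0; apply: IH => //; exact: jet_weaken.
apply: is_derive_derive1.
apply: (is_derive_eq (dmul (dcst k x) (jet_derive jm x0))).
by rewrite mul0r add0r.
Qed.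

Lemma radial_kernel_scale n f h k c : (2 <= n)%N -> 0 <= c ->
  jet exp_bounded 0 (2 + n) c 0 f -> (forall x, 0 < x -> h x = k * f x) ->
  forall x, 0 < x -> radial_kernel n h x = k * radial_kernel n f x.
Proof.
move=> n2 c0 jf hf x x0; rewrite /radial_kernel; case: (boolP (odd n)) => on.
  apply: (iter_radial_scale (c := c)) => //; apply: jet_leq jf.
  apply: (@leq_trans n); last by rewrite leq_addl.
  by apply: leq_trans (leq_pred n); rewrite -{2}(odd_double_half n.-1) -addnn addnA leq_addl.
have [en m1] := half_even n2 on; set m := n./2 in en m1 *.
have mn : (m <= n)%N by rewrite /m -{2}(odd_double_half n) -addnn addnA leq_addl.
have j1 : jet exp_bounded 0 1 (c + m%:R) 0 (iter m (@radial_deriv R) f).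
  by apply: jet_bounded_iter_radial; apply: jet_leq jf; rewrite leq_add.
have em : 1 <= c + m%:R.
  have : 1 <= m%:R :> R by rewrite ler1n.
  by move: (m%:R) => z; lra.
have [M _ HM] := abel_integrand_integrable em j1 x0.
have i := (HM x (lexx x)).1.
rewrite /abel_integral -RintegralZl; [|exact: measurable_itv|exact: i].
apply: eq_Rintegral => r; rewrite inE/= in_itv/= andbT => xr.
rewrite (iter_radial_scale (c := c) (f := f) (k := k)) ?(lt_trans x0 xr)//.
  by rewrite mulrCA.
by apply: jet_leq jf; apply: (leq_trans mn); rewrite leq_addl.
Qed.

Lemma continuous_radial_kernel n f c x : (2 <= n)%N -> 0 <= c ->
  jet exp_bounded 0 (2 + n) c 0 f -> 0 < x -> {for x, continuous (radial_kernel n f)}.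
Proof.
move=> n2 c0 jf x0; rewrite /radial_kernel; case: (boolP (odd n)) => on.
  have mn : (n.-1./2 <= n)%N.
    by apply: leq_trans (leq_pred n); rewrite -{2}(odd_double_half n.-1) -addnn addnA leq_addl.
  have j1 : jet exp_bounded 0 1 (c + n.-1./2%:R) 0 (iter n.-1./2 (@radial_deriv R) f).
    by apply: jet_bounded_iter_radial; apply: jet_leq jf; rewrite leq_add.
  exact: is_derive_continuous (jet_derive j1 x0).
have [en m1] := half_even n2 on; set m := n./2 in en m1 *.
have mn : (m <= n)%N by rewrite /m -{2}(odd_double_half n) -addnn addnA leq_addl.
have j1 : jet exp_bounded 0 1 (c + m%:R) 0 (iter m (@radial_deriv R) f).
  by apply: jet_bounded_iter_radial; apply: jet_leq jf; rewrite leq_add.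
apply: (continuous_abel_integral _ j1) => //.
have : 1 <= m%:R :> R by rewrite ler1n.
by move: (m%:R) => z; lra.
Qed.

Lemma radial_kernel_profile_zero n a g : (2 <= n)%N -> 0 < a -> a = (n%:R - 1) / 2 ->
  - (1 / 2) < g -> exists2 L, L != 0 &
  asymp_zero (n%:R + 2 * g) L (radial_kernel n (profile a g 0)).
Proof.
move=> n2 a0 ea g1; have g1' : -1 < g by lra.
have cs N := @asymp_zero_csch R N.
have jz m := jet_iter_radial_deriv (m := m) (N := 0) asymp_zero_compat asymp_zero_mul cs
   (jet_profile_zero 0 (0 + m) a0 g1).
have c0 : 0 < 1 + 2 * g + 0%:R :> R by rewrite addr0; lra.
have L0 : a ^+ 0 * gamma_int (2 * g + 0%:R) a != 0.
  by rewrite expr0 mul1r addr0 gt_eqF// gamma_int_gt0//; lra.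
rewrite /radial_kernel; case: (boolP (odd n)) => on.
  have [en _] := half_odd n2 on; have [L [L1 jL]] := jz n.-1./2.
  exists L; first by apply: L1 => //; rewrite oner_neq0.
  move: jL => /jet0; congr asymp_zero.
  by rewrite en addr0; ring.
have [en m1] := half_even n2 on; have [L [L1 jL]] := jz n./2.
have m1' : 1 <= n./2%:R :> R by rewrite ler1n.
have j1 : jet exp_bounded 0 1 (a + n./2%:R) 0 (iter n./2 (@radial_deriv R) (profile a g 0)).
  by apply: jet_bounded_iter_radial; exact: jet_profile_bounded.
have [A A0 HA] : exists2 A : R, 0 < A & asymp_zero ((1 + 2 * g + 0%:R + n./2%:R * (1 + 1)) - 1) (L * A)
    (abel_integral (iter n./2 (@radial_deriv R) (profile a g 0))).
  apply: (abel_asymp_zero (c := a + n./2%:R) _ j1 _ jL).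
    by move: (n./2%:R) m1' => z; lra.
  by rewrite addr0; move: (n./2%:R) m1' => z; lra.
exists (L * A); first by rewrite mulf_neq0 ?(gt_eqF A0)// L1// oner_neq0.
move: HA; congr asymp_zero.
by rewrite en addr0; ring.
Qed.

Lemma radial_kernel_profile_pinfty n a g : (2 <= n)%N -> 0 < a -> a = (n%:R - 1) / 2 ->
  -1 < g -> exists2 L, L != 0 &
  asymp_pinfty (fun r => r `^ (- 1 - g)) (n%:R - 1) L (radial_kernel n (profile a g 0)).
Proof.
move=> n2 a0 ea g1.
have cs N := @asymp_pinfty_csch R N.
have jz m := jet_iter_radial_deriv (m := m) (N := 0) (asymp_pinfty_compat _) (@asymp_pinfty_mul R _) cs
   (jet_profile_pinfty 0 (0 + m) a0 g1).
have L0 : a ^+ 0 * (2 `^ g * gamma_int g a) != 0.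
  by rewrite expr0 mul1r gt_eqF// mulr_gt0 ?powR_gt0 ?gamma_int_gt0.
have two0 : 2 != 0 :> R by rewrite pnatr_eq0.
rewrite /radial_kernel; case: (boolP (odd n)) => on.
  have [en _] := half_odd n2 on; have [L [L1 jL]] := jz n.-1./2.
  exists L; first exact: L1.
  move: jL => /jet0; congr asymp_pinfty.
  by rewrite ea en; field.
have [en m1] := half_even n2 on; have [L [L1 jL]] := jz n./2.
have m1' : 1 <= n./2%:R :> R by rewrite ler1n.
have j1 : jet exp_bounded 0 1 (a + n./2%:R) 0 (iter n./2 (@radial_deriv R) (profile a g 0)).
  by apply: jet_bounded_iter_radial; exact: jet_profile_bounded.
have c1 : 1 <= a + n./2%:R by move: (n./2%:R) m1' => z; lra.
have aF : asymp_pinfty (fun r => r `^ (- 1 - g)) (a + n./2%:R) L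
    (iter n./2 (@radial_deriv R) (profile a g 0)).
  by move: jL => /jet0; congr asymp_pinfty; rewrite add0r mulr1.
have [A A0 HA] := abel_asymp_pinfty c1 j1 g1 aF.
exists (L * A); first by rewrite mulf_neq0 ?(gt_eqF A0)// L1.
move: HA; congr asymp_pinfty.
by rewrite ea en; field.
Qed.

Lemma bessel_profileE n g : (2 <= n)%N -> -1 < g -> exists2 k : R, k != 0 &
  forall x, 0 < x -> bessel_profile n g x = k * profile ((n%:R - 1) / 2) g 0 x.
Proof.
move=> n2 g1; set a := (n%:R - 1) / 2.
have a0 : 0 < a by rewrite divr_gt0// subr_gt0 ltr1n.
exists (bessel_coef g * a `^ (1 / 2 + g)).
  rewrite gt_eqF// mulr_gt0 ?powR_gt0// divr_gt0 ?sqrtr_gt0 ?divr_gt0 ?pi_gt0//.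
  by rewrite mulr_gt0 ?powR_gt0 ?gamma_int_gt0.
move=> x x0; rewrite /bessel_profile -/a besselK_profile ?mulr_gt0//.
have -> : profile 1 g 0 (a * x) = profile a g 0 x.
  apply: eq_Rintegral => t _; rewrite !expr0 mul1r; congr (_ * expR (- _)); ring.
rewrite powRM ?(ltW a0) ?(ltW x0)//.
rewrite (_ : - (1 / 2) - g = - (1 / 2 + g)); last by ring.
rewrite powRN; field; rewrite gt_eqF ?powR_gt0//.
by rewrite subr_gt0 ltr1n.
Qed.

End radial_kernel.

Section pairing.
Context {R : realType}.
Local Notation T := (measurableTypeR R).

Lemma continuous_bump_integrable (K phi : R -> R) : bump phi ->
  (forall x : R, 0 < x -> {for x, continuous K}) ->
  mu.-integrable `]0, +oo[ (fun x => (K x * phi x)%:E).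
Proof.
move=> bp cK; have ip := bump_integrable bp.
have [/(_ 0%N 0) [[d d0 hd] _] [b b0 hb]] := bp.
have db : d <= d + b by rewrite lerDl ltW.
have cN : {within `[d, d + b], continuous (fun x => `|K x|)}.
  apply: continuous_in_subspaceT => x; rewrite inE/= in_itv/= => /andP[dx _].
  by apply: cvg_norm; apply: cK; exact: lt_le_trans dx.
have [z _ Hz] := EVT_max db cN.
apply: (dominated_integrable (g := fun x => `|K z| * `|phi x|)) => //.
- apply: measurable_funM; first exact: continuous_measurable_oy.
  by apply/measurable_EFinP; case/integrableP : ip.
- move=> x; rewrite /= in_itv/= andbT => x0; rewrite normrM.
  have [xd|dx] := leP x d; first by rewrite hd// normr0 !mulr0.
  have [bx|xb] := ltP b x; first by rewrite hb// normr0 !mulr0.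
  rewrite ler_wpM2r//; apply: Hz; rewrite in_itv/= (ltW dx)/=.
  by apply: (le_trans xb); rewrite lerDr ltW.
- by apply: integrable_scale => //; exact: (@integrable_norm _ T R mu _ _ ip).
Qed.

Lemma radial_kernel_pairing (n : nat) (gamma : R) : (2 <= n)%N -> - (1 / 2) < gamma -> gamma < 1 ->
  exists2 B : R, (gamma <> 0 -> B != 0) & forall phi : R -> R, test_function phi ->
   mu.-integrable setT (fun lambda => (paired_integrand n gamma phi lambda)%:E) /\
   \int[mu]_lambda paired_integrand n gamma phi lambda =
   B * \int[mu]_(x in `]0, +oo[) (radial_kernel n (profile ((n%:R - 1) / 2) gamma 0) x * phi x).
Proof.
move=> n2 g1 g2; have g1' : -1 < gamma by lra.
set a : R := (n%:R - 1) / 2.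
have a0 : 0 < a by rewrite divr_gt0// subr_gt0 ltr1n.
have [B B0 HB] := cos_transform_symbol a0 g1' g2.
exists (2 * B); first by move=> /B0 h; rewrite mulf_neq0// pnatr_eq0.
move=> phi tphi; have bp : bump phi by exact: test_function_decaying tphi.
have [h [c c0 dh] tr] := radial_kernel_transposition n2 bp.
have pE : paired_integrand n gamma phi = fun lam => (lam ^+ 2 + a ^+ 2) `^ gamma * cos_transform h lam.
  apply/funext => lam; rewrite /paired_integrand; congr (_ * _).
    by rewrite /frac_symbol /a; congr (_ `^ _); field.
  have sE : spectral_kernel n lam = radial_kernel n (fun r => cos (lam * r)) by [].
  rewrite sE (tr _ 0)//; first by apply: eq_Rintegral => x _; rewrite mulrC.
  exact: (exp_bounded_trig lam _ 0).1.
have i := symbol_cos_transform_integrable a0 g2 c0 dh.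
have S0 lam : 0 < lam ^+ 2 + a ^+ 2 by rewrite ltr_wpDl ?sqr_ge0 ?exprn_gt0.
have [iT eT] : mu.-integrable setT (EFin \o paired_integrand n gamma phi) /\
    \int[mu]_lam paired_integrand n gamma phi lam =
    2 * \int[mu]_(lam in `]0, +oo[) paired_integrand n gamma phi lam.
  rewrite pE; apply: even_integral => //.
    move=> lam; apply: cvgM; last exact: (continuous_cos_transform c0 (decaying_leq (isT : (1 <= 5)%N) dh)).
    have hc : {for lam, continuous (fun lam : R => (lam ^+ 2 + a ^+ 2) `^ gamma)}.
      by eapply is_derive_continuous; derive_rule; exact: S0.
    exact: hc.
  move=> lam; rewrite sqrrN; congr (_ * _).
  by apply: eq_Rintegral => x _; rewrite mulNr cosN.
split; first exact: iT.
rewrite eT pE (HB c h c0 dh) mulrA; congr (_ * _).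
rewrite (tr _ a (ltW a0) (jet_profile_bounded 0 _ 0 a0 g1')).
by apply: eq_Rintegral => x _; rewrite mulrC.
Qed.

End pairing.

Theorem theorem2p4 (R : realType) (n : nat) (gamma : R)
    (n_ge2 : (2 <= n)%N) (gamma_gt : - (1 / 2) < gamma) (gamma_lt1 : gamma < 1) :
  exists (alpha : R) (K : R -> R),
    is_frac_laplacian_kernel n gamma K /\
    (odd n -> forall rho : R, 0 < rho ->
       K rho =
       alpha * iter n.-1./2 (@radial_deriv R) (bessel_profile n gamma) rho) /\
    (~~ odd n -> forall rho : R, 0 < rho ->
       K rho =
       alpha * abel_integral
                 (iter n./2 (@radial_deriv R) (bessel_profile n gamma)) rho) /\
    (* at gamma = 0 the kernel vanishes off the diagonal, so the implicit
       constant is 0 there *)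
    equiv_upto_const (gamma <> 0) (0 : R)^'+ K
      (fun rho => rho `^ (- n%:R - 2 * gamma)) /\
    equiv_upto_const (gamma <> 0) (+oo_R) K
      (fun rho => rho `^ (-1 - gamma) * expR (- ((n%:R - 1) * rho))).
Proof.
have g1 : -1 < gamma by lra.
set a : R := (n%:R - 1) / 2.
have a0 : 0 < a by rewrite divr_gt0// subr_gt0 ltr1n.
have [B B0 HB] := radial_kernel_pairing n_ge2 gamma_gt gamma_lt1.
have [k k0 Hk] := bessel_profileE n_ge2 g1.
pose f := profile a gamma 0.
have jf : jet exp_bounded 0 (2 + n) a 0 f by exact: jet_profile_bounded.
pose K rho := B / k * radial_kernel n (bessel_profile n gamma) rho.
have KE rho : 0 < rho -> K rho = B * radial_kernel n f rho.
  move=> rho0; rewrite /K (radial_kernel_scale n_ge2 (ltW a0) jf Hk rho0).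
  by rewrite mulrA mulfVK.
exists (B / k), K; split; last split; last split; last split.
- split.
    move=> rho rho0.
    have h := continuous_radial_kernel n_ge2 (ltW a0) jf rho0.
    change (K y @[y --> rho] --> K rho); rewrite (KE _ rho0).
    have hB : B * radial_kernel n f y @[y --> rho] --> B * radial_kernel n f rho by exact: cvgMr h.
    apply: (cvg_trans _ hB); apply: near_eq_cvg; near=> y.
    by rewrite KE//; near: y; exact: lt_nbhsr.
  move=> phi tphi; have [i e] := HB phi tphi; split; first exact: i.
  rewrite e; have bp : bump phi by exact: test_function_decaying tphi.
  have ifp : mu.-integrable `]0, +oo[ (fun x => (radial_kernel n f x * phi x)%:E).
    apply: continuous_bump_integrable bp _ => x x0.
    exact: continuous_radial_kernel n_ge2 (ltW a0) jf x0.
  rewrite -RintegralZl; [|exact: measurable_itv|exact: ifp].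
  by apply: eq_Rintegral => x; rewrite inE/= in_itv/= andbT => x0; rewrite KE// mulrA.
- by move=> on rho rho0; rewrite /K /radial_kernel on.
- by move=> on rho rho0; rewrite /K /radial_kernel (negbTE on).
- have [L L0 HL] := radial_kernel_profile_zero n_ge2 a0 erefl gamma_gt.
  exists (B * L); split; first by move=> /B0 h; rewrite mulf_neq0.
  have hB : B * (radial_kernel n f x * x `^ (n%:R + 2 * gamma)) @[x --> 0^'+] --> B * L.
    exact: cvgMr HL.
  apply: (cvg_trans _ hB); apply: near_eq_cvg; near=> x.
  have x0 : 0 < x by near: x; exact: nbhs_right_gt.
  rewrite KE// (_ : - n%:R - 2 * gamma = - (n%:R + 2 * gamma)); last by ring.
  by rewrite powRN invrK mulrA.
- have [L L0 HL] := radial_kernel_profile_pinfty n_ge2 a0 erefl g1.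
  exists (B * L); split; first by move=> /B0 h; rewrite mulf_neq0.
  have hB : B * (radial_kernel n f x * expR ((n%:R - 1) * x) / x `^ (- 1 - gamma)) @[x --> +oo] --> B * L.
    exact: cvgMr HL.
  apply: (cvg_trans _ hB); apply: near_eq_cvg; near=> x.
  have x0 : 0 < x by near: x; exact: nbhs_pinfty_gt.
  by rewrite KE// invfM expRN invrK !mulrA mulrAC.
Unshelve. all: by end_near. Qed.
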